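(* There exists a constant $\varepsilon>0$ and an algorithm that, given a set $S\subseteq\mathcal{S}_d$ of $n$ rankings of $d$ candidates partitioned into $g\ge1$ groups (with strict-fairness parameters), finds a $(3-\varepsilon)$-approximate solution to the fair median problem ($q=1$ mean fair rank aggregation) under the Ulam metric, in time $O(nd^{g+2}+n^2d\log d)$.
   Context: Candidates $[d]$ are partitioned into groups $G_1,\dots,G_g$; fairness parameters are vectors $(\lambda_1,\dots,\lambda_g),(\mu_1,\dots,\mu_g)\in[0,1]^g$ and $k\in[d]$. A ranking $\sigma\in\mathcal{S}_d$ is fair (strict-$k$-fair) if every prefix $P$ of $\sigma$ with $|P|\ge k$ satisfies $\lfloor\lambda_i|P|\rfloor\le|P\cap G_i|\le\lceil\mu_i|P|\rceil$ for all $i$. Ulam distance $\mathcal{U}(\pi_1,\pi_2)=d-|\mathrm{LCS}(\pi_1,\pi_2)|$, where LCS is a longest common subsequence. The fair median problem asks for a fair $\sigma$ minimizing $\sum_{\pi\in S}\mathcal{U}(\pi,\sigma)$; a $(3-\varepsilon)$-approximate solution is a fair ranking with objective at most $(3-\varepsilon)$ times the optimum (a fair ranking is assumed to exist). *)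

(* Defs.v *)
From mathcomp Require Import all_boot all_order all_algebra all_fingroup.
From mathcomp Require Import reals.

Set Implicit Arguments.
Unset Strict Implicit.
Unset Printing Implicit Defensive.
Import Order.TTheory GRing.Theory Num.Theory.

Local Open Scope nat_scope.

(* A ranking s : 'S_d lists the candidates s 0, s 1, ..., s (d - 1), best
   first: s maps positions to candidates. *)
Definition ranking_seq d (s : 'S_d) : seq 'I_d := [seq s i | i <- enum 'I_d].

Definition prefix_set d (s : 'S_d) (p : nat) : {set 'I_d} :=
  [set s i | i : 'I_d & i < p].

Definition lcs_length (T : finType) (u v : seq T) : nat :=
  \max_(l < (size u).+1 |
        [exists t : l.-tuple T, subseq t u && subseq t v]) l.

Definition ulam d (s1 s2 : 'S_d) : nat :=
  d - lcs_length (ranking_seq s1) (ranking_seq s2).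

(* The partition of the candidates is given by the group of each candidate. *)
Definition candidates_of d g (grp : 'I_d -> 'I_g) (i : 'I_g) : {set 'I_d} :=
  [set c | grp c == i].

Definition fair (R : realType) d g (grp : 'I_d -> 'I_g)
    (lambda mu : 'I_g -> R) (k : nat) (s : 'S_d) : Prop :=
  forall (p : nat) (i : 'I_g), k <= p <= d ->
    let c : int := Posz #|prefix_set s p :&: candidates_of grp i| in
    (Num.floor (lambda i * p%:R) <= c <= Num.ceil (mu i * p%:R))%R.

Definition median_cost d (S : {set 'S_d}) (s : 'S_d) : nat :=
  \sum_(pi in S) ulam pi s.

Definition fair_median (R : realType) d g (grp : 'I_d -> 'I_g)
    (lambda mu : 'I_g -> R) (k : nat) (S : {set 'S_d}) (s : 'S_d) : Prop :=
  fair grp lambda mu k s /\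
  forall s', fair grp lambda mu k s' -> median_cost S s <= median_cost S s'.

Definition approx_fair_median (R : realType) (rho : R) d g
    (grp : 'I_d -> 'I_g) (lambda mu : 'I_g -> R) (k : nat)
    (S : {set 'S_d}) (s : 'S_d) : Prop :=
  fair grp lambda mu k s /\
  forall opt, fair_median grp lambda mu k S opt ->
    ((median_cost S s)%:R <= rho * (median_cost S opt)%:R)%R.

(* Algorithms are programs of a structured random-access machine with a
   memory indexed by nat and registers named by nat.  A program is a finite
   piece of syntax, fixed before the instance is known. *)

Variant binop := Add | Sub | Mul | Div | Mod | Eq | Leq.

(* [FloorLambda i p] and [CeilMu i p] compute floor (lambda_i * p) and
   ceil (mu_i * p): the fairness parameters are arbitrary reals, which the
   machine can only access through these roundings. *)
Inductive expr :=
| Const of nat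
| Reg of nat
| Read of expr
| Bin of binop & expr & expr
| FloorLambda of expr & expr
| CeilMu of expr & expr.

Inductive cmd :=
| Skip
| Assign of nat & expr
| Store of expr & expr   (* address, value *)
| Seq of cmd & cmd
| If of expr & cmd & cmd
| While of expr & cmd.

Record state := State { regs : nat -> nat; mem : nat -> nat }.

Definition update (f : nat -> nat) (x v : nat) : nat -> nat :=
  fun y => if y == x then v else f y.

Definition eval_binop (o : binop) (a b : nat) : nat :=
  match o with
  | Add => a + b
  | Sub => a - b
  | Mul => a * b
  | Div => a %/ b
  | Mod => a %% b
  | Eq => a == b
  | Leq => a <= b
  end.

Section Semantics.

Variables (floor_lambda ceil_mu : nat -> nat -> nat).
Variable (wbound : nat).

Fixpoint eval (st : state) (e : expr) : nat :=
  match e with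
  | Const m => m
  | Reg x => regs st x
  | Read a => mem st (eval st a)
  | Bin o e1 e2 => eval_binop o (eval st e1) (eval st e2)
  | FloorLambda i p => floor_lambda (eval st i) (eval st p)
  | CeilMu i p => ceil_mu (eval st i) (eval st p)
  end.

Fixpoint cost (e : expr) : nat :=
  match e with
  | Const _ | Reg _ => 1
  | Read a => (cost a).+1
  | Bin _ e1 e2 | FloorLambda e1 e2 | CeilMu e1 e2 => (cost e1 + cost e2).+1
  end.

(* [exec c st t st']: started in st, the program c halts in st' after t unit
   steps.  Every number written to a register or to the memory, and every
   address written to, must be less than wbound, otherwise the program is
   stuck; the intermediate values of an expression of a fixed program thus
   always fit in a constant number of words. *)
Inductive exec : cmd -> state -> nat -> state -> Prop :=
| ExecSkip st : exec Skip st 1 st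
| ExecAssign x e st :
    eval st e < wbound ->
    exec (Assign x e) st (cost e).+1
         (State (update (regs st) x (eval st e)) (mem st))
| ExecStore a e st :
    eval st a < wbound -> eval st e < wbound ->
    exec (Store a e) st (cost a + cost e).+1
         (State (regs st) (update (mem st) (eval st a) (eval st e)))
| ExecSeq c1 c2 st1 st2 st3 t1 t2 :
    exec c1 st1 t1 st2 -> exec c2 st2 t2 st3 ->
    exec (Seq c1 c2) st1 (t1 + t2) st3
| ExecIfTrue e c1 c2 st t st' :
    eval st e != 0 -> exec c1 st t st' ->
    exec (If e c1 c2) st (cost e + t).+1 st'
| ExecIfFalse e c1 c2 st t st' :
    eval st e = 0 -> exec c2 st t st' ->
    exec (If e c1 c2) st (cost e + t).+1 st'
| ExecWhileTrue e c st1 st2 st3 t1 t2 :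
    eval st1 e != 0 -> exec c st1 t1 st2 -> exec (While e c) st2 t2 st3 ->
    exec (While e c) st1 (cost e + t1 + t2).+1 st3
| ExecWhileFalse e c st :
    eval st e = 0 -> exec (While e c) st (cost e).+1 st.

End Semantics.

(* Both roundings of nonnegative reals are nonnegative, so absz is lossless
   for parameters in [0, 1]. *)
Definition floor_op (R : realType) g (lambda : 'I_g -> R) (i p : nat) : nat :=
  if insub i is Some j then absz (Num.floor (lambda j * p%:R)%R) else 0.

Definition ceil_op (R : realType) g (mu : 'I_g -> R) (i p : nat) : nat :=
  if insub i is Some j then absz (Num.ceil (mu j * p%:R)%R) else 0.

(* Memory layout of the input: n, d, g, k, then the groups of the d
   candidates, then the n rankings one after the other.  All other cells and
   all registers are initially 0. *)
Definition encode_input d g (grp : 'I_d -> 'I_g) (k : nat)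
    (rankings : seq 'S_d) : seq nat :=
  [:: size rankings; d; g; k]
    ++ [seq nat_of_ord (grp c) | c <- enum 'I_d]
    ++ flatten [seq [seq nat_of_ord c | c <- ranking_seq s] | s <- rankings].

Definition init_state (input : seq nat) : state :=
  State (fun=> 0) (fun a => nth 0 input a).

(* The output ranking is read in the first d memory cells. *)
Definition outputs d (st : state) (s : 'S_d) : Prop :=
  forall i : 'I_d, mem st i = s i.

(* trunc_log 2 d is floor (log2 d). *)
Definition time_bound (n d g : nat) : nat :=
  n * d ^ (g + 2) + n ^ 2 * d * trunc_log 2 d.

(* Words have O(log (n d^(g+2))) bits, as needed to address a memory of size
   n d^(g+2). *)
Definition word_bound (C n d g : nat) : nat := (C + n * d ^ (g + 2)) ^ C.

(* Main.v *)
(* The algorithm returns the cheapest of the fair rankings f(s), for s in S, and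
   f(tau), where f(s) is a closest fair ranking to s and tau is a ranking built
   from majorities.

   Let opt be a fair median, OPT its cost, n = #|S|, I_s the set of candidates
   outside a longest common subsequence of s and opt, c_a the number of s with
   a in I_s, and Q the sum of the c_a ^ 2.  Candidates outside I_s and I_s' are
   ordered alike by s and s', so U(s, s') <= |I_s| + |I_s'| - |I_s & I_s'|, and
   averaging the cost of f(s) over s gives n * best + Q <= 3 * n * OPT.

   Call a bad if c_a >= n / 6.  Two good candidates are ordered as in opt by
   more than two thirds of S.  A pair without a two-thirds majority therefore
   contains a bad candidate, and deleting a maximal matching of such pairs
   leaves a tournament of two-thirds majorities, which is transitive since a
   3-cycle would need n inversions in total.  If tau lists it in this order,
   then U(tau, opt) <= 2 * #bad, with n ^ 2 * #bad <= 36 * Q; hence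
   n * best <= n * OPT + 144 * Q.  The two bounds yield
   145 * best <= 433 * OPT, that is, the ratio 3 - 2 / 145.

   A closest fair ranking is found by dynamic programming over the vector of
   group counts of a prefix and a position in s: each next candidate is either
   matched with s or a filler of which only the group matters.  Costs are
   computed by patience sorting with binary search. *)
Require Import Defs.
From mathcomp Require Import all_boot all_order all_algebra all_fingroup.
From mathcomp Require Import reals zify lra.

(** The two bounds on [best] pull in opposite directions: a large overlap Q favours the rankings
    f(s), a small one favours f([tau]). Both rest on f(x) being no farther from x than the fair
    ranking [opt]. The threshold n / 6 makes two good candidates inverted in fewer than n / 6 + n /
    6 rankings, a third of S, which is what the exclusion of 3-cycles tolerates.

    This leaves about d ^ (g + 1) cells, each with g + 2 options. Nonempty groups give g <= d, hence
    O(d ^ (g + 2)) per table, with one table per ranking and one for [tau]; the n + 1 cost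
    evaluations account for n ^ 2 * d * log d.

    The program and the constants precede the instance, so neither the layout of the arrays nor the
    value of C may depend on d, g or n: arrays are interleaved, so that each may grow, and time is
    bounded by a factor read off the syntax times the product of the loop lengths. *)

Set Implicit Arguments.
Unset Strict Implicit.
Unset Printing Implicit Defensive.
Local Open Scope nat_scope.

(** * A machine with arrays, and its program logic *)

(* Registers and arrays ("zones") of an idealised machine.  Zone 0 is the part
   of the real memory below [lim], which holds the input and receives the
   output; the zones z with 0 < z < nzones are interleaved above it. *)
Inductive aexpr :=
| AConst of nat
| AReg of nat
| AGet of nat & aexpr
| ABin of binop & aexpr & aexpr
| AFloor of aexpr & aexpr
| ACeil of aexpr & aexpr.

Inductive acmd :=
| ASet of nat & aexpr
| AIn of nat & aexpr
| APut of nat & aexpr & aexpr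
| AOut of aexpr & aexpr
| ASeq of acmd & acmd
| AIf of aexpr & acmd & acmd
| ASkip
| AFor of nat & nat & acmd.

Record astate := AState { rg : nat -> nat; zn : nat -> nat -> nat }.

Definition upd (T : Type) (f : nat -> T) (x : nat) (v : T) : nat -> T :=
  fun y => if y == x then v else f y.
Arguments upd T f x v y /.

Definition setr (st : astate) x v := AState (upd (rg st) x v) (zn st).
Definition setz (st : astate) z a v :=
  AState (rg st) (upd (zn st) z (fun o => if o == a then v else zn st z o)).

(** Interleaving with a fixed stride lets every array grow without a size known at compile time. The
    stride exceeds the largest zone number in use, 16. *)
Definition nzones := 20.

(** Real register 0 holds [lim], which depends on the input and cannot be a constant of the program;
    the other registers are shifted by one. *)
Fixpoint comp_expr (e : aexpr) : expr :=
  match e with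
  | AConst m => Const m
  | AReg x => Reg x.+1
  | AGet z e => Read (Bin Add (Reg 0) (Bin Add (Const z)
                       (Bin Mul (Const nzones) (comp_expr e))))
  | ABin o e1 e2 => Bin o (comp_expr e1) (comp_expr e2)
  | AFloor e1 e2 => FloorLambda (comp_expr e1) (comp_expr e2)
  | ACeil e1 e2 => CeilMu (comp_expr e1) (comp_expr e2)
  end.

Fixpoint comp (c : acmd) : cmd :=
  match c with
  | ASet x e => Assign x.+1 (comp_expr e)
  | AIn x e => Assign x.+1 (Read (comp_expr e))
  | APut z a e => Store (Bin Add (Reg 0) (Bin Add (Const z)
                       (Bin Mul (Const nzones) (comp_expr a)))) (comp_expr e)
  | AOut a e => Store (comp_expr a) (comp_expr e)
  | ASeq c1 c2 => Seq (comp c1) (comp c2)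
  | AIf e c1 c2 => If (comp_expr e) (comp c1) (comp c2)
  | ASkip => Skip
  | AFor x y c =>
      Seq (Assign x.+1 (Const 0))
          (While (Bin Leq (Bin Add (Reg x.+1) (Const 1)) (Reg y.+1))
             (Seq (comp c) (Assign x.+1 (Bin Add (Reg x.+1) (Const 1)))))
  end.

Fixpoint wrg (c : acmd) : seq nat :=
  match c with
  | ASet x _ | AIn x _ => [:: x]
  | ASeq c1 c2 | AIf _ c1 c2 => wrg c1 ++ wrg c2
  | AFor x _ c => x :: wrg c
  | _ => [::]
  end.

Fixpoint wzn (c : acmd) : seq nat :=
  match c with
  | APut z _ _ => [:: z]
  | AOut _ _ => [:: 0]
  | ASeq c1 c2 | AIf _ c1 c2 => wzn c1 ++ wzn c2
  | AFor _ _ c => wzn c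
  | _ => [::]
  end.

Fixpoint wf_expr (e : aexpr) : bool :=
  match e with
  | AGet z e => (0 < z < nzones) && wf_expr e
  | ABin _ e1 e2 | AFloor e1 e2 | ACeil e1 e2 => wf_expr e1 && wf_expr e2
  | _ => true
  end.

(** A loop may overwrite neither its counter nor its bound, so the number of iterations is fixed on
    entry and termination needs no variant. *)
Fixpoint wf (c : acmd) : bool :=
  match c with
  | ASet _ e | AIn _ e => wf_expr e
  | APut z a e => [&& 0 < z < nzones, wf_expr a & wf_expr e]
  | AOut a e => wf_expr a && wf_expr e
  | ASeq c1 c2 => wf c1 && wf c2
  | AIf e c1 c2 => [&& wf_expr e, wf c1 & wf c2]
  | ASkip => true
  | AFor x y c => [&& x != y, x \notin wrg c, y \notin wrg c & wf c]
  end.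

(* Constant factor of the running time: a command whose loops nest to at most
   W iterations takes at most [size_cmd c * W] steps. *)
Fixpoint size_cmd (c : acmd) : nat :=
  match c with
  | ASet _ e => (cost (comp_expr e)).+1
  | AIn _ e => (cost (comp_expr e)).+2
  | APut _ a e => cost (comp_expr a) + cost (comp_expr e) + 10
  | AOut a e => (cost (comp_expr a) + cost (comp_expr e)).+1
  | ASeq c1 c2 => size_cmd c1 + size_cmd c2
  | AIf e c1 c2 => (cost (comp_expr e) + size_cmd c1 + size_cmd c2).+1
  | ASkip => 1
  | AFor _ _ c => size_cmd c + 10
  end.

Definition frame (c : acmd) (st st' : astate) :=
  (forall x, x \notin wrg c -> rg st' x = rg st x) /\
  (forall z, z \notin wzn c -> zn st' z = zn st z).

Section Machine.

(* [ab] bounds all values written and all indices used in arrays. *)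
Variables (fl ce : nat -> nat -> nat) (lim ab wb : nat).
Hypothesis wb_large : lim + nzones * ab.+1 <= wb.

Fixpoint aeval (st : astate) (e : aexpr) : nat :=
  match e with
  | AConst m => m
  | AReg x => rg st x
  | AGet z e => zn st z (aeval st e)
  | ABin o e1 e2 => eval_binop o (aeval st e1) (aeval st e2)
  | AFloor i p => fl (aeval st i) (aeval st p)
  | ACeil i p => ce (aeval st i) (aeval st p)
  end.

Definition sim (st : astate) (s : state) :=
  [/\ regs s 0 = lim,
      forall x, regs s x.+1 = rg st x,
      forall o, o < lim -> Defs.mem s o = zn st 0 o &
      forall z o, 0 < z < nzones -> Defs.mem s (lim + (z + nzones * o)) = zn st z o].

(* Total correctness with three built-in side conclusions: the running time is
   at most [size_cmd c * W], so that no numeral ever occurs in a time bound, the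
   result is related to a state of the real machine, and whatever c does not
   mention is unchanged. *)
Definition wp W (c : acmd) (Q : astate -> Prop) (st : astate) :=
  wf c -> forall s, sim st s -> exists t s' st',
    [/\ exec fl ce wb (comp c) s t s', t <= size_cmd c * W, sim st' s',
        frame c st st' & Q st'].

Lemma eval_comp st s e : sim st s -> wf_expr e ->
  eval fl ce s (comp_expr e) = aeval st e.
Proof.
case=> s0 sr _ sz; elim: e => //=.
- by move=> z e IH /andP[hz /IH ->]; rewrite s0 sz.
- by move=> o e1 IH1 e2 IH2 /andP[/IH1 -> /IH2 ->].
- by move=> e1 IH1 e2 IH2 /andP[/IH1 -> /IH2 ->].
by move=> e1 IH1 e2 IH2 /andP[/IH1 -> /IH2 ->].
Qed.

Lemma sim_setr st s x v : sim st s ->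
  sim (setr st x v) (State (update (regs s) x.+1 v) (Defs.mem s)).
Proof.
case=> s0 sr sl sz; split=> //= y; rewrite /update /upd eqSS.
by case: (eqVneq y x).
Qed.

Lemma wp_set W x e (Q : astate -> Prop) st :
  0 < W -> aeval st e < ab -> Q (setr st x (aeval st e)) ->
  wp W (ASet x e) Q st.
Proof.
move=> W0 hv hQ /= hwf s hs; have he := eval_comp hs hwf.
do 3 eexists; split; last exact: hQ.
- by apply: ExecAssign; rewrite he; move: wb_large hv; rewrite /nzones; lia.
- by rewrite -{1}[(cost _).+1]muln1 leq_mul2l W0 orbT.
- by rewrite he; exact: sim_setr.
by split=> //= y; rewrite inE => /negbTE ->.
Qed.

Lemma wp_in W x e (Q : astate -> Prop) st :
  0 < W -> aeval st e < lim -> zn st 0 (aeval st e) < ab ->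
  Q (setr st x (zn st 0 (aeval st e))) -> wp W (AIn x e) Q st.
Proof.
move=> W0 ha hv hQ /= hwf s hs; have he := eval_comp hs hwf.
have hr : eval fl ce s (Read (comp_expr e)) = zn st 0 (aeval st e).
  by case: hs => _ _ sl _ /=; rewrite he sl.
do 3 eexists; split; last exact: hQ.
- by apply: ExecAssign; rewrite hr; move: wb_large hv; rewrite /nzones; lia.
- by rewrite /= -{1}[(cost _).+2]muln1 leq_mul2l W0 orbT.
- by rewrite hr; exact: sim_setr.
by split=> //= y; rewrite inE => /negbTE ->.
Qed.

Lemma wp_put W z a e (Q : astate -> Prop) st :
  0 < W -> aeval st a < ab -> aeval st e < ab ->
  Q (setz st z (aeval st a) (aeval st e)) -> wp W (APut z a e) Q st.
Proof.
move=> W0 ha hv hQ /= /and3P[hz hwa hwe] s hs.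
have hea := eval_comp hs hwa; have hee := eval_comp hs hwe.
case: (hs) => s0 sr sl sz.
do 3 eexists; split; last exact: hQ.
- apply: ExecStore; rewrite /= ?hea ?hee ?s0; move: wb_large ha hv hz;
    rewrite /nzones; lia.
- rewrite /=; apply: leq_trans (leq_pmulr _ W0); lia.
- rewrite /= hea hee s0; split=> //= [o ho | z' o hz']; rewrite /update /upd.
    case: eqP => [|_]; first by move: ho; lia.
    by case: eqP hz => [<-|_ _]; [rewrite ltnn | exact: sl].
  (* Zones lie below the stride, so equal addresses have equal zones and equal offsets. *)
  rewrite eqn_add2l; case: (z' =P z) => [->|nz].
    rewrite eqn_add2l eqn_mul2l /=; case: eqP => // _; exact: sz.
  case: eqP => [|_]; last exact: sz.
  by move: hz hz' nz; rewrite /nzones; lia.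
by split=> //= y; rewrite inE => /negbTE ->.
Qed.

Lemma wp_out W a e (Q : astate -> Prop) st :
  0 < W -> aeval st a < lim -> aeval st e < ab ->
  Q (setz st 0 (aeval st a) (aeval st e)) -> wp W (AOut a e) Q st.
Proof.
move=> W0 ha hv hQ /= /andP[hwa hwe] s hs.
have hea := eval_comp hs hwa; have hee := eval_comp hs hwe.
case: (hs) => s0 sr sl sz.
do 3 eexists; split; last exact: hQ.
- apply: ExecStore; rewrite /= ?hea ?hee; move: wb_large ha hv;
    rewrite /nzones; lia.
- rewrite /=; apply: leq_trans (leq_pmulr _ W0); lia.
- rewrite /= hea hee; split=> //= [o ho | z' o hz']; rewrite /update /upd.
    by case: eqP => //= _; exact: sl.
  case: eqP => [|_]; first by move: ha hz'; lia.
  by case: (z' =P 0) hz' => [->|_ ?]; [rewrite ltnn | exact: sz].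
by split=> //= y; rewrite inE => /negbTE ->.
Qed.

Lemma wp_skip W (Q : astate -> Prop) st : 0 < W -> Q st -> wp W ASkip Q st.
Proof.
move=> W0 hQ _ s hs; exists 1, s, st; split=> //.
- exact: ExecSkip.
- by rewrite mul1n.
Qed.

Lemma frame_trans c1 c2 c st1 st2 st3 :
  {subset wrg c1 <= wrg c} -> {subset wrg c2 <= wrg c} ->
  {subset wzn c1 <= wzn c} -> {subset wzn c2 <= wzn c} ->
  frame c1 st1 st2 -> frame c2 st2 st3 -> frame c st1 st3.
Proof.
move=> r1 r2 z1 z2 [fr1 fz1] [fr2 fz2]; split=> x hx.
  by rewrite fr2 ?fr1 //; apply: contra hx; [exact: r1 | exact: r2].
by rewrite fz2 ?fz1 //; apply: contra hx; [exact: z1 | exact: z2].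
Qed.

Lemma wp_seq W c1 c2 Q st :
  wp W c1 (wp W c2 Q) st -> wp W (ASeq c1 c2) Q st.
Proof.
move=> h1 /= /andP[w1 w2] s hs.
case: (h1 w1 s hs) => t1 [s1 [st1 [e1 l1 sm1 f1 h2]]].
case: (h2 w2 s1 sm1) => t2 [s2 [st2 [e2 l2 sm2 f2 hQ]]].
exists (t1 + t2), s2, st2; split=> //.
- exact: ExecSeq e1 e2.
- by rewrite mulnDl leq_add.
apply: frame_trans f1 f2 => x /=; rewrite mem_cat => ->; rewrite ?orbT //.
Qed.

Lemma wp_if W e c1 c2 (Q : astate -> Prop) st : 0 < W ->
  (aeval st e != 0 -> wp W c1 Q st) -> (aeval st e = 0 -> wp W c2 Q st) ->
  wp W (AIf e c1 c2) Q st.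
Proof.
clear wb_large ab.
move=> W0 h1 h2 /= /and3P[we w1 w2] s hs; have he := eval_comp hs we.
have [z|nz] := eqVneq (aeval st e) 0.
  case: (h2 z w2 s hs) => t [s' [st' [e2 l2 sm2 [fr fz] hQ]]].
  exists (cost (comp_expr e) + t).+1, s', st'; split=> //.
  - by apply: ExecIfFalse; rewrite ?he.
  - rewrite /= mulSn !mulnDl.
    by move: l2 (leq_pmulr (cost (comp_expr e)) W0); lia.
  by split=> x; rewrite /= mem_cat negb_or => /andP[_]; [exact: fr | exact: fz].
case: (h1 nz w1 s hs) => t [s' [st' [e2 l2 sm2 [fr fz] hQ]]].
exists (cost (comp_expr e) + t).+1, s', st'; split=> //.
- by apply: ExecIfTrue; rewrite ?he.
- rewrite /= mulSn !mulnDl.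
  by move: l2 (leq_pmulr (cost (comp_expr e)) W0); lia.
by split=> x; rewrite /= mem_cat negb_or => /andP[hx _]; [exact: fr | exact: fz].
Qed.

Lemma wp_cons W W' c (Q Q' : astate -> Prop) st :
  W <= W' -> wp W c Q st ->
  (forall st', frame c st st' -> Q st' -> Q' st') -> wp W' c Q' st.
Proof.
move=> hW h hQ w s hs; case: (h w s hs) => t [s' [st' [e l sm f q]]].
exists t, s', st'; split=> //; last exact: hQ.
by apply: leq_trans l _; rewrite leq_mul2l hW orbT.
Qed.

(** An iteration spends 6 steps on its test and 4 on the increment, the 10 in [size_cmd]; the
    initialisation (2) and the failing test (6) fit in the extra iteration of [(rg st y).+1]. The
    body is verified under the frame of the whole loop, so that [I] has to describe only what
    changes. *)
Lemma wp_for (I : nat -> astate -> Prop) W W' x y c (Q : astate -> Prop) st :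
  rg st y < ab -> 0 < W -> (rg st y).+1 * W <= W' ->
  I 0 (setr st x 0) ->
  (forall i s, i < rg st y -> frame (AFor x y c) st s -> rg s x = i ->
     I i s -> wp W c (fun s' => I i.+1 (setr s' x i.+1)) s) ->
  (forall s, frame (AFor x y c) st s -> I (rg st y) s -> Q s) ->
  wp W' (AFor x y c) Q st.
Proof.
move=> hy W0 hW h0 hS hQ hwf.
case/and4P: (hwf) => nxy nx ny w s hs.
set n := rg st y in hy hW hS hQ *.
have step m : m <= n -> forall st1 s1, sim st1 s1 -> frame (AFor x y c) st st1 ->
  rg st1 x = n - m -> I (n - m) st1 ->
  exists t s' st', [/\ exec fl ce wb
    (While (Bin Leq (Bin Add (Reg x.+1) (Const 1)) (Reg y.+1))
      (Seq (comp c) (Assign x.+1 (Bin Add (Reg x.+1) (Const 1))))) s1 t s',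
    t <= m * (size_cmd c + 10) * W + 6, sim st' s', frame (AFor x y c) st st' &
    I n st'].
  elim: m => [|m IH] lm st1 s1 sm1 f1 hx1 i1.
    exists 6, s1, st1; rewrite subn0 in hx1 i1; split=> //.
    apply: (@ExecWhileFalse _ _ _ (Bin Leq (Bin Add (Reg x.+1) (Const 1)) (Reg y.+1))).
    case: sm1 => _ sr _ _; rewrite /= !sr hx1 f1.1; first by rewrite addn1 ltnn.
    by rewrite inE negb_or ny eq_sym nxy.
  have hy1 : rg st1 y = n by rewrite f1.1 // inE negb_or ny eq_sym nxy.
  have lt1 : n - m.+1 < n by move: lm; lia.
  case: (hS _ _ lt1 f1 hx1 i1 w s1 sm1) => t1 [s2 [st2 [e1 l1 sm2 f2 i2]]].
  have hx2 : rg st2 x = n - m.+1 by rewrite f2.1.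
  have nS : (n - m.+1).+1 = n - m by move: lm; lia.
  rewrite nS in i2.
  have f3 : frame (AFor x y c) st (setr st2 x (n - m)).
    split=> [v hv|v hv] /=; last by rewrite f2.2 ?f1.2.
    move: hv; rewrite /= inE negb_or => /andP[vx vc].
    by rewrite (negbTE vx) f2.1 // f1.1 // inE negb_or vx.
  have x3 : rg (setr st2 x (n - m)) x = n - m by rewrite /= eqxx.
  case: (IH (ltnW lm) _ _ (sim_setr x (n - m) sm2) f3 x3 i2)
    => t4 [s4 [st4 [e4 l4 sm4 f4 i4]]].
  exists (5 + (t1 + 4) + t4).+1, s4, st4; split=> //.
    apply: (@ExecWhileTrue _ _ _ (Bin Leq (Bin Add (Reg x.+1) (Const 1)) (Reg y.+1)))
      e4.
      by case: sm1 => _ sr _ _; rewrite /= !sr hx1 hy1 addn1 lt1.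
    apply: ExecSeq e1 _.
    have -> : n - m = eval fl ce s2 (Bin Add (Reg x.+1) (Const 1)).
      by case: sm2 => _ sr _ _; rewrite /= sr hx2 addn1.
    apply: (@ExecAssign _ _ _ x.+1 (Bin Add (Reg x.+1) (Const 1))).
    case: sm2 => _ sr _ _; rewrite /= sr hx2; move: wb_large hy lm.
    by rewrite /nzones; lia.
  move: l1 l4 W0; rewrite !mulSn !mulnDl; lia.
have f0 : frame (AFor x y c) st (setr st x 0).
  by split=> //= v; rewrite inE negb_or => /andP[/negbTE ->].
case: (step n (leqnn n) _ _ (sim_setr x 0 hs) f0 _ _).
- by rewrite subnn /= eqxx.
- by rewrite subnn.
move=> t [s' [st' [e l sm f i]]]; exists (2 + t), s', st'; split=> //.
- apply: ExecSeq e; apply: (@ExecAssign _ _ _ x.+1 (Const 0)).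
  by move: wb_large; rewrite /nzones /=; lia.
- have : (size_cmd c + 10) * (n.+1 * W) <= size_cmd (AFor x y c) * W'.
    by rewrite leq_mul2l hW orbT.
  apply: leq_trans; move: l W0; rewrite mulnA [_ * n.+1]mulnC mulSn !mulnDl; nia.
exact: hQ.
Qed.

End Machine.

(** * Ulam distance *)

Section Ulam.

Variable d : nat.
Implicit Types (s : 'S_d) (K : {set 'I_d}).

Definition pos s (a : 'I_d) : nat := (s^-1)%g a.

Lemma pos_inj s : injective (pos s).
Proof. by move=> a b /val_inj /perm_inj. Qed.

Lemma pos_perm s (p : 'I_d) : pos s (s p) = p.
Proof. by rewrite /pos permK. Qed.

(** A strictly sorted sequence is determined by its elements, so a sequence with increasing
    positions is the ranking filtered by membership in it. *)
Lemma subseq_ranking s (t : seq 'I_d) :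
  subseq t (ranking_seq s) = sorted ltn (map (pos s) t).
Proof.
have -> : subseq t (ranking_seq s) = subseq (map (s^-1)%g t) (enum 'I_d).
  apply/idP/idP => [/(map_subseq (s^-1)%g) | /(map_subseq s)].
    by rewrite /ranking_seq -map_comp (eq_map (permK s)) map_id.
  by rewrite -map_comp (eq_map (permKV s)) map_id.
have -> : map (pos s) t = map val (map (s^-1)%g t) by rewrite -map_comp.
set u := map _ t; apply/idP/idP => [/(map_subseq val) | su].
  rewrite val_enum_ord => /subseq_sorted; apply; first exact: ltn_trans.
  exact: iota_ltn_sorted.
suff -> : u = filter (mem u) (enum 'I_d) by exact: filter_subseq.
apply: (inj_map val_inj); apply: (irr_sorted_eq ltn_trans ltnn su).
  have := @subseq_sorted _ ltn ltn_trans _ _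
    (map_subseq val (filter_subseq (mem u) (enum 'I_d))).
  by apply; rewrite val_enum_ord iota_ltn_sorted.
by apply: eq_mem_map => x; rewrite mem_filter mem_enum andbT.
Qed.

Lemma lcs_length_ge (T : finType) (u v t : seq T) :
  subseq t u -> subseq t v -> size t <= lcs_length u v.
Proof.
move=> tu tv; have st : size t < (size u).+1 by rewrite ltnS size_subseq.
apply: (@leq_bigmax_cond _ _ (@nat_of_ord _) (Ordinal st)).
by apply/existsP; exists (in_tuple t); rewrite /= tu.
Qed.

Lemma lcs_length_ex (T : finType) (u v : seq T) :
  exists t, [/\ subseq t u, subseq t v & size t = lcs_length u v].
Proof.
have h0 : [exists t : 0.-tuple T, subseq t u && subseq t v].
  by apply/existsP; exists [tuple]; rewrite /= !sub0seq.
have [|[l hl] /= /existsP[t /andP[tu tv]] e] :=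
  @eq_bigmax_cond _ [pred l : 'I_(size u).+1 |
    [exists t : l.-tuple T, subseq t u && subseq t v]] (@nat_of_ord _).
  by apply/card_gt0P; exists ord0.
by exists t; split=> //; rewrite size_tuple -[LHS]e.
Qed.

Lemma ranking_uniq s : uniq (ranking_seq s).
Proof. by rewrite map_inj_uniq ?enum_uniq //; exact: perm_inj. Qed.

Lemma mem_ranking s a : a \in ranking_seq s.
Proof. by apply/mapP; exists ((s^-1)%g a); rewrite ?mem_enum ?permKV. Qed.

(** By [ulam_agree] and [ulam_agree_ex], the Ulam distance is the least size of the complement of a
    set on which two rankings agree; symmetry, the triangle inequality and the overlap bound become
    set operations on such K. *)
Definition agree s1 s2 K : Prop :=
  {in K &, forall a b, (pos s1 a < pos s1 b) = (pos s2 a < pos s2 b)}.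

Lemma ulam_agree s1 s2 K : agree s1 s2 K -> ulam s1 s2 <= #|~: K|.
Proof.
move=> hK; pose t := filter (mem K) (ranking_seq s1).
have tin : all (mem K) t by exact: filter_all.
have t1 : subseq t (ranking_seq s1) by exact: filter_subseq.
have t2 : subseq t (ranking_seq s2).
  move: (t1); rewrite !subseq_ranking !sorted_map; apply: etrans.
  by apply/esym/(eq_in_sorted _ tin) => a b /= ha hb; exact: hK.
have := lcs_length_ge t1 t2; rewrite /ulam.
have : #|K| + #|~: K| = d by rewrite cardsC card_ord.
have -> : #|K| = size t.
  have /card_uniqP <- : uniq t by rewrite filter_uniq ?ranking_uniq.
  by apply: eq_card => x; rewrite mem_filter mem_ranking andbT.
by move=> e l; rewrite leq_subLR -[X in X <= _]e leq_add2r.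
Qed.

Lemma ulam_agree_ex s1 s2 : exists2 K, agree s1 s2 K & ulam s1 s2 = #|~: K|.
Proof.
have [t [t1 t2 st]] := lcs_length_ex (ranking_seq s1) (ranking_seq s2).
have ut : uniq t by exact: subseq_uniq t1 (ranking_uniq s1).
have lt_index s : subseq t (ranking_seq s) ->
    {in t &, forall a b, (pos s a < pos s b) = (index a t < index b t)}.
  rewrite subseq_ranking sorted_map => ht.
  have tr : transitive (relpre (pos s) ltn) by move=> x y z; exact: ltn_trans.
  move=> a b ha hb; have := sorted_ltn_index tr ht a b ha hb => hab.
  have := sorted_ltn_index tr ht b a hb ha => hba.
  case: (ltngtP (index a t) (index b t)) => [/hab //|/hba /= h|h].
    by rewrite ltnNge ltnW.
  by rewrite -[a](nth_index a ha) h nth_index ?ltnn.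
exists [set x in t].
  by move=> a b; rewrite !inE => ha hb; rewrite !lt_index.
have : #|[set x in t]| + #|~: [set x in t]| = d by rewrite cardsC card_ord.
by rewrite cardsE (card_uniqP ut) st /ulam => e; rewrite -[X in X - _]e addKn.
Qed.

Lemma agree_sym s1 s2 K : agree s1 s2 K -> agree s2 s1 K.
Proof. by move=> h a b ha hb; rewrite h. Qed.

Lemma agree_trans s1 s2 s3 K1 K2 :
  agree s1 s2 K1 -> agree s2 s3 K2 -> agree s1 s3 (K1 :&: K2).
Proof.
move=> h1 h2 a b; rewrite !inE => /andP[a1 a2] /andP[b1 b2].
by rewrite h1 ?h2.
Qed.

Lemma ulam_sym s1 s2 : ulam s1 s2 = ulam s2 s1.
Proof.
apply/eqP; rewrite eqn_leq; apply/andP; split.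
  by have [K /agree_sym/ulam_agree h ->] := ulam_agree_ex s2 s1.
by have [K /agree_sym/ulam_agree h ->] := ulam_agree_ex s1 s2.
Qed.

Lemma ulam_triangle s1 s2 s3 : ulam s1 s3 <= ulam s1 s2 + ulam s2 s3.
Proof.
have [K1 h1 ->] := ulam_agree_ex s1 s2; have [K2 h2 ->] := ulam_agree_ex s2 s3.
apply: leq_trans (ulam_agree (agree_trans h1 h2)) _.
by rewrite setCI cardsU leq_subr.
Qed.

Lemma ulam_le s1 s2 : ulam s1 s2 <= d.
Proof. exact: leq_subr. Qed.

End Ulam.

(** * The majority ranking and the approximation ratio *)

Section RankOrder.

Variables (d : nat) (lt : rel 'I_d).
Hypotheses (lt_irr : irreflexive lt) (lt_tr : transitive lt).
Hypothesis lt_total : forall a b, a != b -> lt a b || lt b a.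

(** The position of a in the listing sorted by [lt]; a program obtains it by counting predecessors,
    without a sorting routine. *)
Definition order_rank (a : 'I_d) : nat := #|[set b | lt b a]|.

Lemma order_rank_lt a : order_rank a < d.
Proof.
rewrite /order_rank -[X in _ < X]card_ord -[X in _ < X]cardsT proper_card //.
apply/properP; split; first exact: subsetT.
by exists a; rewrite !inE ?lt_irr.
Qed.

Lemma order_rank_homo a b : lt a b -> order_rank a < order_rank b.
Proof.
move=> ab; apply/proper_card/properP; split.
  by apply/subsetP => x; rewrite !inE => xa; exact: lt_tr xa ab.
by exists a; rewrite !inE ?lt_irr.
Qed.

Lemma order_rankE a b : (order_rank a < order_rank b) = lt a b.
Proof.
apply/idP/idP => [|/order_rank_homo //].
have [->|ne] := eqVneq a b; first by rewrite ltnn.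
have /orP[//|/order_rank_homo ba] := lt_total ne.
by rewrite ltnNge ltnW.
Qed.

Lemma order_rank_inj : injective order_rank.
Proof.
move=> a b e; apply/eqP/negPn/negP => ne.
by have /orP[] := lt_total ne; rewrite -order_rankE e ltnn.
Qed.

Lemma order_perm : exists s : 'S_d, forall a, pos s a = order_rank a.
Proof.
have inj : injective (fun a => Ordinal (order_rank_lt a)).
  by move=> a b [] /order_rank_inj.
exists ((perm inj)^-1)%g => a; by rewrite /pos invgK permE.
Qed.

End RankOrder.

(** * Two-thirds majorities as an order *)

Section RelativeOrder.

Variables (d : nat) (S : {set 'S_d}).
Implicit Types (a b : 'I_d).

Definition inversions a b : nat := #|[set s in S | pos s b < pos s a]|.

Definition contested a b : bool :=
  (#|S| <= 3 * inversions a b) && (#|S| <= 3 * (#|S| - inversions a b)).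

Lemma inversionsC a b : a != b -> inversions a b + inversions b a = #|S|.
Proof.
move=> ab; rewrite /inversions -(cardsID [set s | pos s b < pos s a] S).
congr (_ + _); apply: eq_card => s; rewrite !inE //.
rewrite -leqNgt ltn_neqAle andbC (inj_eq (@pos_inj _ s)) ab.
by rewrite andbC.
Qed.

Lemma inversions_id a : inversions a a = 0.
Proof.
by apply/eqP; rewrite cards_eq0; apply/eqP/setP => s; rewrite !inE ltnn andbF.
Qed.

Variable del : {set 'I_d}.

(* Non-deleted candidates come first, in majority order; the deleted ones
   follow by index. *)
Definition before a b : bool :=
  if b \in del then (a \in del) ==> (a < b)
  else (a \notin del) && (3 * (#|S| - inversions b a) < #|S|).

Hypothesis S_gt0 : 0 < #|S|.
Hypothesis uncontested : {in ~: del &, forall a b, ~~ contested a b}.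

(** No ranking puts b before a, c before b and a before c at once, so each one is counted by some
    term. The last three terms cover coinciding candidates. *)
Lemma inversions_cycle a b c :
  #|S| <= inversions b a + inversions c b + inversions a c
          + #|S| * (a == b) + #|S| * (b == c) + #|S| * (a == c).
Proof.
have [_|ab] := eqVneq a b; first by rewrite muln1; lia.
have [_|bc] := eqVneq b c; first by rewrite muln1; lia.
have [_|ac] := eqVneq a c; first by rewrite muln1; lia.
rewrite !muln0 !addn0.
apply: leq_trans (leq_trans (leq_card_setU _ _) _);
  last by apply: leq_add (leqnn _); exact: leq_card_setU.
apply: subset_leq_card; apply/subsetP => s sS; rewrite !inE sS /=.
have := inj_eq (@pos_inj _ s) a b; rewrite (negbTE ab).
by lia.
Qed.

(** [before] uses [#|S| - inversions b a], which equals [inversions a b] off the diagonal but [#|S|]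
    on it; this is what makes the relation irreflexive. *)
Lemma before_irr : irreflexive before.
Proof.
move=> a; rewrite /before inversions_id subn0; case: ifP => [->|->] /=.
  by rewrite ltnn.
by apply/negbTE; rewrite -leqNgt leq_pmull.
Qed.

Lemma before_total a b : a != b -> before a b || before b a.
Proof.
move=> ab; rewrite /before; have [ad|ad] := boolP (a \in del);
  have [bd|bd] //= := boolP (b \in del).
  by rewrite -neq_ltn.
have := @uncontested a b; rewrite !inE ad bd /contested => /(_ isT isT).
have := inversionsC ab.
by move: (inversions a b) (inversions b a) #|S| => x y n; lia.
Qed.

Lemma before_tr : transitive before.
Proof.
move=> b a c; rewrite /before; have [ad|ad] := boolP (a \in del);
  have [bd|bd] //= := boolP (b \in del); have [cd|cd] //= := boolP (c \in del).
  exact: ltn_trans.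
(* Fewer than two thirds of S put b before a or c before b, so more than a third put a before c; as
   the pair is uncontested, more than two thirds do. *)
move=> h1 h2; have := inversions_cycle c b a.
have nab : a != b.
  by apply: contraTneq h1 => ->; rewrite inversions_id -leqNgt; lia.
have nbc : b != c.
  by apply: contraTneq h2 => ->; rewrite inversions_id -leqNgt; lia.
have nac : a != c.
  apply: contraTneq h2 => <-; have := inversionsC nab; move: h1.
  by move: (inversions a b) (inversions b a) #|S| => x y n; lia.
rewrite (eq_sym c b) (eq_sym b a) (eq_sym c a) (negbTE nab) (negbTE nbc) (negbTE nac).
have := @uncontested a c; rewrite !inE ad cd /contested => /(_ isT isT).
have := inversionsC nab; have := inversionsC nbc; have := inversionsC nac.
move: h1 h2; move: (inversions a b) (inversions b a) (inversions b c) => x1 x2 x3.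
move: (inversions c b) (inversions a c) (inversions c a) #|S| => x4 x5 x6 n; lia.
Qed.

End RelativeOrder.

(** * The trade-off behind the approximation ratio *)

Section MedianApproximation.

Variables (d : nat) (S : {set 'S_d}) (opt : 'S_d).
Hypothesis S_gt0 : 0 < #|S|.
Variable K : 'S_d -> {set 'I_d}.
Hypothesis K_agree : forall s, agree s opt (K s).
Hypothesis K_ulam : forall s, ulam s opt = #|~: K s|.

Definition misplaced (a : 'I_d) : nat := #|[set s in S | a \notin K s]|.

Definition bad : {set 'I_d} := [set a | #|S| <= 6 * misplaced a].

(** A ranking that inverts a and b relative to [opt] cannot have both of them in its set [K s]. *)
Lemma inversions_misplaced a b : pos opt a < pos opt b ->
  inversions S a b <= misplaced a + misplaced b.
Proof.
move=> ab; apply: leq_trans (leq_card_setU _ _); apply: subset_leq_card.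
apply/subsetP => s; rewrite !inE => /andP[-> ba] /=.
rewrite -negb_and; apply/negP => /andP[ha hb].
by move: ba; rewrite (K_agree hb ha) ltnNge ltnW.
Qed.

Lemma inversions_good a b : a \notin bad -> b \notin bad ->
  pos opt a < pos opt b -> 3 * inversions S a b < #|S|.
Proof.
rewrite !inE -!ltnNge => ha hb /inversions_misplaced.
by move: ha hb; move: (misplaced _) (misplaced _) (inversions _ _ _) #|S|; lia.
Qed.

Lemma good_uncontested : {in ~: bad &, forall a b, ~~ contested S a b}.
Proof.
move=> a b; rewrite !in_setC => ha hb; rewrite /contested negb_and -!ltnNge.
have [->|ab] := eqVneq a b; first by rewrite inversions_id S_gt0.
have := inversionsC S ab.
case: (ltngtP (pos opt a) (pos opt b)) => [h|h|/pos_inj e].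
- by rewrite (inversions_good ha hb h).
- have := inversions_good hb ha h.
  by move: (inversions _ _ _) (inversions _ _ _) #|S|; lia.
by rewrite e eqxx in ab.
Qed.

(** [tau] and [opt] agree outside the bad and the deleted candidates. The greedy hypothesis, taken
    at the set of good candidates, bounds the good deleted ones by the bad deleted ones, whence the
    factor 2. *)
Lemma relative_order_ulam (del : {set 'I_d}) (tau : 'S_d) :
  {in ~: del &, forall a b, ~~ contested S a b} ->
  (forall G : {set 'I_d}, {in G &, forall a b, ~~ contested S a b} ->
     #|del :&: G| <= #|del :\: G|) ->
  (forall a, pos tau a = order_rank (before S del) a) ->
  ulam tau opt <= 2 * #|bad|.
Proof.
move=> unc greedy htau.
have ag : agree tau opt (~: (bad :|: del)).
  have mono a b : a \notin bad -> b \notin bad -> a \notin del -> b \notin del ->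
      pos opt a < pos opt b -> pos tau a < pos tau b.
    move=> ga gb ad bd ab; rewrite !htau order_rankE.
    - rewrite /before (negbTE bd) ad /=.
      have ne : a != b by apply: contraTneq ab => ->; rewrite ltnn.
      have := inversionsC S ne; have := inversions_good ga gb ab.
      by move: (inversions _ _ _) (inversions _ _ _) #|S|; lia.
    - exact: before_irr.
    - exact: before_tr.
    - exact: before_total.
  move=> a b; rewrite !in_setC !in_setU !negb_or => /andP[ga ad] /andP[gb bd].
  case: (ltngtP (pos opt a) (pos opt b)) => [h|h|/pos_inj ->].
  - exact: mono.
  - by apply/negbTE; rewrite -leqNgt ltnW // mono.
  - by rewrite ltnn.
apply: leq_trans (ulam_agree ag) _; rewrite setCK.
have -> : bad :|: del = bad :|: (del :&: ~: bad).
  by rewrite setUIr setUCr setIT.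
apply: leq_trans (leq_card_setU _ _) _; rewrite mul2n -addnn leq_add2l.
apply: leq_trans (greedy _ good_uncontested) _.
by rewrite setDE setCK subset_leq_card // subsetIr.
Qed.

Definition overlap : nat := \sum_a misplaced a ^ 2.

Lemma misplacedE a : misplaced a = \sum_(s in S) (a \notin K s).
Proof.
rewrite /misplaced -sum1_card big_mkcond [RHS]big_mkcond.
by apply: eq_bigr => s _; rewrite inE; case: (s \in S); case: (a \notin K s).
Qed.

(** Both sides count the triples of a candidate and two rankings of S that misplace it. *)
Lemma overlapE :
  overlap = \sum_(s in S) \sum_(s' in S) #|~: K s :&: ~: K s'|.
Proof.
rewrite /overlap.
under eq_bigr do rewrite -mulnn misplacedE big_distrlr /=.
rewrite exchange_big /=; apply: eq_bigr => s _.
rewrite exchange_big /=; apply: eq_bigr => s' _.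
rewrite -sum1_card [RHS]big_mkcond; apply: eq_bigr => a _.
by rewrite !inE; case: (a \notin K s); case: (a \notin K s').
Qed.

(** Each bad candidate contributes at least (n / 6) ^ 2 to the sum. *)
Lemma bad_overlap : #|bad| * #|S| ^ 2 <= 36 * overlap.
Proof.
rewrite -sum_nat_const /overlap big_distrr /= [X in _ <= X](bigID (mem bad)) /=.
apply: leq_trans (leq_addr _ _); apply: leq_sum => a; rewrite inE => ha.
by rewrite -[36]/(6 ^ 2) -expnMn leq_exp2r.
Qed.

Lemma ulam_pair s s' :
  ulam s s' + #|~: K s :&: ~: K s'| <= ulam s opt + ulam s' opt.
Proof.
have := ulam_agree (agree_trans (@K_agree s) (agree_sym (@K_agree s'))).
by rewrite setCI !K_ulam -cardsUI leq_add2r.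
Qed.

(** The triangle inequality through s spends one [ulam s opt] on f; [ulam_pair] spends the other and
    yields the gain of the overlap. *)
Lemma cost_closest s f : ulam s f <= ulam s opt ->
  median_cost S f + \sum_(s' in S) #|~: K s :&: ~: K s'| <=
  median_cost S opt + 2 * (#|S| * ulam s opt).
Proof.
move=> hf; rewrite /median_cost -big_split /= -sum_nat_const big_distrr -big_split /=.
apply: leq_sum => s' _.
have := ulam_triangle s' s f; have := ulam_pair s s'; rewrite (ulam_sym s' s).
by move: hf; move: (ulam _ _) (ulam _ _) (ulam _ _) (ulam _ _) #|_|; lia.
Qed.

Lemma best_closest best :
  (forall s, s \in S -> exists2 f, ulam s f <= ulam s opt &
     best <= median_cost S f) ->
  #|S| * best + overlap <= 3 * (#|S| * median_cost S opt).
Proof.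
move=> h; rewrite overlapE -sum_nat_const -big_split /=.
apply: leq_trans (_ : \sum_(s in S) (median_cost S opt + 2 * (#|S| * ulam s opt)) <= _).
  apply: leq_sum => s /h[f hf hb]; apply: leq_trans (cost_closest hf).
  by rewrite leq_add2r.
rewrite big_split /= sum_nat_const -!big_distrr /= -/(median_cost S opt).
by rewrite mulSn.
Qed.

Lemma best_relative tau f best :
  ulam tau f <= ulam tau opt -> best <= median_cost S f ->
  ulam tau opt <= 2 * #|bad| ->
  #|S| * best <= #|S| * median_cost S opt + 144 * overlap.
Proof.
move=> hf hb ht.
(* The detour from s through [opt] and [tau] to f exceeds [ulam s opt] by at most twice
   [ulam tau opt], that is, 4 * [#|bad|]; with [bad_overlap], 4 * 36 gives the 144. *)
have h : best <= median_cost S opt + #|S| * (4 * #|bad|).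
  apply: leq_trans hb _; rewrite /median_cost -sum_nat_const -big_split /=.
  apply: leq_sum => s _; have := ulam_triangle s opt f.
  have := ulam_triangle opt tau f; rewrite (ulam_sym opt tau).
  by move: hf ht; move: (ulam _ _) (ulam _ _) (ulam _ _) (ulam _ _) #|_|; lia.
apply: leq_trans (leq_mul (leqnn _) h) _; rewrite mulnDr leq_add2l.
have := bad_overlap; rewrite -mulnn.
by move: #|S| #|bad| overlap => n x q; nia.
Qed.

Lemma best_approx best tau f :
  (forall s, s \in S -> exists2 f, ulam s f <= ulam s opt &
     best <= median_cost S f) ->
  ulam tau f <= ulam tau opt -> best <= median_cost S f ->
  ulam tau opt <= 2 * #|bad| ->
  145 * best <= 433 * median_cost S opt.
Proof.
move=> /best_closest h1 hf hb ht; have := best_relative hf hb ht.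
move: h1 S_gt0 => {hb}.
(* 144 times the first bound plus the second cancels the overlap: 144 + 1 = 145 and 3 * 144 + 1 =
   433. *)
move: #|S| best (median_cost S opt) overlap => n x y q; nia.
Qed.

End MedianApproximation.

(** * Patience sorting *)

Section Patience.

Implicit Types (u w : seq nat) (T : nat -> nat).

(* T l is the least last element of an increasing subsequence of w of size
   l + 1, and len is the greatest size of an increasing subsequence of w. *)
Definition tails w T len : Prop :=
  (forall l, l < len -> exists u,
     [/\ sorted ltn u, subseq u w, size u = l.+1 & last 0 u = T l]) /\
  (forall u, sorted ltn u -> subseq u w -> 0 < size u ->
     size u <= len /\ T (size u).-1 <= last 0 u).

(** T is arbitrary, so the array of tails may keep the contents of an earlier run. *)
Lemma tails_nil T : tails [::] T 0.
Proof. by split=> // u _; rewrite subseq0 => /eqP ->. Qed.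

(** The first l + 1 terms of a witness for l' end below its last term. Monotonicity is what licenses
    the binary search. *)
Lemma tails_mono w T len l l' : tails w T len -> l < l' -> l' < len -> T l < T l'.
Proof.
move=> [tA tB] ll hl'; have [u [su uw sz <-]] := tA _ hl'.
have stake : size (take l.+1 u) = l.+1 by rewrite size_takel // sz; lia.
have := tB (take l.+1 u); rewrite stake => /(_ _ _ isT)[].
- exact: take_sorted.
- exact: subseq_trans (take_subseq _ _) uw.
move=> _ /leq_ltn_trans; apply.
rewrite -!nth_last stake sz /= nth_take //.
by apply: (sorted_ltn_nth ltn_trans 0 su) => //; rewrite inE sz; lia.
Qed.

Lemma subseq_rconsE (T : eqType) (t s : seq T) x : subseq t (rcons s x) ->
  subseq t s \/ exists2 t', t = rcons t' x & subseq t' s.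
Proof.
rewrite -subseq_rev rev_rcons; case/lastP: t => [|t y]; first by rewrite sub0seq; left.
rewrite rev_rcons /=; case: eqP => [->|_]; rewrite ?subseq_rev.
  by move=> h; right; exists t.
by rewrite -rev_rcons subseq_rev; left.
Qed.

(** p counts the tails below x. Appending x to a witness of length p yields one of length p + 1, and
    no increasing subsequence ending in the new x is longer, so only entry p changes. *)
Lemma tails_rcons w T len x p : tails w T len -> p <= len ->
  (forall l, l < p -> T l < x) -> (forall l, p <= l < len -> x <= T l) ->
  tails (rcons w x) (fun o => if o == p then x else T o)
        (if p == len then len.+1 else len).
Proof.
move=> [tA tB] hp lo hi; split.
  move=> l hl; case: eqP => [-> {l hl}|np].
    case: p hp lo hi => [|p] hp lo hi.
      by exists [:: x]; rewrite sub1seq mem_rcons mem_head.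
    have [u [su uw sz lu]] := tA _ hp.
    exists (rcons u x); split=> //.
    - case: u su sz lu {uw} => // y u + _.
      by rewrite /= rcons_path => -> /= ->; exact: lo.
    - by rewrite -!cats1 cat_subseq.
    - by rewrite size_rcons sz.
    - by rewrite last_rcons.
  have [|u [su uw sz lu]] := tA l; first by case: eqP hl np => [->|_]; lia.
  by exists u; split=> //; exact: subseq_trans uw (subseq_rcons _ _).
move=> u su /subseq_rconsE[uw|[u' e uw]] hu.
  have [h1 h2] := tB _ su uw hu; split; first by case: eqP => _ //; exact: leqW.
  case: eqP => // e; apply: leq_trans h2; apply: hi; rewrite e leqnn -e.
  by case: (size u) hu h1.
subst u; rewrite size_rcons last_rcons /=.
case: u' su uw {hu} => [|y u'] su uw.
  split; first by rewrite /=; case: eqP; lia.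
  by case: eqP => // ne; apply/ltnW/lo; move: ne; rewrite /=; lia.
move: su; rewrite rcons_cons /= rcons_path => /andP[su lx].
have [/= h1 h2] := tB (y :: u') su uw isT.
have hs : size u' < p.
  rewrite ltnNge; apply/negP => hps; have := hi (size u').
  by rewrite hps h1 leqNgt (leq_ltn_trans h2 lx) => /(_ isT).
split; first by rewrite /=; move: (size u') hs => m hs; case: eqP; lia.
case: eqP => // ne; rewrite ltnW // lo //; move: ne; rewrite /=.
by move: (size u') hs => m hs; lia.
Qed.

(** Renaming candidates by their positions in s2 turns common subsequences into increasing ones. *)
Lemma tails_lcs d (s1 s2 : 'S_d) T len :
  tails [seq pos s2 a | a <- ranking_seq s1] T len ->
  lcs_length (ranking_seq s1) (ranking_seq s2) = len.
Proof.
move=> [tA tB]; apply/eqP; rewrite eqn_leq; apply/andP; split.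
  have [t [t1 t2 <-]] := lcs_length_ex (ranking_seq s1) (ranking_seq s2).
  move: t2; rewrite subseq_ranking => t2.
  have [st|st] := posnP (size t); first by rewrite st.
  by have := tB _ t2 (map_subseq _ t1); rewrite size_map => /(_ st)[].
case: len tA {tB} => // len /(_ len (leqnn _))[u [su /subseqP[m sm e] <- _]].
rewrite e -map_mask size_map; apply: lcs_length_ge; first exact: mask_subseq.
by rewrite subseq_ranking map_mask -e.
Qed.

End Patience.

(** * Codes of vectors of group counts *)

Section Digits.

Variable b : nat.

Definition digit (c i : nat) : nat := c %/ b ^ i %% b.

(** The order is forgotten, and appending a member of group i is the addition of [b ^ i]; as long as
    all counts are below b, the digits recover them. *)
Definition gcode (l : seq nat) : nat := \sum_(i <- l) b ^ i.

Lemma digit_sum (f : nat -> nat) g : (forall i, i < g -> f i < b) ->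
  \sum_(i < g) f i * b ^ i < b ^ g /\
  forall i, i < g -> digit (\sum_(i < g) f i * b ^ i) i = f i.
Proof.
elim: g => [|g IH] hf; first by rewrite big_ord0.
have [|lt IHd] := IH; first by move=> i hi; apply: hf; lia.
have b0 : 0 < b by have := hf g (leqnn _); lia.
rewrite big_ord_recr /=; split.
  apply: leq_trans (_ : (f g).+1 * b ^ g <= _); first by rewrite mulSn ltn_add2r.
  by rewrite expnS leq_mul2r hf ?orbT.
move=> i; rewrite ltnS leq_eqVlt => /orP[/eqP ->|hi].
  by rewrite /digit addnC divnMDl ?expn_gt0 ?b0 // divn_small // addn0 modn_small ?hf.
(* Divided by [b ^ i], the top term is still a multiple of b, hence vanishes modulo b. *)
rewrite -[RHS](IHd _ hi) /digit -[in f g * _](subnK (ltnW hi)) expnD mulnA addnC.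
rewrite divnMDl ?expn_gt0 ?b0 //.
have -> : g - i = (g - i.+1).+1 by lia.
by rewrite expnS mulnCA mulnC modnMDl.
Qed.

Lemma gcode_count g l : all (fun i => i < g) l ->
  gcode l = \sum_(i < g) count_mem (i : nat) l * b ^ i.
Proof.
rewrite /gcode; elim: l => [|x l IH] /=; first by rewrite big_nil big1.
move=> /andP[hx /IH e]; rewrite big_cons e.
under [RHS]eq_bigr do rewrite mulnDl.
rewrite [RHS]big_split /= [in RHS](bigD1 (Ordinal hx)) //= eqxx mul1n.
rewrite [in RHS]big1 ?addn0 //.
by move=> i /negbTE ni; rewrite eq_sym -[x]/(val (Ordinal hx)) val_eqE ni.
Qed.

Lemma gcode_lt g l : all (fun i => i < g) l -> (forall i, count_mem i l < b) ->
  gcode l < b ^ g.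
Proof.
move=> /gcode_count -> hl.
by have [] := @digit_sum (fun i => count_mem i l) g (fun i _ => hl i).
Qed.

Lemma digit_gcode g l i : all (fun i => i < g) l -> (forall i, count_mem i l < b) ->
  i < g -> digit (gcode l) i = count_mem i l.
Proof.
move=> /gcode_count -> hl hi.
by have [_ ->] := @digit_sum (fun i => count_mem i l) g (fun i _ => hl i).
Qed.

Lemma gcode_rcons l i : gcode (rcons l i) = gcode l + b ^ i.
Proof. by rewrite /gcode -cats1 big_cat big_seq1. Qed.

Lemma size_count g l : all (fun i => i < g) l ->
  size l = \sum_(i < g) count_mem (i : nat) l.
Proof.
elim: l => [|x l IH] /=; first by rewrite big1.
move=> /andP[hx /IH ->]; rewrite [RHS]big_split /= [in RHS](bigD1 (Ordinal hx)) //=.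
rewrite eqxx [in RHS]big1 ?addn0 //.
by move=> i /negbTE ni; rewrite eq_sym -[x]/(val (Ordinal hx)) val_eqE ni.
Qed.

End Digits.

(** * Closest fair rankings *)

Section Words.

Variables (d g : nat) (grp : 'I_d -> 'I_g) (k : nat).
Variables (fl ce : nat -> nat -> nat).

Definition word (s : 'S_d) : seq nat := [seq nat_of_ord (grp a) | a <- ranking_seq s].

Definition gsize (i : nat) : nat := count_mem i [seq nat_of_ord (grp a) | a <- enum 'I_d].

(** Fairness of one prefix through its groups alone, with the two roundings as black boxes, as the
    machine accesses them. *)
Definition fair_word (u : seq nat) : bool :=
  (k <= size u) ==>
  all (fun i => fl i (size u) <= count_mem i u <= ce i (size u)) (iota 0 g).

Lemma size_ranking (s : 'S_d) : size (ranking_seq s) = d.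
Proof. by rewrite size_map size_enum_ord. Qed.

Lemma nth_ranking (s : 'S_d) a p (hp : p < d) :
  nth a (ranking_seq s) p = s (Ordinal hp).
Proof.
rewrite (nth_map (Ordinal hp)) ?size_enum_ord //.
by congr (s _); apply: val_inj; rewrite /= nth_enum_ord.
Qed.

Lemma nth_word (s : 'S_d) p (hp : p < d) :
  nth 0 (word s) p = grp (s (Ordinal hp)).
Proof.
by rewrite (nth_map (s (Ordinal hp))) ?size_ranking // (nth_ranking _ _ hp).
Qed.

Lemma take_rankingS (s : 'S_d) p (hp : p < d) :
  take p.+1 (ranking_seq s) = rcons (take p (ranking_seq s)) (s (Ordinal hp)).
Proof.
by rewrite (take_nth (s (Ordinal hp))) ?size_ranking // (nth_ranking _ _ hp).
Qed.

Lemma size_word s : size (word s) = d.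
Proof. by rewrite size_map size_ranking. Qed.

Lemma word_lt s : all (fun i => i < g) (word s).
Proof. by apply/allP => i /mapP[a _ ->]; exact: ltn_ord. Qed.

Lemma count_word s i : count_mem i (word s) = gsize i.
Proof.
suff pe : perm_eq (word s) [seq nat_of_ord (grp a) | a <- enum 'I_d].
  exact: (seq.permP pe).
apply: perm_map; apply: uniq_perm; rewrite ?enum_uniq ?ranking_uniq // => a.
by rewrite mem_ranking mem_enum.
Qed.

Lemma gsize_candidates (i : 'I_g) : gsize i = #|candidates_of grp i|.
Proof.
rewrite /gsize count_map -size_filter.
have /card_uniqP <- : uniq [seq a <- enum 'I_d |
    preim (fun a => nat_of_ord (grp a)) (pred1 (nat_of_ord i)) a].
  by rewrite filter_uniq // enum_uniq.
by apply: eq_card => a; rewrite mem_filter mem_enum !inE andbT.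
Qed.

Lemma count_prefix (s : 'S_d) p (i : 'I_g) :
  count_mem (i : nat) (take p (word s)) = #|prefix_set s p :&: candidates_of grp i|.
Proof.
rewrite /word -map_take count_map -size_filter.
have /card_uniqP <- : uniq [seq a <- take p (ranking_seq s) |
    preim (fun a => nat_of_ord (grp a)) (pred1 (nat_of_ord i)) a].
  by rewrite filter_uniq // take_uniq // ranking_uniq.
apply: eq_card => a; rewrite mem_filter /= !inE val_eqE andbC; congr (_ && _).
rewrite -map_take; apply/idP/imsetP => [/mapP[q qp ->]|[q qp ->]].
  exists q => //; rewrite inE.
  by move/(map_f val): qp; rewrite map_take val_enum_ord take_iota mem_iota /= leq_min => /andP[].
apply: map_f; rewrite inE in qp.
rewrite -(mem_map val_inj) map_take val_enum_ord take_iota mem_iota.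
by rewrite /= leq_min qp ltn_ord.
Qed.

End Words.

Lemma fair_wordP (R : realType) d g (grp : 'I_d -> 'I_g) (lambda mu : 'I_g -> R) k s :
  (forall i : 'I_g, (0 <= lambda i <= 1)%R /\ (0 <= mu i <= 1)%R) ->
  fair grp lambda mu k s <->
  forall p, p <= d ->
    fair_word g k (floor_op lambda) (ceil_op mu) (take p (word grp s)).
Proof.
move=> h.
have eqv p (i : 'I_g) (c : nat) :
    ((Num.floor (lambda i * p%:R) <= Posz c <= Num.ceil (mu i * p%:R))%R : bool) =
    (floor_op lambda i p <= c <= ceil_op mu i p).
  have [/andP[l0 _] /andP[m0 _]] := h i.
  rewrite /floor_op /ceil_op valK.
  have : (0 <= Num.floor (lambda i * p%:R))%R.
    by rewrite Num.Theory.floor_ge0 Num.Theory.mulr_ge0.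
  have : (0 <= Num.ceil (mu i * p%:R))%R.
    rewrite Num.Theory.ceil_ge0; apply: Order.POrderTheory.lt_le_trans (Num.Theory.ltrN10 _) _.
    by rewrite Num.Theory.mulr_ge0.
  by case: (Num.ceil _) => // m _; case: (Num.floor _).
split=> [hf p pd|hw p i /andP[kp pd]].
  rewrite /fair_word size_takel ?size_word //; apply/implyP => kp.
  apply/allP => i; rewrite mem_iota /= => hi.
  have := hf p (Ordinal hi); rewrite kp pd => /(_ isT).
  by rewrite /= eqv -count_prefix.
have := hw p pd; rewrite /fair_word size_takel ?size_word // kp => /allP /(_ i).
by rewrite mem_iota /= ltn_ord => /(_ isT); rewrite eqv -count_prefix.
Qed.

Section ClosestFair.

Variables (d g : nat) (grp : 'I_d -> 'I_g) (k b : nat).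
Variables (fl ce : nat -> nat -> nat).
Hypothesis gsize_lt : forall i, gsize grp i < b.

Local Notation gsize := (gsize grp).
Local Notation fair_word := (fair_word g k fl ce).

Definition full_code : nat := gcode b [seq nat_of_ord (grp a) | a <- enum 'I_d].

Definition valid_code (c : nat) : bool :=
  let tot := \sum_(i < g) digit b c i in
  (k <= tot) ==> all (fun i => fl i tot <= digit b c i <= ce i tot) (iota 0 g).

Definition room (c i : nat) : bool := digit b c i < gsize i.

Lemma count_le_lt u i : (forall i, count_mem i u <= gsize i) -> count_mem i u < b.
Proof. by move=> h; exact: leq_ltn_trans (h i) _. Qed.

Lemma valid_gcode u : all (fun i => i < g) u ->
  (forall i, count_mem i u <= gsize i) -> valid_code (gcode b u) = fair_word u.
Proof.
move=> hu hc; have hb i := count_le_lt i hc.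
rewrite /valid_code /fair_word.
have -> : \sum_(i < g) digit b (gcode b u) i = size u.
  by rewrite (size_count hu); apply: eq_bigr => i _; rewrite (digit_gcode hu).
congr (_ ==> _); apply: eq_in_all => i; rewrite mem_iota /= => hi.
by rewrite (digit_gcode hu).
Qed.

Lemma words_lt : all (fun i => i < g) [seq nat_of_ord (grp a) | a <- enum 'I_d].
Proof. by apply/allP => i /mapP[a _ ->]; exact: ltn_ord. Qed.

(** Counts bounded by the group sizes and adding up to d must all be equal to them. *)
Lemma gcode_full u : all (fun i => i < g) u ->
  (forall i, count_mem i u <= gsize i) ->
  (gcode b u == full_code) = (size u == d).
Proof.
move=> hu hc; have hb i := count_le_lt i hc.
have sd : size [seq nat_of_ord (grp a) | a <- enum 'I_d] = d by rewrite size_map size_enum_ord.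
apply/eqP/eqP => [e|e].
  rewrite -[RHS]sd (size_count hu) (size_count words_lt); apply: eq_bigr => i _.
  rewrite -(digit_gcode hu hb (ltn_ord i)) e.
  by rewrite (digit_gcode words_lt gsize_lt (ltn_ord i)).
rewrite /full_code (gcode_count b hu) (gcode_count b words_lt).
have := size_count hu; rewrite e -[LHS]sd (size_count words_lt) => es.
apply: eq_bigr => i _; congr (_ * _); apply/eqP; rewrite eqn_leq hc leqNgt /=.
apply/negP => lt; move/eqP: es; apply/negP; rewrite eq_sym.
rewrite ltn_eqF // (bigD1 i) //= [ltnRHS](bigD1 i) //=.
by rewrite -addSn leq_add // leq_sum // => j _; exact: hc.
Qed.

Variable r : 'S_d.
Local Notation grp_at j := (nth 0 (word grp r) j).

Variables H choice : nat -> nat -> nat.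

(** With [dp_chosen], this describes a maximum as an upper bound that is attained, in the form in
    which the program updates it. A matched successor of value 0 is excluded: its increment would
    pretend that a completion exists. *)
Definition dp_above c j v : Prop :=
  [/\ j < d -> H c j.+1 <= v,
      j < d -> room c (grp_at j) -> 0 < H (c + b ^ grp_at j) j.+1 ->
        H (c + b ^ grp_at j) j.+1 < v &
      forall i, i < g -> room c i -> H (c + b ^ i) j <= v].

(** Coding of the choice: h < g is a filler of group h, g skips position j of the given ranking, g +
    1 matches the candidate there. *)
Definition dp_chosen c j v h : Prop :=
  [\/ [/\ h = g, j < d & v = H c j.+1],
      [/\ h = g.+1, j < d, room c (grp_at j),
          0 < H (c + b ^ grp_at j) j.+1 & v = (H (c + b ^ grp_at j) j.+1).+1] |
      [/\ h < g, room c h & v = H (c + b ^ h) j]].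

(* [H c j] is one more than the largest number of candidates of the ranking r,
   from position j on, that can still be matched by a fair completion of a
   prefix whose group counts have code c; it is 0 if there is no such
   completion. *)
Definition dp_cell c j v h : Prop :=
  [/\ ~~ valid_code c -> v = 0,
      valid_code c -> c = full_code -> v = 1 &
      valid_code c -> c <> full_code ->
        dp_above c j v /\ (0 < v -> dp_chosen c j v h)].

Definition dp_table : Prop := forall c j, c < b ^ g -> j <= d ->
  dp_cell c j (H c j) (choice c j).

Hypothesis tableH : dp_table.

Lemma take_word_count s p i : count_mem i (take p (word grp s)) <= gsize i.
Proof.
rewrite -(count_word grp s i) -[X in _ <= count_mem i X](cat_take_drop p).
by rewrite count_cat leq_addr.
Qed.

Lemma take_word_lt s p : all (fun i => i < g) (take p (word grp s)).
Proof.
by have := word_lt grp s; rewrite -{1}(cat_take_drop p (word _ _)) all_cat => /andP[].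
Qed.

Lemma take_word_code_lt s p : gcode b (take p (word grp s)) < b ^ g.
Proof.
apply: gcode_lt (take_word_lt s p) _ => i.
exact: leq_ltn_trans (take_word_count s p i) _.
Qed.

(** The table dominates every fair ranking, by induction on what is left of s and r. The next
    candidate of s is treated as a filler unless it heads t; then either r has it at position j, a
    match, or position j is skipped. The inequality is strict because values are shifted by one. *)
Lemma dp_complete (s : 'S_d) :
  (forall p, p <= d -> fair_word (take p (word grp s))) ->
  forall m p j t, (d - p) + (d - j) <= m -> p <= d -> j <= d ->
  subseq t (drop p (ranking_seq s)) -> subseq t (drop j (ranking_seq r)) ->
  size t < H (gcode b (take p (word grp s))) j.
Proof.
move=> fs; elim=> [|m IH] p j t em pd jd ts tr.
  all: have cnt := take_word_count s p; have lt := take_word_lt s p.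
  all: have vc : valid_code (gcode b (take p (word grp s))) by rewrite valid_gcode ?fs.
  all: have [_ hfull hopt] := tableH (take_word_code_lt s p) jd.
  all: have fullE := gcode_full lt cnt.
  all: rewrite size_takel ?size_word // in fullE.
  have ep : p = d by lia.
  move: ts; rewrite drop_oversize ?size_ranking; last by rewrite ep.
  rewrite subseq0 => /eqP ->.
  by rewrite hfull //; apply/eqP; rewrite fullE ep.
have [ep|np] := eqVneq p d.
  move: ts; rewrite drop_oversize ?size_ranking; last by rewrite ep.
  rewrite subseq0 => /eqP ->.
  by rewrite hfull //; apply/eqP; rewrite fullE ep.
have pd' : p < d by lia.
case: (hopt vc) => [/eqP|[hskip hmatch hfill] _]; first by rewrite fullE (negbTE np).
set x := s (Ordinal pd').
have xE : nth x (ranking_seq s) p = x.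
  exact: nth_ranking.
have gE : nth 0 (word grp s) p = grp x.
  exact: nth_word.
have takeS : take p.+1 (word grp s) = rcons (take p (word grp s)) (grp x).
  by rewrite (take_nth 0) ?size_word // gE.
have rm : room (gcode b (take p (word grp s))) (grp x).
  rewrite /room (digit_gcode lt) //; last by move=> i; exact: count_le_lt.
  have := take_word_count s p.+1 (grp x); rewrite takeS -cats1 count_cat /= eqxx; lia.
have codeS : gcode b (take p (word grp s)) + b ^ (grp x) = gcode b (take p.+1 (word grp s)).
  by rewrite takeS gcode_rcons.
have fill t' : subseq t' (drop p.+1 (ranking_seq s)) ->
    subseq t' (drop j (ranking_seq r)) -> size t' < H (gcode b (take p (word grp s))) j.
  move=> h1 h2; apply: leq_trans (hfill _ (ltn_ord (grp x)) rm).
  by rewrite codeS; apply: IH => //; lia.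
move: ts; rewrite (drop_nth x) ?size_ranking // xE.
case: t tr => [|y t] tr ts; first by apply: fill; exact: sub0seq.
have [yx|nyx] := eqVneq y x; last first.
  by apply: fill => //; move: ts; rewrite /= (negbTE nyx).
move: ts; rewrite /= yx eqxx => ts.
have jd' : j < d.
  by rewrite ltnNge; apply/negP => dj; move: tr; rewrite drop_oversize ?size_ranking.
set z := r (Ordinal jd').
have zE : nth z (ranking_seq r) j = z.
  exact: nth_ranking.
move: tr; rewrite (drop_nth z) ?size_ranking // zE /= yx.
have [xz|nxz] := eqVneq x z => tr; last first.
  apply: leq_trans (hskip jd').
  apply: (IH p j.+1 (x :: t)) => //; [lia|].
  by rewrite (drop_nth x) ?size_ranking // xE /= eqxx.
have gj : grp_at j = grp x by rewrite (nth_map z) ?size_ranking // zE xz.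
have step : size t < H (gcode b (take p.+1 (word grp s))) j.+1 by apply: IH => //; lia.
have := hmatch jd'; rewrite gj codeS => /(_ rm) h.
by apply: leq_ltn_trans (h _); [exact: step | exact: leq_trans step].
Qed.

End ClosestFair.

(** * Reading a closest fair ranking off the table *)

Section Reconstruction.

Variables (d g : nat) (grp : 'I_d -> 'I_g) (k b : nat).
Variables (fl ce : nat -> nat -> nat).
Hypothesis gsize_lt : forall i, gsize grp i < b.

Local Notation gsize := (gsize grp).
Local Notation fair_word := (fair_word g k fl ce).
Local Notation full_code := (full_code grp b).

(* [inl a]: the next candidate is a, matched with the given ranking;
   [inr i]: the next candidate is some unmatched member of group i. *)
Definition label := ('I_d + 'I_g)%type.

Definition lgroup (x : label) : nat :=
  match x with inl a => grp a | inr i => i end.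

Definition matched (l : seq label) : seq 'I_d :=
  pmap (fun x : label => if x is inl a then Some a else None) l.

Lemma matched_cat l1 l2 : matched (l1 ++ l2) = matched l1 ++ matched l2.
Proof. exact: pmap_cat. Qed.

Lemma matched_inl l a : matched (rcons l (inl a)) = rcons (matched l) a.
Proof. by rewrite -!cats1 matched_cat. Qed.

Lemma matched_inr l i : matched (rcons l (inr i)) = matched l.
Proof. by rewrite -cats1 matched_cat cats0. Qed.

Lemma lgroup_lt l : all (fun i => i < g) (map lgroup l).
Proof. by apply/allP => i /mapP[[a|a] _ ->]; exact: ltn_ord. Qed.

Variables (r : 'S_d) (H choice : nat -> nat -> nat).
Local Notation lcode l := (gcode b (map lgroup l)).

(** Invariant of the trace-back: the labels l are chosen and j positions of r are consumed.
    [plan_value] says that what is matched plus what the table still promises never changes. *)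
Record plan (l : seq label) (j : nat) : Prop := Plan {
  plan_j : j <= d;
  plan_fair : forall p, p <= size l -> fair_word (take p (map lgroup l));
  plan_count : forall i, count_mem i (map lgroup l) <= gsize i;
  plan_sub : subseq (matched l) (take j (ranking_seq r));
  plan_value : size (matched l) + H (lcode l) j = H 0 0;
  plan_pos : 0 < H (lcode l) j }.

Hypothesis tableH : dp_table grp k b fl ce r H choice.

Lemma lcode_lt l : (forall i, count_mem i (map lgroup l) <= gsize i) ->
  lcode l < b ^ g.
Proof.
by move=> h; apply: gcode_lt (lgroup_lt l) _ => i; exact: count_le_lt gsize_lt _ _ h.
Qed.

Lemma plan_valid l j : plan l j -> valid_code g k b fl ce (lcode l).
Proof.
move=> pl; apply: (contraTT _ (plan_pos pl)) => nv.
by have [-> // _ _] := tableH (lcode_lt (plan_count pl)) (plan_j pl).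
Qed.

Lemma plan_full l j : plan l j -> (lcode l == full_code) = (size l == d).
Proof.
move=> pl; rewrite (gcode_full gsize_lt (lgroup_lt l) (plan_count pl)).
by rewrite size_map.
Qed.

Lemma plan_size l j : plan l j -> size l <= d.
Proof.
move=> pl; rewrite -(size_map lgroup) (size_count (lgroup_lt l)).
have <- : size [seq nat_of_ord (grp a) | a <- enum 'I_d] = d by rewrite size_map size_enum_ord.
by rewrite (size_count (words_lt grp)) leq_sum // => i _; exact: plan_count pl i.
Qed.

Lemma plan_room l j i : plan l j -> room grp b (lcode l) i -> i < g ->
  forall i', count_mem i' (rcons (map lgroup l) i) <= gsize i'.
Proof.
move=> pl; rewrite /room => hr hi i'.
rewrite -cats1 count_cat /= addn0; case: eqP => [<-|_]; last by rewrite addn0 (plan_count pl).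
rewrite (digit_gcode (lgroup_lt l)) // in hr; first by rewrite addn1.
by move=> i1; exact: count_le_lt gsize_lt _ _ (plan_count pl).
Qed.

Lemma plan_fair_rcons l j j' i : plan l j -> i < g -> j' <= d ->
  (forall i', count_mem i' (rcons (map lgroup l) i) <= gsize i') ->
  0 < H (lcode l + b ^ i) j' ->
  forall p, p <= (size l).+1 -> fair_word (take p (rcons (map lgroup l) i)).
Proof.
move=> pl hi jd hc Hp p; rewrite leq_eqVlt => /orP[/eqP ->|]; last first.
  move=> lp; rewrite -cats1 takel_cat ?size_map //; exact: plan_fair pl _ _.
have hlt : all (fun i => i < g) (rcons (map lgroup l) i).
  by rewrite all_rcons hi lgroup_lt.
rewrite take_oversize ?size_rcons ?size_map //.
rewrite -(valid_gcode k fl ce gsize_lt hlt hc) gcode_rcons.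
apply: (contraTT _ Hp) => nv.
have [|-> //] := tableH (_ : lcode l + b ^ i < b ^ g) jd.
rewrite -gcode_rcons; apply: gcode_lt hlt _ => i1.
exact: count_le_lt gsize_lt _ _ hc.
Qed.

Lemma plan_nil : 0 < H 0 0 -> plan [::] 0.
Proof.
move=> H0; have code0 : lcode [::] = 0 by rewrite /gcode big_nil.
split=> //; rewrite ?code0 ?sub0seq //=.
move=> p _; rewrite -(valid_gcode k fl ce gsize_lt) //=.
apply: (contraTT _ H0) => nv; rewrite code0 in nv.
have [|-> //] := tableH (_ : 0 < b ^ g) (leq0n d).
by rewrite expn_gt0 (leq_ltn_trans _ (gsize_lt 0)).
Qed.

Lemma plan_step l j : plan l j -> lcode l != full_code ->
  [\/ choice (lcode l) j = g /\ plan l j.+1,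
      exists hj : j < d, choice (lcode l) j = g.+1 /\
        plan (rcons l (inl (r (Ordinal hj)))) j.+1 |
      exists hi : choice (lcode l) j < g, plan (rcons l (inr (Ordinal hi))) j].
Proof.
move=> pl /eqP nf; have [_ _] := tableH (lcode_lt (plan_count pl)) (plan_j pl).
move=> /(_ (plan_valid pl) nf)[_ /(_ (plan_pos pl))].
have val0 := plan_value pl; have pos0 := plan_pos pl.
case=> [[hc jd e]|[hc jd hr Hp e]|[hc hr e]].
- constructor 1; split=> //; case: pl => *; split=> //; rewrite -?e //.
  by rewrite (take_rankingS r jd); apply: subseq_trans (subseq_rcons _ _).
- constructor 2; exists jd; split=> //; rewrite (nth_word grp r jd) in hr Hp e.
  have hi := ltn_ord (grp (r (Ordinal jd))).
  have cnt := plan_room pl hr hi.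
  have fw := plan_fair_rcons pl hi jd cnt Hp.
  split=> //; rewrite ?map_rcons /= ?matched_inl ?gcode_rcons //.
  + by move=> p; rewrite size_rcons; exact: fw.
  + by rewrite (take_rankingS r jd) -!cats1 cat_subseq // (plan_sub pl).
  + by rewrite size_rcons -val0 e addSnnS.
constructor 3; exists hc.
have Hp : 0 < H (lcode l + b ^ choice (lcode l) j) j by rewrite -e.
have cnt := plan_room pl hr hc.
have fw := plan_fair_rcons pl hc (plan_j pl) cnt Hp.
split=> //; rewrite ?map_rcons /= ?matched_inr ?gcode_rcons //.
- exact: plan_j pl.
- by move=> p; rewrite size_rcons; exact: fw.
- exact: plan_sub pl.
by rewrite -val0 e.
Qed.

(* cs realizes the labels l1, and the labels l2 remain to be realized; the
   candidates matched in l2 are reserved and must not be used as fillers. *)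
Definition filled (l1 l2 : seq label) (cs : seq 'I_d) : Prop :=
  [/\ [seq nat_of_ord (grp a) | a <- cs] = map lgroup l1, uniq (cs ++ matched l2) &
      subseq (matched l1) cs].

Lemma filled_inl l1 a l2 cs : filled l1 (inl a :: l2) cs ->
  filled (rcons l1 (inl a)) l2 (rcons cs a).
Proof.
case=> e u s; split; first by rewrite !map_rcons e.
  by rewrite cat_rcons.
by rewrite matched_inl -!cats1 cat_subseq.
Qed.

Lemma filled_inr l1 i l2 cs x : filled l1 (inr i :: l2) cs ->
  x \notin cs ++ matched l2 -> grp x = i ->
  filled (rcons l1 (inr i)) l2 (rcons cs x).
Proof.
case=> e u s nx gx; split; first by rewrite !map_rcons e /= gx.
  by rewrite cat_rcons -cat1s uniq_catCA cat1s /= nx.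
by rewrite matched_inr; apply: subseq_trans s (subseq_rcons _ _).
Qed.

Lemma count_matched l i :
  count_mem i [seq nat_of_ord (grp a) | a <- matched l] <= count_mem i (map lgroup l).
Proof.
by elim: l => //= -[a|j] l IH /=; rewrite ?leq_add2l // (leq_trans IH) // leq_addl.
Qed.

(** The members of group i in cs or reserved by l2 number at most the labels of that group other
    than the current one, hence fewer than the group has members. *)
Lemma filled_ex l1 i l2 cs : filled l1 (inr i :: l2) cs ->
  (forall i', count_mem i' (map lgroup (l1 ++ inr i :: l2)) <= gsize i') ->
  exists2 x, x \notin cs ++ matched l2 & grp x = i.
Proof.
move=> [e u _] hc; set L := cs ++ matched l2.
case: (pickP [pred x | (x \notin L) && (grp x == i)]) => [x /andP[xL /eqP gx]|no].
  by exists x.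
have := hc i; rewrite map_cat count_cat /= eqxx gsize_candidates leqNgt => /negP[].
have sub : candidates_of grp i \subset [seq a <- L | grp a == i].
  apply/subsetP => x; rewrite inE mem_filter => gx; rewrite gx /=.
  by have := no x; rewrite /= gx andbT => /negbFE.
apply: leq_ltn_trans (subset_leq_card sub) _.
apply: leq_ltn_trans (card_size _) _.
rewrite size_filter /L count_cat addnS ltnS; apply: leq_add.
  by rewrite -e count_map; apply: sub_count => a /=.
by apply: leq_trans (count_matched _ _); rewrite count_map; apply: sub_count => a /=.
Qed.

Lemma filled_perm l cs : filled l [::] cs -> size l = d ->
  exists s : 'S_d, [/\ ranking_seq s = cs, word grp s = map lgroup l &
                       subseq (matched l) (ranking_seq s)].
Proof.
move=> [e u sm] sl; rewrite cats0 in u.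
have sc : size cs = d by have := congr1 size e; rewrite !size_map sl.
pose f (p : 'I_d) := nth p cs p.
have fi : injective f.
  move=> p q; rewrite /f (set_nth_default q) ?sc // => /eqP.
  by rewrite nth_uniq ?sc // => /eqP/val_inj.
have rk : ranking_seq (perm fi) = cs.
  case: (posnP d) => [d0|d0].
    by rewrite (size0nil (etrans sc d0)) (size0nil (etrans (size_ranking _) d0)).
  apply: (@eq_from_nth _ (Ordinal d0)); rewrite size_ranking ?sc // => p hp.
  by rewrite (nth_ranking _ _ hp) permE /f; apply: set_nth_default; rewrite sc.
by exists (perm fi); rewrite /word rk.
Qed.

(** At the full code the value is 1, so [matched l] has size [H 0 0] - 1, which by [dp_complete] no
    common subsequence of r with a fair ranking exceeds. *)
Lemma plan_closest l j s : plan l j -> lcode l = full_code ->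
  word grp s = map lgroup l -> subseq (matched l) (ranking_seq s) ->
  (forall p, p <= d -> fair_word (take p (word grp s))) /\
  forall s' : 'S_d, (forall p, p <= d -> fair_word (take p (word grp s'))) ->
    ulam r s <= ulam r s'.
Proof.
move=> pl hf hw hm; split=> [p pd|s' fs'].
  by rewrite hw; apply: (plan_fair pl); move: (plan_full pl); rewrite hf eqxx => /esym/eqP ->.
have [_ /(_ (plan_valid pl) hf) H1 _] := tableH (lcode_lt (plan_count pl)) (plan_j pl).
have [t [t1 t2 et]] := lcs_length_ex (ranking_seq r) (ranking_seq s').
have := dp_complete gsize_lt tableH fs' (leqnn _) (leq0n d) (leq0n d) (t := t).
rewrite !drop0 take0 /gcode big_nil => /(_ t2 t1) ht.
have mr : subseq (matched l) (ranking_seq r).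
  apply: subseq_trans (plan_sub pl) _; exact: take_subseq.
have := lcs_length_ge mr hm.
rewrite /ulam -et => h; apply: leq_sub2l; apply: leq_trans h.
by move: ht; rewrite -(plan_value pl) H1 addn1 ltnS.
Qed.

End Reconstruction.

(** * The program *)

Declare Scope acmd_scope.
Delimit Scope acmd_scope with A.
Notation "$ x" := (AReg x) (at level 2, x at level 1, format "$ x") : acmd_scope.
Notation "z @[ e ]" := (AGet z e) (at level 2, e at level 99, format "z @[ e ]") : acmd_scope.
Notation "e1 + e2" := (ABin Defs.Add e1 e2) : acmd_scope.
Notation "e1 - e2" := (ABin Defs.Sub e1 e2) : acmd_scope.
Notation "e1 * e2" := (ABin Defs.Mul e1 e2) : acmd_scope.
Notation "e1 / e2" := (ABin Defs.Div e1 e2) : acmd_scope.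
Notation "e1 'mod' e2" := (ABin Defs.Mod e1 e2) (at level 40, no associativity) : acmd_scope.
Notation "e1 == e2" := (ABin Defs.Eq e1 e2) : acmd_scope.
Notation "e1 <= e2" := (ABin Defs.Leq e1 e2) : acmd_scope.
Notation "x ::= e" := (ASet x e%A) (at level 90) : acmd_scope.
Notation "c1 ;; c2" := (ASeq c1 c2) (at level 95, right associativity) : acmd_scope.
Coercion AConst : nat >-> aexpr.
Bind Scope acmd_scope with aexpr acmd.

(* Registers 0 to 11 are constants once the input has been loaded; 12 holds the
   index of the current ranking and 13 the least cost so far.  Registers 20 to
   37 carry results between fragments, notably 22 and 26 the code c and the
   position j of the current cell of the table, 27 and 28 its value and choice,
   24 the validity of c, 33 the output position, and 34, 35, 36 the length,
   position and step of the binary search. *)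
Notation rN := 0 (only parsing).
Notation rD := 1 (only parsing).
Notation rG := 2 (only parsing).
Notation rK := 3 (only parsing).
Notation rB := 4 (only parsing).
Notation rNN := 5 (only parsing).
Notation rFull := 6 (only parsing).
Notation rS := 7 (only parsing).
Notation rL := 8 (only parsing).
Notation rD1 := 9 (only parsing).
Notation rN1 := 10 (only parsing).
Notation rD2 := 11 (only parsing).

Notation zG := 1 (only parsing).
Notation zSZ := 2 (only parsing).
Notation zPW := 3 (only parsing).
Notation zPOS := 4 (only parsing).
Notation zDEL := 5 (only parsing).
Notation zTAU := 6 (only parsing).
Notation zPI := 7 (only parsing).
Notation zH := 8 (only parsing).
Notation zCH := 9 (only parsing).
Notation zOUT := 10 (only parsing).
Notation zGL := 11 (only parsing).
Notation zUSED := 12 (only parsing).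
Notation zCUR := 13 (only parsing).
Notation zINV := 14 (only parsing).
Notation zT := 15 (only parsing).
Notation zBEST := 16 (only parsing).

(** * Loading the input and computing the constants *)

Definition p_load : acmd := (
  AIn rN 0 ;; AIn rD 1 ;; AIn rG 2 ;; AIn rK 3 ;;
  rD1 ::= $rD + 1 ;; rN1 ::= $rN + 1 ;; rD2 ::= $rD + $rD ;;
  rB ::= $rD + ($rG == 1))%A.

Definition p_powers : acmd := (
  14 ::= 1 ;;
  AFor 15 rG (APut zPW $15 $14 ;; 14 ::= $14 * $rB) ;;
  rNN ::= $14)%A.

Definition p_groups : acmd := (
  rFull ::= 0 ;;
  AFor 15 rD
    (AIn 14 (4 + $15) ;;
     APut zG $15 $14 ;;
     APut zSZ $14 (zSZ @[ $14 ] + 1) ;;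
     rFull ::= $rFull + zPW @[ $14 ]))%A.

(* Register rS becomes the largest power 2 ^ (rL - 1) that is at most d. *)
Definition p_log : acmd := (
  rS ::= 1 ;; rL ::= 1 ;;
  AFor 15 rD
    (AIf ($rS + $rS <= $rD) (rS ::= $rS + $rS ;; rL ::= $rL + 1) ASkip))%A.

Definition p_init : acmd := (p_load ;; p_powers ;; p_groups ;; p_log)%A.

Section Init.

Variables (fl ce : nat -> nat -> nat) (lim ab wb : nat).
Hypothesis wb_large : lim + nzones * ab.+1 <= wb.

Local Notation wp := (wp fl ce lim wb).

Variables (d g k : nat) (grp : 'I_d -> 'I_g) (rankings : seq 'S_d).
Local Notation n := (size rankings).

(* Base of the codes of count vectors: each group has fewer than [base] members,
   since groups are nonempty, while [base ^ g <= 2 * d ^ g]. *)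
Definition base : nat := d + (g == 1).
Local Notation NN := (base ^ g).

Hypotheses (g_gt0 : 0 < g) (g_le : g <= d) (k_gt0 : 0 < k) (k_le : k <= d).
Hypothesis limE : lim = 4 + d + n * d.
Hypothesis ab_n : (n + 2) * (d + 2) + 10 <= ab.
Hypothesis ab_NN : (NN + 2) * (d + 2) + 10 <= ab.

Definition low_input (st : astate) : Prop :=
  (forall a : 'I_d, zn st 0 (4 + a) = grp a) /\
  (forall r (p : 'I_d), r < n ->
     zn st 0 (4 + d + r * d + p) = nth 1%g rankings r p).

Record initial (st : astate) : Prop := Initial {
  init_n : zn st 0 0 = n;
  init_d : zn st 0 1 = d;
  init_g : zn st 0 2 = g;
  init_k : zn st 0 3 = k;
  init_low : low_input st;
  init_zones : forall z o, 0 < z -> zn st z o = 0 }.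

Record params (st : astate) : Prop := Params {
  par_n : rg st rN = n;
  par_d : rg st rD = d;
  par_g : rg st rG = g;
  par_k : rg st rK = k;
  par_b : rg st rB = base;
  par_d1 : rg st rD1 = d + 1;
  par_n1 : rg st rN1 = n + 1;
  par_d2 : rg st rD2 = d + d;
  par_low : low_input st }.

Record env (st : astate) : Prop := Env {
  env_par : params st;
  env_NN : rg st rNN = NN;
  env_full : rg st rFull = full_code grp base;
  env_S : rg st rS = 2 ^ (rg st rL).-1;
  env_S2 : d < 2 * rg st rS;
  env_L0 : 0 < rg st rL;
  env_L : rg st rL <= (trunc_log 2 d).+1;
  env_G : forall a : 'I_d, zn st zG a = grp a;
  env_SZ : forall i, i < g -> zn st zSZ i = gsize grp i;
  env_PW : forall i, i < g -> zn st zPW i = base ^ i }.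

Lemma params_frame c st st' : frame c st st' ->
  all (fun x => x \notin wrg c) [:: rN; rD; rG; rK; rB; rD1; rN1; rD2] ->
  0 \notin wzn c -> params st -> params st'.
Proof.
move=> [fr fz] /= /and5P[h1 h2 h3 h4 /and5P[h5 h6 h7 h8 _]] hz.
by case=> *; split; rewrite ?fr // /low_input fz.
Qed.

(** For a concrete fragment the side conditions are closed by computation, which carries the
    environment through all fragments between the initialisation and the output. *)
Lemma env_frame c st st' : frame c st st' ->
  all (fun x => x \notin wrg c) (iota 0 12) ->
  all (fun z => z \notin wzn c) [:: 0; zG; zSZ; zPW] -> env st -> env st'.
Proof.
move=> fr hr hz [hp *]; have [frr frz] := fr.
have /and5P[z0 z1 z2 z3 _] := hz.
have hrx x : x < 12 -> x \notin wrg c.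
  by move=> hx; move/allP: hr => /(_ x); rewrite mem_iota; exact.
split; rewrite ?frr ?frz ?hrx //.
by apply: (params_frame fr _ _ hp) => //=; rewrite !hrx.
Qed.

Lemma env_setr st x v : 11 < x -> env st -> env (setr st x v).
Proof.
move=> hx; apply: (@env_frame (ASet x 0)) => //.
  by split=> //= y; rewrite inE => /negbTE ->.
by apply/allP => y; rewrite mem_iota inE; apply: contraTneq => ->; rewrite -leqNgt.
Qed.

Lemma p_load_ok st : initial st ->
  wp 1 p_load (fun st' => params st') st.
Proof.
case=> i0 i1 i2 i3 low _; rewrite /p_load.
have n_lt : n + 1 < ab by nia.
have d_lt : d + d + 1 < ab by nia.
have l4 : 4 <= lim by rewrite limE; lia.
apply: wp_seq; apply: (wp_in wb_large) => //=; rewrite ?i0; try lia.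
apply: wp_seq; apply: (wp_in wb_large) => //=; rewrite ?i1; try lia.
apply: wp_seq; apply: (wp_in wb_large) => //=; rewrite ?i2; try lia.
apply: wp_seq; apply: (wp_in wb_large) => //=; rewrite ?i3; try lia.
apply: wp_seq; apply: (wp_set wb_large) => //=; try lia.
apply: wp_seq; apply: (wp_set wb_large) => //=; try lia.
apply: wp_seq; apply: (wp_set wb_large) => //=; try lia.
by apply: (wp_set wb_large) => //=; lia.
Qed.

Lemma base_gt0 : 0 < base.
Proof. by clear - g_gt0 g_le; rewrite /base; lia. Qed.

Lemma base_le_NN : base <= NN.
Proof. by rewrite -{1}[base]expn1 leq_pexp2l // base_gt0. Qed.

Lemma pow_le_NN i : i <= g -> base ^ i <= NN.
Proof. by move=> hi; rewrite leq_pexp2l // base_gt0. Qed.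

Lemma p_powers_ok st : params st ->
  wp g.+1 p_powers (fun s =>
    rg s rNN = NN /\ (forall i, i < g -> zn s zPW i = base ^ i)) st.
Proof.
move=> hp; rewrite /p_powers.
have n_lt : n + 1 < ab by nia.
have d_lt : d + d + 1 < ab by nia.
have NN_lt : NN < ab by nia.
apply: wp_seq; apply: (wp_set wb_large) => //=; first by lia.
have hg : rg st rG = g by case: hp.
apply: wp_seq; apply: (wp_for wb_large (W := 1)
  (I := fun i s => rg s 14 = base ^ i /\ forall i', i' < i -> zn s zPW i' = base ^ i'));
  rewrite /= ?hg ?muln1 //; first by lia.
  move=> i s hi fr hx [h14 hpw].
  have hb : rg s rB = base by rewrite fr.1 //=; case: hp.
  have lt1 := leq_ltn_trans (pow_le_NN (ltnW hi)) NN_lt.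
  have lt2 := leq_ltn_trans (pow_le_NN hi) NN_lt.
  apply: wp_seq; apply: (wp_put wb_large) => //=; rewrite ?hx ?h14 //; first by lia.
  apply: (wp_set wb_large) => //=; rewrite ?hx h14 hb -?expnSr //.
  split=> // i' hi'; case: eqP => [->//|ne]; apply: hpw; lia.
move=> s fr [h14 hpw]; apply: (wp_set wb_large) => //=; by rewrite h14.
Qed.

Local Notation groups := [seq nat_of_ord (grp a) | a <- enum 'I_d].

Lemma size_groups : size groups = d.
Proof. by rewrite size_map size_enum_ord. Qed.

Lemma p_groups_ok st : params st ->
  (forall i, i < g -> zn st zPW i = base ^ i) -> (forall o, zn st zSZ o = 0) ->
  wp d.+1 p_groups (fun s =>
    [/\ rg s rFull = full_code grp base, forall a : 'I_d, zn s zG a = grp a &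
        forall i, i < g -> zn s zSZ i = gsize grp i]) st.
Proof.
move=> hp hpw hz; rewrite /p_groups.
have n_lt : n + 1 < ab by nia.
have d_lt : d + d + 1 < ab by nia.
have NN_lt : NN * d + NN + d < ab by nia.
have code_le j : gcode base (take j groups) <= NN * d.
  rewrite /gcode big_seq; apply: leq_trans (_ : \sum_(i <- take j groups) NN <= _).
    rewrite [X in _ <= X]big_seq; apply: leq_sum => i /mem_take/mapP[a _ ->].
    exact/pow_le_NN/ltnW/ltn_ord.
  rewrite big_const_seq iter_addn_0 leq_mul2l count_predT size_take_min.
  by rewrite size_groups geq_minr orbT.
apply: wp_seq; apply: (wp_set wb_large) => //=; first by lia.
have hd : rg st rD = d by case: hp.
apply: (wp_for wb_large (W := 1)
  (I := fun j s => [/\ rg s rFull = gcode base (take j groups),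
     forall a : 'I_d, a < j -> zn s zG a = grp a &
     forall i, zn s zSZ i = count_mem i (take j groups)]));
  rewrite /= ?hd ?muln1 //; first by lia.
- by split=> //; rewrite ?take0 ?/gcode ?big_nil.
- move=> j s hj fr hx [hF hG hS].
  pose a := Ordinal hj.
  have [low _] : low_input s by rewrite /low_input fr.2 //; case: hp.
  have takeE : take j.+1 groups = rcons (take j groups) (grp a).
    rewrite (take_nth 0) ?size_groups //; congr (rcons _ _).
    rewrite (nth_map a) ?size_enum_ord //; congr (nat_of_ord (grp _)).
    by apply: val_inj; rewrite /= nth_enum_ord.
  have pw : zn s zPW (grp a) = base ^ grp a by rewrite fr.2 //= hpw.
  have cl : rg s rFull <= NN * d by rewrite hF code_le.
  have pl := pow_le_NN (ltnW (ltn_ord (grp a))).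
  have cnt : zn s zSZ (grp a) <= d.
    rewrite hS; apply: leq_trans (count_size _ _) _; rewrite size_take_min.
    by rewrite size_groups geq_minr.
  have ga := ltn_ord (grp a).
  apply: wp_seq; apply: (wp_in wb_large) => //=; rewrite ?hx ?(low a); try lia.
  apply: wp_seq; apply: (wp_put wb_large) => //=; rewrite ?hx; try lia.
  apply: wp_seq; apply: (wp_put wb_large) => //=; try lia.
  apply: (wp_set wb_large) => //=; rewrite ?pw; try lia.
  split=> [|a' ha'|i] /=.
  + by rewrite takeE gcode_rcons hF.
  + case: eqP => [e|ne]; first by congr (nat_of_ord (grp _)); apply: val_inj.
    by apply: hG; lia.
  rewrite takeE -cats1 count_cat /= addn0 eq_sym !hS; by case: eqP => [->|_] //; rewrite addn0.
move=> s fr [hF hG hS].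
have tk : take d groups = groups by rewrite take_oversize // size_groups.
by rewrite tk in hF hS; split=> // a; apply: hG.
Qed.

Lemma p_log_ok st : params st ->
  wp d.+1 p_log (fun s =>
    [/\ rg s rS = 2 ^ (rg s rL).-1, d < 2 * rg s rS, 0 < rg s rL &
        rg s rL <= (trunc_log 2 d).+1]) st.
Proof.
move=> hp; rewrite /p_log.
have d_lt : d + d + 1 < ab by nia.
have hd : rg st rD = d by case: hp.
apply: wp_seq; apply: (wp_set wb_large) => //=; first by lia.
apply: wp_seq; apply: (wp_set wb_large) => //=; first by lia.
(* After j rounds either the power can no longer double or it has doubled j times; the latter is
   impossible for j = d, as 2 ^ d > d. *)
apply: (wp_for wb_large (W := 1)
  (I := fun j s => [/\ rg s rS = 2 ^ (rg s rL).-1, rg s rS <= d, 0 < rg s rL,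
     rg s rL <= j.+1 & d < 2 * rg s rS \/ rg s rL = j.+1]));
  rewrite /= ?hd ?muln1 //; first by lia.
- by split=> //; [lia | right].
- move=> j s hj fr hx [hS hSd hL hLj hor].
  have hd' : rg s rD = d by rewrite fr.1.
  apply: wp_if => //=; rewrite hd'.
    case: leqP => // le _.
    apply: wp_seq; apply: (wp_set wb_large) => //=; first by lia.
    apply: (wp_set wb_large) => //=; first by lia.
    split=> /=; try lia.
      by rewrite addn1 /= -[in RHS](prednK hL) expnS -hS addnn mul2n.
  case: leqP => // le _; apply: wp_skip => //=.
  by split=> //; [lia | left; lia].
move=> s fr [hS hSd hL hLj hor]; split=> //.
  case: hor => // e; move: hSd; rewrite hS e /= => h.
  by have := ltn_expl d (isT : 1 < 2); lia.
rewrite -[X in X <= _](prednK hL) ltnS trunc_log_max //.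
by rewrite -hS.
Qed.

Lemma p_init_ok st : initial st -> wp d.+1 p_init env st.
Proof.
move=> hi; rewrite /p_init.
apply: wp_seq; apply: (wp_cons (W := 1)) (p_load_ok hi) _ => // s1 f1 h1.
apply: wp_seq; apply: (wp_cons _ (p_powers_ok h1)) => // s2 f2 [hNN hPW].
have h2 : params s2 by exact: params_frame f2 _ _ h1.
have z2 o : zn s2 zSZ o = 0.
  by rewrite f2.2 // f1.2 //; apply: (init_zones hi).
apply: wp_seq; apply: (wp_cons _ (p_groups_ok h2 hPW z2)) => // s3 f3 [hF hG hS].
have h3 : params s3 by exact: params_frame f3 _ _ h2.
apply: (wp_cons _ (p_log_ok h3)) => // s4 f4 [l1 l2 l3 l4].
have h4 : params s4 by exact: params_frame f4 _ _ h3.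
split=> //.
- by rewrite f4.1 // f3.1.
- by rewrite f4.1.
- by move=> a; rewrite f4.2.
- by move=> i hi'; rewrite f4.2 // hS.
by move=> i hi'; rewrite f4.2 // f3.2 // hPW.
Qed.

End Init.

(** * Computing the majority ranking *)

Definition p_positions : acmd := (
  AFor 15 rN (AFor 16 rD
    (AIn 14 (4 + $rD + $15 * $rD + $16) ;;
     APut zPOS ($15 * $rD + $14) $16)))%A.

Definition p_inversions : acmd := (
  20 ::= 0 ;;
  AFor 15 rN (20 ::= $20 +
    (zPOS @[ $15 * $rD + $18 ] + 1 <= zPOS @[ $15 * $rD + $17 ])))%A.

(** One pass is enough: [del] only grows, so a pair once examined is uncontested or has a deleted
    member for good. *)
Definition p_greedy : acmd := (
  AFor 17 rD (AFor 18 rD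
    (p_inversions ;;
     AIf (($rN <= 3 * $20) * ($rN <= 3 * ($rN - $20))
            * ((1 - zDEL @[ $17 ]) * (1 - zDEL @[ $18 ])))
       (APut zDEL $17 1 ;; APut zDEL $18 1) ASkip)))%A.

(** The summand is [before] in 0/1 arithmetic; register 21 ends as the rank of the candidate in
    register 17. *)
Definition p_tau : acmd := (
  AFor 17 rD
    (21 ::= 0 ;;
     AFor 18 rD
       (p_inversions ;;
        21 ::= $21 + (zDEL @[ $17 ] * ((1 - zDEL @[ $18 ])
                        + zDEL @[ $18 ] * ($18 + 1 <= $17))
                      + (1 - zDEL @[ $17 ]) * (1 - zDEL @[ $18 ])
                        * (3 * ($rN - $20) + 1 <= $rN))) ;;
     APut zTAU $21 $17))%A.

Definition p_relative : acmd := (p_positions ;; p_greedy ;; p_tau)%A.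

Lemma cell_inj d r r' a a' : a < d -> a' < d ->
  (r * d + a == r' * d + a') = (r == r') && (a == a').
Proof.
move=> ha ha'; apply/eqP/andP => [e|[/eqP-> /eqP->]] //.
have er : r = r'.
  have := congr1 (fun x => x %/ d) e.
  by rewrite !divnMDl ?(leq_ltn_trans _ ha) // !divn_small // !addn0.
by move: e; rewrite er => /addnI ->; rewrite !eqxx.
Qed.

Section Relative.

Variables (fl ce : nat -> nat -> nat) (lim ab wb : nat).
Hypothesis wb_large : lim + nzones * ab.+1 <= wb.

Local Notation wp := (wp fl ce lim wb).

Variables (d g k : nat) (grp : 'I_d -> 'I_g) (rankings : seq 'S_d).
Local Notation n := (size rankings).
Local Notation env := (env k grp rankings).
Local Notation rk r := (nth 1%g rankings r).

Hypothesis limE : lim = 4 + d + n * d.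
Hypothesis ab_n : (n + 2) * (d + 2) + 10 <= ab.
Hypothesis uniq_rk : uniq rankings.
Hypothesis n_gt0 : 0 < n.

Local Notation S := [set s in rankings].

Lemma card_S : #|S| = n.
Proof. by rewrite cardsE; apply/card_uniqP. Qed.

Definition positions st := forall r (a : 'I_d), r < n ->
  zn st zPOS (r * d + a) = pos (rk r) a.

Lemma p_positions_ok st : env st ->
  wp (n.+1 * d.+1) p_positions positions st.
Proof.
move=> he; rewrite /p_positions.
have hn : rg st rN = n by case: (env_par he).
have n_lt : n + d + 1 < ab by nia.
apply: (wp_for wb_large (W := d.+1)
  (I := fun r s => forall r' (a : 'I_d), r' < r ->
     zn s zPOS (r' * d + a) = pos (rk r') a)); rewrite /= ?hn //; first by lia.
move=> r s hr fr hx hpos.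
have hs : env s by exact: env_frame fr _ _ he.
have hd : rg s rD = d by case: (env_par hs).
apply: (wp_for wb_large (W := 1)
  (I := fun p s => (forall r' (a : 'I_d), r' < r ->
     zn s zPOS (r' * d + a) = pos (rk r') a) /\
     (forall a : 'I_d, pos (rk r) a < p -> zn s zPOS (r * d + a) = pos (rk r) a)));
  rewrite /= ?hd ?muln1 //; first by lia.
- move=> p s' hp fr' hx' [h1 h2]; pose q := Ordinal hp.
  have he' : env s' by exact: env_frame fr' _ _ hs.
  have hd' : rg s' rD = d by case: (env_par he').
  have hr' : rg s' 15 = r by rewrite fr'.1.
  have [_ /(_ r q hr) low] := par_low (env_par he').
  have rd : r * d + d <= n * d by rewrite -mulSnr leq_mul2r hr orbT.
  have ndab : n * d + 2 * d < ab by nia.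
  have nq : rk r q < ab by have := ltn_ord (rk r q); move: (nat_of_ord _) => x; lia.
  have cl : r * d + rk r q < ab.
    by have := ltn_ord (rk r q); move: (nat_of_ord _) => x; lia.
  apply: wp_seq; apply: (wp_in wb_large) => //=; rewrite ?hd' ?hr' ?hx' ?low //; try lia.
  apply: (wp_put wb_large) => //=; rewrite ?hd' ?hr' ?hx' //; try lia.
  split=> [r' a hlt|a hlt].
    rewrite cell_inj ?ltn_ord //; case: eqP => [e|_] /=; last exact: h1.
    by move: hlt; rewrite e ltnn.
  rewrite cell_inj ?ltn_ord // eqxx /=; case: eqP => [e|ne].
    have -> : a = rk r q by apply: val_inj.
    by rewrite pos_perm.
  apply: h2; move: hlt; rewrite ltnS leq_eqVlt => /orP[/eqP e|//].
  case: ne; have -> // : a = rk r q; apply: (@pos_inj _ (rk r)).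
  by rewrite pos_perm.
move=> s' fr' [h1 h2] r' a; rewrite ltnS leq_eqVlt => /orP[/eqP ->|]; last exact: h1.
by apply: h2; exact: ltn_ord.
Qed.

Lemma inversionsE (a b : 'I_d) :
  inversions S a b = count (fun s => pos s b < pos s a) rankings.
Proof.
rewrite /inversions -size_filter.
have /card_uniqP <- : uniq [seq s <- rankings | pos s b < pos s a].
  exact: filter_uniq.
by apply: eq_card => s; rewrite mem_filter !inE andbC.
Qed.

Lemma p_inversions_ok st (a b : 'I_d) : env st -> positions st ->
  rg st 17 = a -> rg st 18 = b ->
  wp n.+1 p_inversions (fun s => rg s 20 = inversions S a b) st.
Proof.
move=> he hpos ha hb; rewrite /p_inversions inversionsE.
have hn : rg st rN = n by case: (env_par he).
have n_lt : n + d + 1 < ab by nia.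
apply: wp_seq; apply: (wp_set wb_large) => //=; first by lia.
apply: (wp_for wb_large (W := 1)
  (I := fun r s => rg s 20 = count (fun s => pos s b < pos s a) (take r rankings)));
  rewrite /= ?hn ?muln1 //; first by lia.
- by rewrite take0.
- move=> r s hr fr hx h20.
  have hs : env s by exact: env_frame fr _ _ (env_setr 0 (isT : 11 < 20) he).
  have hd : rg s rD = d by case: (env_par hs).
  have le20 : rg s 20 <= n.
    by rewrite h20; apply: leq_trans (count_size _ _) _; rewrite size_take_min geq_minr.
  have s17 : rg s 17 = a by rewrite fr.1.
  have s18 : rg s 18 = b by rewrite fr.1.
  have sp c : zn s zPOS (r * d + nat_of_ord c) = pos (rk r) c by rewrite fr.2 // hpos.
  apply: (wp_set wb_large) => //=; rewrite hx hd s17 s18 !sp.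
    by case: (_ + 1 <= _); lia.
  by rewrite (take_nth 1%g) // -cats1 count_cat /= addn0 h20 addn1.
by move=> s fr ->; rewrite take_size.
Qed.

Local Notation contested := (contested S).

(* What a maximal matching of contested pairs guarantees: each pair has an
   element outside any uncontested set G. *)
Definition greedy (del : {set 'I_d}) : Prop :=
  forall G : {set 'I_d}, {in G &, forall a b, ~~ contested a b} ->
    #|del :&: G| <= #|del :\: G|.

(** A contested pair does not lie inside G, so it adds at most one element to [del :&: G] and at
    least one to [del :\: G]. *)
Lemma greedy_step (del : {set 'I_d}) a b : greedy del -> contested a b ->
  a \notin del -> b \notin del -> greedy (a |: (b |: del)).
Proof.
move=> hd cab ad bd G hG; have := hd G hG.
have inc x (A : {set 'I_d}) : x \notin A ->
    #|(x |: A) :&: G| = (x \in G) + #|A :&: G| /\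
    #|(x |: A) :\: G| = (x \notin G) + #|A :\: G|.
  move=> xA; rewrite setIUl setDUl; case: (boolP (x \in G)) => xG.
    have -> : [set x] :&: G = [set x] by apply/setIidPl; rewrite sub1set.
    have -> : [set x] :\: G = set0 by apply/eqP; rewrite setD_eq0 sub1set.
    by rewrite set0U cardsU1 inE (negbTE xA).
  have -> : [set x] :&: G = set0.
    by apply/setP => y; rewrite !inE; case: eqP => [->|//]; rewrite (negbTE xG).
  have -> : [set x] :\: G = [set x].
    by apply/setP => y; rewrite !inE; case: eqP => [->|//]; rewrite ?xG ?andbF ?andbT.
  by rewrite set0U cardsU1 inE (negbTE xA) andbF.
have nab : a != b.
  apply: contraTneq cab => ->; rewrite /contested inversions_id card_S.
  by rewrite muln0 leqn0 eqn0Ngt n_gt0.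
have [] := inc a (b |: del); first by rewrite !inE negb_or nab.
move=> -> ->; have [-> ->] := inc b del bd.
case: (boolP (a \in G)) => aG; case: (boolP (b \in G)) => bG /=; try lia.
by have := hG a b aG bG; rewrite cab.
Qed.

Definition deleted (del : {set 'I_d}) st := forall a : 'I_d, zn st zDEL a = (a \in del).

Lemma p_greedy_ok st : env st -> positions st -> (forall o, zn st zDEL o = 0) ->
  wp (d.+1 * (d.+1 * n.+1)) p_greedy (fun s => exists del : {set 'I_d},
    [/\ deleted del s, greedy del & {in ~: del &, forall a b, ~~ contested a b}]) st.
Proof.
move=> he hpos h0; rewrite /p_greedy.
have hd : rg st rD = d by case: (env_par he).
have n_lt : n + d + 1 < ab by nia.
apply: (wp_for wb_large (W := d.+1 * n.+1)
  (I := fun i s => exists del : {set 'I_d}, [/\ deleted del s, greedy del &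
     forall a b : 'I_d, a < i -> a \notin del -> b \notin del -> ~~ contested a b]));
  rewrite /= ?hd //; first by lia.
- exists set0; split=> //; first by move=> a; rewrite inE /= h0.
  by move=> G _; rewrite set0I set0D.
- move=> i s hi fr hx [del0 [hdel0 hgr0 hun0]]; pose a := Ordinal hi.
  have hs : env s by exact: env_frame fr _ _ he.
  have hds : rg s rD = d by case: (env_par hs).
  apply: (wp_for wb_large (W := n.+1)
    (I := fun j s => exists del : {set 'I_d}, [/\ deleted del s, greedy del &
       forall a b : 'I_d, (a < i) || (a == i :> nat) && (b < j) ->
         a \notin del -> b \notin del -> ~~ contested a b]));
    rewrite /= ?hds //; first by lia.
  + exists del0; split=> // a' b'; rewrite ltn0 andbF orbF; exact: hun0.
  + move=> j s' hj fr' hx' [del [hdel hgr hun]]; pose b := Ordinal hj.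
    have hs' : env s' by exact: env_frame fr' _ _ hs.
    have pos' : positions s' by move=> r c hr; rewrite fr'.2 // fr.2 // hpos.
    have h17 : rg s' 17 = a by rewrite fr'.1.
    apply: wp_seq; apply: (wp_cons _ (p_inversions_ok (b := b) hs' pos' h17 hx')) => //.
    move=> s2 fr2 h20.
    have hs2 : env s2 by exact: env_frame fr2 _ _ hs'.
    have hn2 : rg s2 rN = n by case: (env_par hs2).
    have r17 : rg s2 17 = a by rewrite fr2.1.
    have r18 : rg s2 18 = b by rewrite fr2.1.
    have del2 : deleted del s2 by move=> c; rewrite fr2.2.
    have cond : aeval fl ce s2 (($rN <= 3 * $20) * ($rN <= 3 * ($rN - $20))
            * ((1 - zDEL @[ $17 ]) * (1 - zDEL @[ $18 ])))%A =
        (contested a b && ((a \notin del) && (b \notin del))).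
      rewrite /= h20 hn2 r17 r18 !del2 /contested card_S.
      by do 2!case: (_ \in del); do 2!case: (n <= _).
        apply: wp_if => //; rewrite cond.
      rewrite eqb0 negbK => /and3P[cab ad bd].
      apply: wp_seq; apply: (wp_put wb_large) => //=; rewrite ?r17; try by have := ltn_ord a; lia.
      apply: (wp_put wb_large) => //=; rewrite ?r18; try by have := ltn_ord b; lia.
      exists (a |: (b |: del)); split; last 2 first.
      - exact: greedy_step.
      - move=> a' b' hc; rewrite !inE !negb_or => /and3P[na1 nb1 a'd] /and3P[na2 nb2 b'd].
        apply: hun => //; move: hc; case: (ltnP a' i) => //= _ /andP[-> /=].
        rewrite ltnS leq_eqVlt => /orP[/eqP e|//].
        by case/eqP: nb2; apply: val_inj.
      move=> c /=; rewrite !inE -!val_eqE /=; case: eqP => [->|_]; first by rewrite orbT.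
      by case: eqP => //= _; rewrite del2.
    move=> /eqP; rewrite eqb0 => nc; apply: wp_skip => //.
    exists del; split=> // a' b' hc a'd b'd.
    case: (boolP ((a' < i) || (a' == i :> nat) && (b' < j))) => hc'; first exact: hun.
    have [ea eb] : a' = a /\ b' = b.
      move: hc hc'; case: (ltnP a' i) => //= _; case: eqP => //= ea.
      by rewrite ltnS leq_eqVlt => /orP[/eqP eb _|-> //]; split; apply: val_inj.
    by move: nc; rewrite -ea -eb a'd b'd !andbT.
  move=> s' fr' [del [hdel hgr hun]]; exists del; split=> // a' b' ha' a'd b'd.
  by apply: hun => //; rewrite ltn_ord andbT orbC -leq_eqVlt.
move=> s fr [del [hdel hgr hun]]; exists del; split=> // a b; rewrite !inE => ad bd.
by apply: hun => //; exact: ltn_ord.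
Qed.

Definition tau_of del st := exists tau : 'S_d,
  (forall a, pos tau a = order_rank (before S del) a) /\
  (forall p : 'I_d, zn st zTAU p = tau p).

Lemma p_tau_ok del st : env st -> positions st -> deleted del st ->
  {in ~: del &, forall a b, ~~ contested a b} ->
  wp (d.+1 * (d.+1 * n.+1)) p_tau (tau_of del) st.
Proof.
move=> he hpos hdel hun; rewrite /p_tau.
have hd : rg st rD = d by case: (env_par he).
have n_lt : n + d + 1 < ab by nia.
have S_gt0 : 0 < #|S| by rewrite card_S.
pose lt := before S del.
have lt_irr : irreflexive lt by exact: before_irr.
have lt_tr : transitive lt by exact: before_tr.
have lt_tot a b : a != b -> lt a b || lt b a by exact: before_total.
have rank_inj := order_rank_inj lt_irr lt_tr lt_tot.
apply: (wp_for wb_large (W := d.+1 * n.+1)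
  (I := fun i s => forall a : 'I_d, a < i -> zn s zTAU (order_rank lt a) = a));
  rewrite /= ?hd //; first by lia.
  move=> i s hi fr hx hT; pose a := Ordinal hi.
  have hs : env s by exact: env_frame fr _ _ he.
  have hds : rg s rD = d by case: (env_par hs).
  apply: wp_seq; apply: (wp_set wb_large) => //=; first by lia.
  apply: wp_seq; apply: (wp_for wb_large (W := n.+1)
    (I := fun j s => rg s 21 = count (fun b => lt b a) (take j (enum 'I_d))));
    rewrite /= ?hds //; first by lia.
  - by rewrite take0.
  - move=> j s' hj fr' hx' h21; pose b := Ordinal hj.
    have hs' : env s' by exact: env_frame fr' _ _ (env_setr 0 (isT : 11 < 21) hs).
    have pos' : positions s' by move=> r c hr; rewrite fr'.2 //= fr.2 // hpos.
    have h17 : rg s' 17 = a by rewrite fr'.1.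
    apply: wp_seq; apply: (wp_cons _ (p_inversions_ok (b := b) hs' pos' h17 hx')) => //.
    move=> s2 fr2 h20.
    have hs2 : env s2 by exact: env_frame fr2 _ _ hs'.
    have hn2 : rg s2 rN = n by case: (env_par hs2).
    have r17 : rg s2 17 = a by rewrite fr2.1.
    have r18 : rg s2 18 = b by rewrite fr2.1.
    have del2 : deleted del s2 by move=> c; rewrite fr2.2 //= fr'.2 //= fr.2.
    have cnt : count (fun b => lt b a) (take j (enum 'I_d)) <= j.
      apply: leq_trans (count_size _ _) _; rewrite size_take_min; exact: geq_minl.
    have tk : take j.+1 (enum 'I_d) = rcons (take j (enum 'I_d)) b.
      rewrite (take_nth b) ?size_enum_ord //; congr (rcons _ _).
      by apply: val_inj; rewrite /= nth_enum_ord.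
    have cond : aeval fl ce s2 ($21 + (zDEL @[ $17 ] * ((1 - zDEL @[ $18 ])
                        + zDEL @[ $18 ] * ($18 + 1 <= $17))
                      + (1 - zDEL @[ $17 ]) * (1 - zDEL @[ $18 ])
                        * (3 * ($rN - $20) + 1 <= $rN)))%A =
        count (fun b => lt b a) (take j.+1 (enum 'I_d)).
      rewrite tk -cats1 count_cat -h21 -(fr2.1 21) // [aeval _ _ _ _]/=.
      rewrite h20 hn2 r17 r18 !del2 !addn1; congr (_ + _).
      rewrite /= addn0 /lt /before card_S; do 2!case: (_ \in del) => //=;
        by rewrite !(subnn, subn0, mul1n, mul0n, add0n, addn0).
    apply: (wp_set wb_large) => //; rewrite cond //.
    apply: (@leq_ltn_trans j.+1); last by lia.
    apply: leq_trans (count_size _ _) _; rewrite size_take_min; exact: geq_minl.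
  move=> s' fr' h21.
  have rk_a : rg s' 21 = order_rank lt a.
    rewrite h21 take_oversize ?size_enum_ord // /order_rank -size_filter.
    have /card_uniqP <- : uniq [seq b <- enum 'I_d | lt b a] by rewrite filter_uniq ?enum_uniq.
    by apply: eq_card => b; rewrite mem_filter mem_enum !inE andbT.
  have rlt := order_rank_lt lt_irr a.
  have h17 : rg s' 17 = a by rewrite fr'.1.
  apply: (wp_put wb_large) => //=; rewrite ?rk_a ?h17; try lia.
    by have := ltn_ord a; lia.
  move=> c; rewrite ltnS leq_eqVlt => hc; case: eqP => [/rank_inj -> //|ne].
  case/orP: hc => [/eqP e|hc]; last by rewrite fr'.2 //= hT.
  by case: ne; congr order_rank; apply: val_inj.
move=> s fr hT.
have [tau htau] := order_perm lt_irr lt_tr lt_tot.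
exists tau; split=> // p.
by have := hT (tau p) (ltn_ord _); rewrite -htau pos_perm.
Qed.

Lemma p_relative_ok st : env st -> (forall o, zn st zDEL o = 0) ->
  wp (d.+1 * (d.+1 * n.+1)) p_relative (fun s => exists del,
    [/\ greedy del, {in ~: del &, forall a b, ~~ contested a b} & tau_of del s]) st.
Proof.
move=> he h0; rewrite /p_relative.
apply: wp_seq; apply: (wp_cons _ (p_positions_ok he)) => [|s1 f1 h1]; first by nia.
have e1 : env s1 by exact: env_frame f1 _ _ he.
have z1 o : zn s1 zDEL o = 0 by rewrite f1.2.
apply: wp_seq; apply: (wp_cons _ (p_greedy_ok e1 h1 z1)) => // s2 f2 [del [hdel hgr hun]].
have e2 : env s2 by exact: env_frame f2 _ _ e1.
have h2 : positions s2 by move=> r a hr; rewrite f2.2 // h1.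
by apply: (wp_cons _ (p_tau_ok e2 h2 hdel hun)) => // s3 f3 h3; exists del.
Qed.

End Relative.

(** * Filling the table *)

Notation digit_of c i := ($c / zPW @[ $i ] mod $rB)%A (only parsing).

Definition p_valid : acmd := (
  23 ::= 0 ;;
  AFor 25 rG (23 ::= $23 + digit_of 22 25) ;;
  24 ::= 1 ;;
  AFor 25 rG (24 ::= $24 *
    (1 - ($rK <= $23) * (1 - (AFloor $25 $23 <= digit_of 22 25)
                             * (digit_of 22 25 <= ACeil $25 $23)))))%A.

Definition p_advance : acmd := (
  AIf ($26 + 1 <= $rD)
    (29 ::= zH @[ $22 * $rD1 + ($26 + 1) ] ;;
     AIf ($27 + 1 <= $29) (27 ::= $29 ;; 28 ::= $rG) ASkip ;;
     32 ::= zG @[ zPI @[ $26 ] ] ;;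
     AIf (digit_of 22 32 + 1 <= zSZ @[ $32 ])
       (29 ::= zH @[ ($22 + zPW @[ $32 ]) * $rD1 + ($26 + 1) ] ;;
        AIf ((1 <= $29) * ($27 <= $29)) (27 ::= $29 + 1 ;; 28 ::= $rG + 1) ASkip)
       ASkip)
    ASkip)%A.

Definition p_fillers : acmd := (
  AFor 25 rG
    (AIf (digit_of 22 25 + 1 <= zSZ @[ $25 ])
       (29 ::= zH @[ ($22 + zPW @[ $25 ]) * $rD1 + $26 ] ;;
        AIf ($27 + 1 <= $29) (27 ::= $29 ;; 28 ::= $25) ASkip)
       ASkip))%A.

Definition p_cell : acmd := (
  27 ::= 0 ;; 28 ::= 0 ;;
  AIf $24 (AIf ($22 == $rFull) (27 ::= 1) (p_advance ;; p_fillers)) ASkip ;;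
  APut zH ($22 * $rD1 + $26) $27 ;; APut zCH ($22 * $rD1 + $26) $28)%A.

(** Codes and positions run downwards: a cell reads only cells of larger code, or of the same code
    and larger position. Validity depends on the code alone and is tested once per row. *)
Definition p_dp : acmd := (
  AFor 30 rNN
    (22 ::= $rNN - 1 - $30 ;; p_valid ;;
     AFor 31 rD1 (26 ::= $rD - $31 ;; p_cell)))%A.

Section Table.

Variables (fl ce : nat -> nat -> nat) (lim ab wb : nat).
Hypothesis wb_large : lim + nzones * ab.+1 <= wb.

Local Notation wp := (wp fl ce lim wb).

Variables (d g k : nat) (grp : 'I_d -> 'I_g) (rankings : seq 'S_d).
Local Notation n := (size rankings).
Local Notation env := (env k grp rankings).
Local Notation b := (base d g).
Local Notation NN := (b ^ g).
Local Notation gsize := (gsize grp).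
Local Notation room := (room grp b).
Local Notation valid := (valid_code g k b fl ce).

Hypotheses (g_gt0 : 0 < g) (g_le : g <= d) (k_le : k <= d).
Hypothesis ab_n : (n + 2) * (d + 2) + 10 <= ab.
Hypothesis ab_NN : (NN + 2) * (d + 2) + 10 <= ab.

Variable r : 'S_d.

Lemma digits_small : g * b <= ab.
Proof.
apply: leq_trans ab_NN; rewrite mulnC; apply: leq_trans (leq_addr _ _).
by apply: leq_mul; [have := base_le_NN g_gt0 g_le | ]; lia.
Qed.

Definition loaded (s : 'S_d) z st := forall p : 'I_d, zn st z p = s p.

Definition value st c j := zn st zH (c * d.+1 + j).
Definition choice_at st c j := zn st zCH (c * d.+1 + j).

Lemma wp_cut W W1 c1 c2 Q1 (Q : astate -> Prop) st : W1 <= W ->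
  wp W1 c1 Q1 st -> (forall s, frame c1 st s -> Q1 s -> wp W c2 Q s) ->
  wp W (ASeq c1 c2) Q st.
Proof. by move=> hW h1 h2; apply: wp_seq; apply: (wp_cons hW h1). Qed.

Lemma digitE st c i : env st -> i < g ->
  c %/ zn st zPW i %% rg st rB = digit b c i.
Proof. by move=> he hi; rewrite (env_PW he) // (par_b (env_par he)). Qed.

Lemma p_valid_ok st c : env st -> rg st 22 = c ->
  wp g.+1 p_valid (fun s => rg s 24 = valid c) st.
Proof.
move=> he hc; rewrite /p_valid.
have d_lt : d + d + 1 < ab by nia.
have b0 : 0 < b by rewrite /base; lia.
have hg : rg st rG = g by case: (env_par he).
apply: wp_seq; apply: (wp_set wb_large) => //=; first by lia.
apply: (@wp_cut _ _ _ _ (fun s => rg s 23 = \sum_(i < g) digit b c i) _ _ (leqnn _)).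
  apply: (wp_for wb_large (W := 1) (I := fun m s => rg s 23 = \sum_(i < m) digit b c i));
    rewrite /= ?hg ?muln1 //; first by lia.
  - by rewrite big_ord0.
  move=> i s hi fr hx h23.
  have hs : env s by exact: env_frame fr _ _ (env_setr 0 (isT : 11 < 23) he).
  have s22 : rg s 22 = c by rewrite fr.1.
  have de := digitE c hs hi.
  have lt : \sum_(i0 < i) digit b c i0 + digit b c i < ab.
    rewrite -(big_ord_recr i (fun i0 => digit b c i0)) /=.
    apply: leq_trans digits_small; apply: (@leq_ltn_trans (i.+1 * b.-1)).
      have -> : i.+1 * b.-1 = \sum_(i0 < i.+1) b.-1 by rewrite sum_nat_const card_ord.
      apply: leq_sum => x _.
      by rewrite -ltnS prednK // ltn_mod.
    by move: hi b0; case: (b) => // m; nia.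
  by apply: (wp_set wb_large) => //=; rewrite h23 s22 hx de // big_ord_recr.
move=> s1 f1 h23; set tot := \sum_(i < g) _ in h23.
have hs1 : env s1 by exact: env_frame f1 _ _ (env_setr 0 (isT : 11 < 23) he).
apply: wp_seq; apply: (wp_set wb_large) => //=; first by lia.
pose good i := fl i tot <= digit b c i <= ce i tot.
apply: (wp_for wb_large (W := 1)
  (I := fun m s => rg s 24 = ((k <= tot) ==> all good (iota 0 m))));
  rewrite /= ?(par_g (env_par hs1)) ?muln1 //; first by lia.
- by rewrite implybT.
- move=> i s hi fr hx h24.
  have hs : env s by exact: env_frame fr _ _ (env_setr 1 (isT : 11 < 24) hs1).
  have s22 : rg s 22 = c by rewrite fr.1 //= f1.1.
  have s23 : rg s 23 = tot by rewrite fr.1.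
  have de := digitE c hs hi.
  have e : aeval fl ce s ($24 *
    (1 - ($rK <= $23) * (1 - (AFloor $25 $23 <= digit_of 22 25)
                             * (digit_of 22 25 <= ACeil $25 $23))))%A =
    ((k <= tot) ==> all good (iota 0 i.+1)).
    rewrite [LHS]/= hx s22 s23 de (par_k (env_par hs)) h24.
    have -> : iota 0 i.+1 = rcons (iota 0 i) i by rewrite -addn1 iotaD cats1.
    rewrite all_rcons /good; case: (k <= tot) => //=.
    by case: (all _ _); case: (fl _ _ <= _); case: (_ <= ce _ _).
  by apply: (wp_set wb_large) => //; rewrite e //; case: (_ ==> _); lia.
Qed.

Section Cell.

Variables (st : astate) (c j : nat).
Hypotheses (he : env st) (hr : loaded r zPI st) (hj : j <= d) (hc : c < NN).
Hypothesis value_le : forall c j, j <= d -> value st c j + j <= d.+1.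

Local Notation H := (value st).
Local Notation grp_at := (nth 0 (word grp r) j).

Definition option_inv s : Prop :=
  [/\ rg s 27 + j <= d.+1, rg s 28 <= g.+1 &
  0 < rg s 27 -> dp_chosen grp b r H c j (rg s 27) (rg s 28)].

Lemma advance_ok s : env s -> zn s zH = zn st zH -> loaded r zPI s ->
  rg s 22 = c -> rg s 26 = j -> rg s 27 = 0 -> rg s 28 = 0 ->
  wp 1 p_advance (fun s' => [/\ option_inv s',
     j < d -> H c j.+1 <= rg s' 27 &
     j < d -> room c grp_at -> 0 < H (c + b ^ grp_at) j.+1 ->
       H (c + b ^ grp_at) j.+1 < rg s' 27]) s.
Proof.
move=> es eH er s22 s26 s27 s28; rewrite /p_advance.
have d_lt : d + d + 3 < ab by nia.
apply: wp_if => //=; rewrite s26 (par_d (env_par es)); last first.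
  move=> /eqP; rewrite eqb0 addn1 -leqNgt => dj; apply: wp_skip => //.
  have -> : (j < d) = false by rewrite ltnNge dj.
  by rewrite /option_inv s27 s28; split=> //; split=> //; exact: leqW.
rewrite eqb0 negbK addn1 => jd.
have gE : grp_at = grp (r (Ordinal jd)) := nth_word grp r jd.
have HE c' : zn s zH (c' * d.+1 + j.+1) = H c' j.+1 by rewrite eH.
have vl c' : H c' j.+1 + j.+1 <= d.+1 by exact: value_le.
apply: wp_seq; apply: (wp_set wb_large) => //=;
  rewrite s22 (par_d1 (env_par es)) s26 !addn1 HE; first by have := vl c; lia.
apply: (@wp_cut _ 1 _ _ (fun s' => option_inv s' /\ H c j.+1 <= rg s' 27)) => //.
  apply: wp_if => //=; rewrite s27 ?addn1.
    rewrite eqb0 negbK => Hp.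
    apply: wp_seq; apply: (wp_set wb_large) => //=; first by have := vl c; lia.
    apply: (wp_set wb_large) => //=; rewrite (par_g (env_par es)); first by lia.
    split=> //; split=> /= [||_]; [by have := vl c; lia | by [] | by constructor 1].
  move=> /eqP; rewrite eqb0 -leqNgt => Hp; apply: wp_skip => //.
  by rewrite /option_inv /= s27 s28; split=> //; split=> //; lia.
move=> s1 f1 [[h27 h28 hch] hs1].
have es1 : env s1 by exact: env_frame f1 _ _ (env_setr _ (isT : 11 < 29) es).
have s22' : rg s1 22 = c by rewrite f1.1.
have s26' : rg s1 26 = j by rewrite f1.1.
have er' : zn s1 zPI j = r (Ordinal jd) by rewrite f1.2 //= (er (Ordinal jd)).
have HE' c' : zn s1 zH (c' * d.+1 + j.+1) = H c' j.+1 by rewrite f1.2 //= HE.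
have gi : grp_at < g by rewrite gE ltn_ord.
apply: wp_seq; apply: (wp_set wb_large) => //=; rewrite s26' er' (env_G es1) -gE; first by lia.
have es2 := env_setr grp_at (isT : 11 < 32) es1.
apply: wp_if => //=; rewrite s22' (digitE _ es1 gi) (env_SZ es1 gi) addn1 -/(room c grp_at).
  rewrite eqb0 negbK => rm.
  apply: wp_seq; apply: (wp_set wb_large) => //=;
    rewrite s22' s26' (par_d1 (env_par es1)) (env_PW es1 gi) !addn1 HE'.
    by have := vl (c + b ^ grp_at); lia.
  set u := H (c + b ^ grp_at) j.+1.
  have ul : u + j.+1 <= d.+1 by exact: vl.
  apply: wp_if => //=.
    rewrite muln_eq0 negb_or !eqb0 !negbK => /andP[u0 vu].
    apply: wp_seq; apply: (wp_set wb_large) => //=; first by lia.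
    apply: (wp_set wb_large) => //=; rewrite (par_g (env_par es1)); first by lia.
    rewrite /option_inv /= !addn1; split=> //; last 1 first.
    - by move=> _; apply: leq_trans hs1 _; exact: leqW.
    by split=> [||_]; [lia | lia | constructor 2].
  move=> /eqP; rewrite muln_eq0 !eqb0 => nv; apply: wp_skip => //=.
  by split=> // _ _ u0; move: nv; rewrite u0 /= -ltnNge.
move=> /eqP; rewrite eqb0 => nrm; apply: wp_skip => //=.
by split=> // _; rewrite (negbTE nrm).
Qed.

Lemma fillers_ok s : env s -> zn s zH = zn st zH ->
  rg s 22 = c -> rg s 26 = j -> option_inv s ->
  wp g.+1 p_fillers (fun s' => option_inv s' /\ rg s 27 <= rg s' 27 /\
     forall i, i < g -> room c i -> H (c + b ^ i) j <= rg s' 27) s.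
Proof.
move=> es eH s22 s26 inv; rewrite /p_fillers.
have d_lt : d + d + 3 < ab by nia.
have hg := par_g (env_par es).
apply: (wp_for wb_large (W := 1) (I := fun m s' => option_inv s' /\
   rg s 27 <= rg s' 27 /\
   forall i, i < m -> room c i -> H (c + b ^ i) j <= rg s' 27));
  rewrite /= ?hg ?muln1 //; first by lia.
move=> i s' hi fr hx [[h27 h28 hch] [hle hold]].
have es' : env s' by exact: env_frame fr _ _ es.
have s22' : rg s' 22 = c by rewrite fr.1.
have s26' : rg s' 26 = j by rewrite fr.1.
have HE c' : zn s' zH (c' * d.+1 + j) = H c' j by rewrite fr.2 // eH.
have vl : H (c + b ^ i) j + j <= d.+1 by exact: value_le.
apply: wp_if => //=; rewrite s22' hx (digitE _ es' hi) (env_SZ es' hi) addn1 -/(room c i).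
  rewrite eqb0 negbK => rm.
  apply: wp_seq; apply: (wp_set wb_large) => //=;
    rewrite s22' s26' hx (par_d1 (env_par es')) (env_PW es' hi) addn1 HE; first by lia.
  apply: wp_if => //=; rewrite addn1.
    rewrite eqb0 negbK => lt.
    apply: wp_seq; apply: (wp_set wb_large) => //=; first by lia.
    apply: (wp_set wb_large) => //=; rewrite hx; first by lia.
    split; last split=> [|i']; [|by rewrite /=; lia|].
      split=> //= [|_]; [by lia | by constructor 3].
    rewrite /= ltnS leq_eqVlt => /orP[/eqP -> //|hi' rm'].
    by apply: leq_trans (hold _ hi' rm') _; exact: ltnW.
  move=> /eqP; rewrite eqb0 -leqNgt => le; apply: wp_skip => //=.
  split=> //; split=> // i'; rewrite /= ltnS leq_eqVlt => /orP[/eqP -> //|hi' rm'].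
  exact: hold.
move=> /eqP; rewrite eqb0 => nrm; apply: wp_skip => //=.
split=> //; split=> // i'; rewrite /= ltnS leq_eqVlt => /orP[/eqP -> |hi' rm'].
  by rewrite (negbTE nrm).
exact: hold.
Qed.

Definition cell_written s := exists v h,
  [/\ dp_cell grp k b fl ce r H c j v h, v + j <= d.+1,
      forall o, zn s zH o = (if o == c * d.+1 + j then v else zn st zH o) &
      forall o, zn s zCH o = (if o == c * d.+1 + j then h else zn st zCH o)].

Lemma p_cell_ok : rg st 22 = c -> rg st 26 = j -> rg st 24 = valid c ->
  wp g.+1 p_cell cell_written st.
Proof.
move=> s22 s26 s24; rewrite /p_cell.
have d_lt : d + d + 3 < ab by nia.
have c_lt : c * d.+1 + j < ab by nia.
apply: wp_seq; apply: (wp_set wb_large) => //=; first by lia.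
apply: wp_seq; apply: (wp_set wb_large) => //=; first by lia.
set s0 := setr _ 28 0.
have es0 : env s0 by do 2!apply: env_setr => //.
apply: (@wp_cut _ g.+1 _ _ (fun s => [/\ dp_cell grp k b fl ce r H c j (rg s 27) (rg s 28),
  rg s 27 + j <= d.+1 & rg s 28 <= g.+1])) => //.
  apply: wp_if => //=; rewrite s24; last first.
    move=> /eqP; rewrite eqb0 => nv; apply: wp_skip => //=.
    by split=> //; [split=> // v; rewrite v in nv | exact: leqW].
  rewrite eqb0 negbK => vc.
  apply: wp_if => //=; rewrite s22 (env_full he).
    rewrite eqb0 negbK => /eqP cF; apply: (wp_set wb_large) => //=; first by lia.
    by split=> //; split=> //; rewrite vc.
  move=> /eqP; rewrite eqb0 => /eqP ncF.
  have e22 : rg s0 22 = c by []. have e26 : rg s0 26 = j by [].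
  apply: (wp_cut _ (advance_ok (s := s0) es0 _ _ e22 e26 _ _)) => //.
  move=> s1 f1 [inv hsk hma].
  have es1 : env s1 by exact: env_frame f1 _ _ es0.
  have eH : zn s1 zH = zn st zH by rewrite f1.2.
  have f22 : rg s1 22 = c by rewrite f1.1.
  have f26 : rg s1 26 = j by rewrite f1.1.
  apply: (wp_cons _ (fillers_ok es1 eH f22 f26 inv)) => // s2 f2 [[h27 h28 hch] [hle hfi]].
  split=> //; split=> // [nv|_ _]; first by rewrite vc in nv.
  split=> //; split=> // [jd|jd rm H0].
    exact: leq_trans (hsk jd) hle.
  exact: leq_trans (hma jd rm H0) hle.
move=> s1 f1 [hcell hv hh].
have es1 : env s1 by exact: env_frame f1 _ _ es0.
have f22 : rg s1 22 = c by rewrite f1.1.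
have f26 : rg s1 26 = j by rewrite f1.1.
apply: wp_seq; apply: (wp_put wb_large) => //=;
  rewrite ?f22 ?f26 ?(par_d1 (env_par es1)) ?addn1 //; first by lia.
apply: (wp_put wb_large) => //=;
  rewrite ?f22 ?f26 ?(par_d1 (env_par es1)) ?addn1 //; first by lia.
exists (rg s1 27), (rg s1 28); split=> // o /=; by rewrite f1.2.
Qed.

End Cell.

(* A cell depends only on the cells that come after it, which are filled
   first; the others may hold values of a previous run. *)
Lemma dp_cell_eq (H H' : nat -> nat -> nat) c j v h :
  (forall c' j', j' <= d -> (c < c') || (c' == c) && (j < j') -> H c' j' = H' c' j') ->
  j <= d -> dp_cell grp k b fl ce r H c j v h -> dp_cell grp k b fl ce r H' c j v h.
Proof.
move=> e jd [h1 h2 h3]; split=> // vc nf; have [[a1 a2 a3] hch] := h3 vc nf.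
have lt i : c < c + b ^ i by rewrite -[ltnLHS]addn0 ltn_add2l expn_gt0 base_gt0.
have ej : j < d -> H c j.+1 = H' c j.+1.
  by move=> jd'; rewrite e // eqxx leqnn orbT.
have em i : j < d -> H (c + b ^ i) j.+1 = H' (c + b ^ i) j.+1.
  by move=> jd'; rewrite e // lt.
have ef i : H (c + b ^ i) j = H' (c + b ^ i) j by rewrite e // lt.
split.
  split=> [jd'|jd' rm|i hi rm].
  - by rewrite -ej // a1.
  - by rewrite -em //; apply: a2.
  - by rewrite -ef; apply: a3.
move=> v0; case: (hch v0) => [[hh jd' hv]|[hh jd' rm Hp hv]|[hh rm hv]].
- by constructor 1; rewrite -ej.
- by constructor 2; rewrite -em.
- by constructor 3; rewrite -ef.
Qed.

(** From position j at most d - j candidates can be matched, and values are shifted by one. The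
    bound is kept for all cells, stale ones included, so that any read fits in a word without
    locating the cell among those already written. *)
Definition value_bound st := forall c j, j <= d -> value st c j + j <= d.+1.

Lemma p_dp_ok st : env st -> loaded r zPI st -> value_bound st ->
  wp (NN.+1 * (d.+2 * g.+1)) p_dp (fun s => value_bound s /\
    dp_table grp k b fl ce r (value s) (choice_at s)) st.
Proof.
move=> he hr hv; rewrite /p_dp.
have d_lt : d + d + 3 < ab by nia.
have NN_lt : NN < ab by nia.
have hNN := env_NN he.
apply: (wp_for wb_large (W := d.+2 * g.+1)
  (I := fun i s => value_bound s /\ forall c, c < NN -> NN <= i + c ->
     forall j, j <= d ->
     dp_cell grp k b fl ce r (value s) c j (value s c j) (choice_at s c j)));
  rewrite /= ?hNN //; last 1 first.
- move=> s fr [vb hs]; split=> // c j hc hj; apply: hs => //; exact: leq_addr.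
- by split=> // c hc; rewrite leqNgt hc.
move=> i s hi fr hx [vb hs]; pose c := NN - 1 - i.
have c_lt : c < NN by rewrite /c; lia.
have es : env s by exact: env_frame fr _ _ he.
apply: wp_seq; apply: (wp_set wb_large) => //=; rewrite (env_NN es) hx -/c; first by lia.
set s0 := setr s 22 c.
have es0 : env s0 by exact: env_setr.
apply: (wp_cut _ (p_valid_ok (st := s0) (c := c) es0 _)) => // [|s1 f1 h24]; first by nia.
have es1 : env s1 by exact: env_frame f1 _ _ es0.
have hd1 := par_d1 (env_par es1).
have eH c' j' : value s1 c' j' = value s c' j' by rewrite /value f1.2.
have eC c' j' : choice_at s1 c' j' = choice_at s c' j' by rewrite /choice_at f1.2.
have hs1 c' j' : c < c' -> c' < NN -> j' <= d ->
    dp_cell grp k b fl ce r (value s1) c' j' (value s1 c' j') (choice_at s1 c' j').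
  move=> cc' c'N jd; rewrite eH eC; apply: (@dp_cell_eq (value s)) => //.
  by apply: hs => //; move: cc'; rewrite /c; lia.
apply: (wp_for wb_large (W := g.+1)
  (I := fun m s' => value_bound s' /\ forall c' j', c' < NN -> j' <= d ->
     (c < c') || (c' == c) && (d < m + j') ->
     dp_cell grp k b fl ce r (value s') c' j' (value s' c' j') (choice_at s' c' j')));
  rewrite /= ?hd1 ?addn1 //; first by lia.
- split=> [c' j' jd|c' j' c'N jd]; first by rewrite /value f1.2 //=; exact: vb.
  rewrite add0n (ltnNge d) jd andbF orbF => cc'; exact: hs1.
- move=> m s2 hm fr2 hx2 [vb2 hs2]; pose j := d - m.
  have es2 : env s2 by exact: env_frame fr2 _ _ es1.
  have jd : j <= d by rewrite leq_subr.
  apply: wp_seq; apply: (wp_set wb_large) => //=;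
    rewrite (par_d (env_par es2)) hx2 -/j; first by lia.
  set s3 := setr s2 26 j.
  have es3 : env s3 by exact: env_setr.
  have er3 : loaded r zPI s3 by move=> p; rewrite /= fr2.2 //= f1.2 //= fr.2.
  have t22 : rg s3 22 = c by rewrite /= fr2.1 //= f1.1.
  have t24 : rg s3 24 = valid c by rewrite /= fr2.1.
  apply: (wp_cons _ (p_cell_ok es3 er3 jd c_lt vb2 t22 _ t24)) => //.
  move=> s4 f4 [v [h [hcell hvj hH hC]]].
  have vE c' j' : j' <= d ->
      value s4 c' j' = if (c' == c) && (j' == j) then v else value s2 c' j'.
    by move=> jd'; rewrite /value hH cell_inj.
  have cE c' j' : j' <= d ->
      choice_at s4 c' j' = if (c' == c) && (j' == j) then h else choice_at s2 c' j'.
    by move=> jd'; rewrite /choice_at hC cell_inj.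
  split=> [c' j' jd'|c' j' c'N jd' hlt].
    by rewrite [value _ _ _]vE //; case: ifP => [/andP[_ /eqP ->] //|_]; exact: vb2.
  rewrite [X in dp_cell _ _ _ _ _ _ _ _ _ X]vE // [X in dp_cell _ _ _ _ _ _ _ _ _ _ X]cE //.
  have later : (c < c') || (c' == c) && (j <= j').
    case/orP: hlt => [-> //|/andP[-> h']]; apply/orP; right=> /=; rewrite /j; lia.
  apply: (@dp_cell_eq (value s2)) => //.
    move=> c2 j2 jd2 hlt2; rewrite [RHS]vE //; case: ifP => // /andP[/eqP e1 /eqP e2].
    by move: hlt2 later; rewrite e1 e2; case: (ltngtP c' c) => //= _; lia.
  case: ifP => [/andP[/eqP -> /eqP ->] //|ne]; apply: hs2 => //.
  case/orP: hlt => [-> //|/andP[ec h']]; rewrite ec /= in ne *; apply/orP; right.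
  by move: ne h'; rewrite /j; lia.
move=> s5 f5 [vb5 hs5]; split=> // c' c'N hc' j' jd; apply: hs5 => //.
have [->|ne] := eqVneq c' c; first by rewrite addnC (leq_trans _ (leq_addl _ _)) ?orbT //; lia.
by move: ne; rewrite /c; lia.
Qed.

End Table.

(** * Tracing the choices and placing the fillers *)

Definition p_reset : acmd := (AFor 15 rD (APut zUSED $15 0))%A.

(** Each round appends a candidate or advances in the given ranking, or does both, and each can
    happen at most d times; 2 * d rounds therefore reach the full code, after which the loop
    idles. *)
Definition p_follow : acmd := (
  22 ::= 0 ;; 26 ::= 0 ;; 33 ::= 0 ;;
  AFor 30 rD2
    (AIf ($22 == $rFull) ASkip
      (28 ::= zCH @[ $22 * $rD1 + $26 ] ;;
       AIf ($28 == $rG) (26 ::= $26 + 1)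
         (AIf ($28 == $rG + 1)
            (29 ::= zPI @[ $26 ] ;; APut zOUT $33 ($29 + 1) ;; APut zUSED $29 1 ;;
             22 ::= $22 + zPW @[ zG @[ $29 ] ] ;; 26 ::= $26 + 1 ;; 33 ::= $33 + 1)
            (APut zOUT $33 0 ;; APut zGL $33 $28 ;;
             22 ::= $22 + zPW @[ $28 ] ;; 33 ::= $33 + 1)))))%A.

(** Matched candidates are marked in [zUSED] beforehand, which reserves them. Linear search for each
    filler costs O(d ^ 2) in all, within the cost of the table. *)
Definition p_fill : acmd := (
  AFor 15 rD
    (AIf (zOUT @[ $15 ] == 0)
      (AFor 16 rD
         (AIf ((zUSED @[ $16 ] == 0) * (zG @[ $16 ] == zGL @[ $15 ])) (32 ::= $16) ASkip) ;;
       APut zUSED $32 1 ;; APut zCUR $15 $32)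
      (APut zCUR $15 (zOUT @[ $15 ] - 1))))%A.

Definition p_closest : acmd := (p_dp ;; p_reset ;; p_follow ;; p_fill)%A.

Section Closest.

Variables (fl ce : nat -> nat -> nat) (lim ab wb : nat).
Hypothesis wb_large : lim + nzones * ab.+1 <= wb.

Local Notation wp := (wp fl ce lim wb).

Variables (d g k : nat) (grp : 'I_d -> 'I_g) (rankings : seq 'S_d).
Local Notation n := (size rankings).
Local Notation env := (env k grp rankings).
Local Notation b := (base d g).
Local Notation NN := (b ^ g).
Local Notation gsize := (gsize grp).

Hypotheses (g_gt0 : 0 < g) (g_le : g <= d) (k_le : k <= d).
Hypothesis ab_n : (n + 2) * (d + 2) + 10 <= ab.
Hypothesis ab_NN : (NN + 2) * (d + 2) + 10 <= ab.
Hypothesis gsize_lt : forall i, gsize i < b.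

Variable r : 'S_d.

Local Notation label := (label d g).
Local Notation lcode l := (gcode b (map (lgroup grp) l)).

(** 0 in [zOUT] marks a filler, hence the shift by one for matched candidates. *)
Definition coded st q (x : label) : Prop :=
  match x with
  | inl a => zn st zOUT q = a.+1
  | inr i => zn st zOUT q = 0 /\ zn st zGL q = i
  end.

Definition written (l : seq label) st : Prop :=
  forall l1 x l2, l = l1 ++ x :: l2 -> coded st (size l1) x.

Definition used (A : seq 'I_d) st : Prop :=
  forall a : 'I_d, zn st zUSED a = (a \in A).

Lemma written_rcons l x st st' : written l st ->
  (forall q y, q < size l -> coded st q y -> coded st' q y) ->
  coded st' (size l) x -> written (rcons l x) st'.
Proof.
move=> hw hs hx l1 y l2; case/lastP: l2 => [|l2 z].
  by rewrite cats1 => /rcons_inj[<- <-].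
rewrite -rcons_cons -rcons_cat => /rcons_inj[e _]; apply: hs; last exact: (hw _ _ _ e).
by rewrite e size_cat /= addnS ltnS leq_addr.
Qed.

Lemma p_reset_ok st : env st -> wp d.+1 p_reset (used [::]) st.
Proof.
move=> he; rewrite /p_reset; have hd := par_d (env_par he).
have d_lt : d + d + 3 < ab by nia.
apply: (wp_for wb_large (W := 1) (I := fun m s => forall a : 'I_d, a < m -> zn s zUSED a = 0));
  rewrite /= ?hd ?muln1 //; first by lia.
  move=> m s hm fr hx hI; apply: (wp_put wb_large) => //=; rewrite ?hx; try lia.
  by move=> a; rewrite ltnS leq_eqVlt; case: eqP => //= _; exact: hI.
by move=> s fr hI a; rewrite hI ?ltn_ord.
Qed.

Definition plan_inv H (l : seq label) j st : Prop :=
  [/\ plan grp k b fl ce r H l j, rg st 22 = lcode l, rg st 26 = j,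
      rg st 33 = size l & written l st /\ used (matched l) st].

Lemma p_follow_ok st H : env st -> loaded r zPI st -> used [::] st ->
  dp_table grp k b fl ce r H (choice_at d st) -> 0 < H 0 0 ->
  wp (d + d).+1 p_follow (fun s => exists l j,
    [/\ plan grp k b fl ce r H l j, lcode l = full_code grp b, written l s &
        used (matched l) s]) st.
Proof.
move=> he hr hu hT H0; rewrite /p_follow.
have d_lt : d + d + 3 < ab by nia.
have NN_lt : NN < ab by nia.
apply: wp_seq; apply: (wp_set wb_large) => //=; first by lia.
apply: wp_seq; apply: (wp_set wb_large) => //=; first by lia.
apply: wp_seq; apply: (wp_set wb_large) => //=; first by lia.
set s0 := setr _ 33 0.
have es0 : env s0 by do 3!apply: env_setr => //.
have hd2 := par_d2 (env_par he).
apply: (wp_for wb_large (W := 1) (I := fun m s => exists l j,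
  plan_inv H l j s /\ (lcode l = full_code grp b \/ m <= size l + j)));
  rewrite /= ?hd2 ?muln1 //; first by lia.
- exists [::], 0; split; last by right.
  split=> //; first exact: (plan_nil gsize_lt hT H0).
    by rewrite /= /gcode big_nil.
  by split=> // -[].
- move=> m s hm fr hx [l [j [[pl h22 h26 h33 [hw hus]] hm']]].
  have es : env s by exact: env_frame fr _ _ es0.
  have hlt : lcode l < b ^ g := lcode_lt gsize_lt (plan_count pl).
  have hsz := plan_size pl.
  apply: wp_if => //=; rewrite h22 (env_full es).
    rewrite eqb0 negbK => /eqP hf; apply: wp_skip => //.
    by exists l, j; split; [split | left].
  move=> /eqP; rewrite eqb0 => nf.
  have hm2 : m <= size l + j by case: hm' => // e; rewrite e eqxx in nf.
  have sl : size l < d.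
    by rewrite ltn_neqAle hsz andbT; move: nf; rewrite (plan_full gsize_lt pl).
  have chE : zn s zCH (lcode l * d.+1 + j) = choice_at d st (lcode l) j by rewrite fr.2.
  have jd := plan_j pl.
  have step := plan_step gsize_lt hT pl nf.
  have ch_le : choice_at d st (lcode l) j <= g.+1.
    by case: step => [[-> _]|[hj [-> _]]|[hi _]]; lia.
  apply: wp_seq; apply: (wp_set wb_large) => //=;
    rewrite h22 h26 (par_d1 (env_par es)) addn1 chE; first by lia.
  set ch := choice_at _ _ _ _ in ch_le step *.
  apply: wp_if => //=; rewrite (par_g (env_par es)).
    rewrite eqb0 negbK => /eqP e; case: step => [[_ pl']|[hj [e' _]]|[hi _]]; try lia.
    apply: (wp_set wb_large) => //=; rewrite h26 ?addn1; first by lia.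
    exists l, j.+1; split; last by right; rewrite addnS ltnS.
    by split.
  move=> /eqP; rewrite eqb0 => /eqP ng.
  apply: wp_if => //=; rewrite (par_g (env_par es)) addn1.
    rewrite eqb0 negbK => /eqP e; case: step => [[e' _]|[hj [e' pl']]|[hi _]]; try lia.
    pose a := r (Ordinal hj).
    have PIE : zn s zPI j = a by rewrite fr.2 //= (hr (Ordinal hj)).
    have ga : zn s zPW (zn s zG a) = b ^ grp a by rewrite (env_G es) (env_PW es) ?ltn_ord.
    have a_lt := ltn_ord a.
    have lt2 := lcode_lt gsize_lt (plan_count pl').
    rewrite map_rcons gcode_rcons /= -/a in lt2.
    apply: wp_seq; apply: (wp_set wb_large) => //=; rewrite h26 PIE; first by lia.
    apply: wp_seq; apply: (wp_put wb_large) => //=; rewrite ?h33; try lia.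
    apply: wp_seq; apply: (wp_put wb_large) => //=; rewrite ?h33; try lia.
    apply: wp_seq; apply: (wp_set wb_large) => //=; rewrite h22 ga; first by lia.
    apply: wp_seq; apply: (wp_set wb_large) => //=; rewrite h26; first by lia.
    apply: (wp_set wb_large) => //=; rewrite h33; first by lia.
    exists (rcons l (inl a)), j.+1; split; last by right; rewrite size_rcons addSn addnS ltnS leqW.
    split=> //=; rewrite ?size_rcons ?addn1 ?map_rcons ?gcode_rcons //.
    split.
      apply: written_rcons hw _ _ => [q [c|c] hq|] /=; rewrite ?eqxx ?addn1 //.
        by rewrite ltn_eqF.
      by rewrite ltn_eqF.
    move=> c /=; rewrite matched_inl mem_rcons inE -val_eqE /=.
    by case: eqP => //= _; exact: hus.
  move=> /eqP; rewrite eqb0 => /eqP ng1.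
  case: step => [[e' _]|[hj [e' _]]|[hi pl']]; try lia.
  have lt2 := lcode_lt gsize_lt (plan_count pl').
  rewrite map_rcons gcode_rcons /= in lt2.
  apply: wp_seq; apply: (wp_put wb_large) => //=; rewrite ?h33; try lia.
  apply: wp_seq; apply: (wp_put wb_large) => //=; rewrite ?h33; try lia.
  apply: wp_seq; apply: (wp_set wb_large) => //=; rewrite h22 (env_PW es hi); first by lia.
  apply: (wp_set wb_large) => //=; rewrite h33; first by lia.
  exists (rcons l (inr (Ordinal hi))), j; split; last by right; rewrite size_rcons addSn ltnS.
  split=> //=; rewrite ?size_rcons ?addn1 ?map_rcons ?gcode_rcons ?matched_inr //.
  split=> //; apply: written_rcons hw _ _ => [q [c|c] hq|] /=; rewrite ?eqxx //.
    by rewrite ltn_eqF.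
  by rewrite ltn_eqF.
move=> s fr [l [j [[pl h22 h26 h33 [hw hus]] hm']]]; exists l, j; split=> //.
(* [size l + j] has reached 2 * d and both terms are at most d, so [size l] is d. *)
case: hm' => // e; apply/eqP; rewrite (plan_full gsize_lt pl).
by have := plan_size pl; have := plan_j pl; lia.
Qed.

Definition filled_inv l p st : Prop := exists l1 l2 cs,
  [/\ l = l1 ++ l2, size l1 = p, filled grp l1 l2 cs,
      (forall q, q < p -> zn st zCUR q = nth 0 (map (@nat_of_ord d) cs) q) &
      used (cs ++ matched l2) st].

Lemma size_filled l1 l2 cs : filled grp l1 l2 cs -> size cs = size l1.
Proof. by case=> e _ _; have := congr1 size e; rewrite !size_map. Qed.

Lemma p_fill_ok st l : env st -> written l st -> used (matched l) st ->
  uniq (matched l) -> size l = d ->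
  (forall i, count_mem i (map (lgroup grp) l) <= gsize i) ->
  wp (d.+1 * d.+2) p_fill (fun s => exists f : 'S_d,
    [/\ loaded f zCUR s, word grp f = map (lgroup grp) l &
        subseq (matched l) (ranking_seq f)]) st.
Proof.
move=> he hw hu un sl hc; rewrite /p_fill.
have d_lt : d + d + 3 < ab by nia.
have hd := par_d (env_par he).
apply: (wp_for wb_large (W := d.+2) (I := fun p s => filled_inv l p s));
  rewrite /= ?hd //; first by lia.
- by exists [::], l, [::]; split.
- move=> p s hp fr hx [l1 [l2 [cs [el sl1 hf hcur hus]]]].
  have es : env s by exact: env_frame fr _ _ he.
  case: l2 el hf hus => [|x l2] el hf hus.
    have : size l1 = d by rewrite -[RHS]sl el cats0.
    by rewrite sl1 => e; move: hp; rewrite [p]e ltnn.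
  have cod : coded s p x.
    have := hw _ _ _ el; rewrite sl1; case: (x) => [a|i] /=; by rewrite !fr.2.
  have scs : size cs = p by rewrite (size_filled hf).
  have nxt y s' : zn s' zCUR p = nat_of_ord y ->
      (forall q, q != p -> zn s' zCUR q = zn s zCUR q) ->
      forall q, q < p.+1 -> zn s' zCUR q = nth 0 (map (@nat_of_ord d) (rcons cs y)) q.
    move=> e1 e2 q; rewrite map_rcons nth_rcons size_map scs ltnS leq_eqVlt.
    case: eqP => [->|ne] /=; first by rewrite ltnn.
    by move=> hq; rewrite hq e2 ?hcur //; apply/eqP.
  case: x cod el hf hus => [a|i] /= cod el hf hus.
    apply: wp_if => //=; rewrite hx cod //= => _.
    have a_lt := ltn_ord a.
    apply: (wp_put wb_large) => //=; rewrite ?hx ?cod ?subn1; try lia.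
    exists (rcons l1 (inl a)), l2, (rcons cs a); split.
    - by rewrite cat_rcons.
    - by rewrite size_rcons sl1.
    - exact: filled_inl.
    - by apply: nxt => [|q nq] /=; rewrite ?eqxx // (negbTE nq).
    by move=> c /=; rewrite cat_rcons hus.
  case: cod => cod1 cod2.
  apply: wp_if => //=; rewrite hx cod1 //= => _.
  have [x0 x0n gx0] := filled_ex hf (eq_ind _
    (fun l => forall i, count_mem i (map (lgroup grp) l) <= gsize i) hc _ el).
  have hds := par_d (env_par es).
  apply: (@wp_cut _ _ _ _ _ d.+1 _ _ (fun s' => exists x : 'I_d,
     [/\ rg s' 32 = x, x \notin cs ++ matched l2 & grp x = i])); first by lia.
    (* The invariant is an implication, as register 32 is meaningless until the scan meets a free
       candidate; [x0] supplies the premise at the end. *)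
    apply: (wp_for wb_large (W := 1) (I := fun m s' =>
      (exists x : 'I_d, [/\ x < m, x \notin cs ++ matched l2 & grp x = i]) ->
      exists x : 'I_d, [/\ rg s' 32 = x, x \notin cs ++ matched l2 & grp x = i]));
      rewrite /= ?hds ?muln1 //; first by lia.
    - by move=> [x []].
    - move=> m s2 hm fr2 hx2 hI; pose c := Ordinal hm.
      have es2 : env s2 by exact: env_frame fr2 _ _ es.
      have u2 : zn s2 zUSED m = (c \in cs ++ matched l2) by rewrite fr2.2 //= (hus c).
      have g2 : zn s2 zG m = grp c by rewrite -(env_G es2 c).
      have t2 : zn s2 zGL p = i by rewrite fr2.2.
      have p2 : rg s2 15 = p by rewrite fr2.1.
      apply: wp_if => //=; rewrite hx2 p2 u2 g2 t2 eqb0 mulnb val_eqE.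
        rewrite eqb0 negbK => /andP[nc /eqP gc].
        apply: (wp_set wb_large) => //=; first by lia.
        by rewrite hx2 => _; exists c.
      move=> /eqP; rewrite eqb0 => nc; apply: wp_skip => //=.
      move=> [x []]; rewrite ltnS leq_eqVlt => /orP[/eqP ex|lt] xn gx; last first.
        by apply: hI; exists x.
      have exc : x = c by apply: val_inj.
      by move: nc; rewrite -exc xn gx eqxx.
    by move=> s2 fr2 hI; apply: hI; exists x0; rewrite ltn_ord.
  move=> s2 fr2 [x [h32 xn gx]].
  have x_lt := ltn_ord x.
  have p2 : rg s2 15 = p by rewrite fr2.1.
  apply: wp_seq; apply: (wp_put wb_large) => //=; rewrite ?h32; try lia.
  apply: (wp_put wb_large) => //=; rewrite ?h32 ?p2; try lia.
  exists (rcons l1 (inr i)), l2, (rcons cs x); split.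
  - by rewrite cat_rcons.
  - by rewrite size_rcons sl1.
  - exact: filled_inr.
  - by apply: nxt => [|q nq] /=; rewrite ?eqxx // (negbTE nq) fr2.2.
  move=> c /=; rewrite fr2.2 //= cat_rcons mem_cat inE -val_eqE /=.
  case: eqP => [_|_]; first by rewrite orbT.
  by rewrite hus mem_cat.
move=> s fr [l1 [l2 [cs [el sl1 hf hcur hus]]]].
have l2n : l2 = [::].
  apply: size0nil; have := congr1 size el; rewrite size_cat sl sl1 => /eqP.
  by rewrite -{1}[d]addn0 eqn_add2l => /eqP.
rewrite l2n cats0 in el hf; rewrite -el in hf.
have [f [f1 f2 f3]] := filled_perm hf sl.
exists f; split=> // p; rewrite hcur //= -f1 (nth_map p) ?size_ranking //.
by rewrite (nth_ranking _ _ (ltn_ord p)); congr (nat_of_ord (f _)); apply: val_inj.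
Qed.

Definition fair_perm (s : 'S_d) : Prop :=
  forall p, p <= d -> fair_word g k fl ce (take p (word grp s)).

Lemma p_closest_ok st : env st -> loaded r zPI st -> value_bound d st ->
  (exists s, fair_perm s) ->
  wp (NN.+1 * (d.+2 * g.+1) + d.+1 * d.+2) p_closest (fun s => value_bound d s /\
    exists f : 'S_d, [/\ loaded f zCUR s, fair_perm f &
      forall f', fair_perm f' -> ulam r f <= ulam r f']) st.
Proof.
move=> he hr hv [s0 fs0]; rewrite /p_closest.
apply: (wp_cut _ (p_dp_ok fl ce wb_large g_gt0 g_le k_le ab_n ab_NN he hr hv)).
  exact: leq_addr.
move=> s1 f1 [hv1 hT].
have e1 : env s1 by exact: env_frame f1 _ _ he.
apply: (wp_cut _ (p_reset_ok e1)); first by nia.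
move=> s2 f2 hu2.
have e2 : env s2 by exact: env_frame f2 _ _ e1.
have r2 : loaded r zPI s2 by move=> p; rewrite f2.2 // f1.2.
have hT2 : dp_table grp k b fl ce r (value d s1) (choice_at d s2).
  by move: hT; rewrite /dp_table /choice_at f2.2.
(* The empty common subsequence with a fair ranking already makes the initial cell positive. *)
have H0 : 0 < value d s1 0 0.
  have := dp_complete gsize_lt hT fs0 (leqnn _) (leq0n d) (leq0n d) (sub0seq _) (sub0seq _).
  by rewrite take0 /gcode big_nil.
apply: (wp_cut _ (p_follow_ok e2 r2 hu2 hT2 H0)); first by nia.
move=> s3 f3 [l [j [pl hf hw hu]]].
have e3 : env s3 by exact: env_frame f3 _ _ e2.
have un : uniq (matched l).
  apply: subseq_uniq (plan_sub pl) _; apply: take_uniq; exact: ranking_uniq.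
have sl : size l = d by apply/eqP; rewrite -(plan_full gsize_lt pl) hf.
apply: (wp_cons _ (p_fill_ok e3 hw hu un sl (plan_count pl))); first exact: leq_addl.
move=> s4 f4 [f [hl hwf hsub]]; split.
  by move=> c j' jd; rewrite /value f4.2 // f3.2 // f2.2 //; exact: hv1.
have [ff fc] := plan_closest gsize_lt hT pl hf hwf hsub.
by exists f.
Qed.

End Closest.

(** * Cost of a ranking *)

Definition p_inverse : acmd := (AFor 15 rD (APut zINV (zCUR @[ $15 ]) $15))%A.

(** Binary lifting: the step halves from [rS] down to 1, so the number [rL] of rounds depends on d
    only and the search is a counted loop. *)
Definition p_search : acmd := (
  35 ::= 0 ;; 36 ::= $rS ;;
  AFor 16 rL
    (AIf ($35 + $36 <= $34)
       (AIf (zT @[ $35 + $36 - 1 ] + 1 <= $29) (35 ::= $35 + $36) ASkip) ASkip ;;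
     36 ::= $36 / 2))%A.

Definition p_lcs : acmd := (
  34 ::= 0 ;;
  AFor 17 rD
    (AIn 14 (4 + $rD + $15 * $rD + $17) ;;
     29 ::= zINV @[ $14 ] ;;
     p_search ;;
     APut zT $35 $29 ;;
     34 ::= $34 + ($35 == $34)))%A.

Definition p_cost : acmd := (
  p_inverse ;;
  37 ::= 0 ;;
  AFor 15 rN (p_lcs ;; 37 ::= $37 + ($rD - $34)))%A.

Section Evaluation.

Variables (fl ce : nat -> nat -> nat) (lim ab wb : nat).
Hypothesis wb_large : lim + nzones * ab.+1 <= wb.

Local Notation wp := (wp fl ce lim wb).

Variables (d g k : nat) (grp : 'I_d -> 'I_g) (rankings : seq 'S_d).
Local Notation n := (size rankings).
Local Notation env := (env k grp rankings).
Local Notation rk r := (nth 1%g rankings r).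
Local Notation tl := (trunc_log 2 d).

Hypothesis d_gt0 : 0 < d.
Hypothesis limE : lim = 4 + d + n * d.
Hypothesis ab_n : (n + 2) * (d + 2) + 10 <= ab.
Hypothesis uniq_rk : uniq rankings.

Variable f : 'S_d.

Definition inverted st : Prop := forall a : 'I_d, zn st zINV a = pos f a.

Lemma p_inverse_ok st : env st -> loaded f zCUR st -> wp d.+1 p_inverse inverted st.
Proof.
move=> he hf; rewrite /p_inverse; have hd := par_d (env_par he).
have d_lt : d + d + 3 < ab by nia.
apply: (wp_for wb_large (W := 1) (I := fun m s =>
  forall a : 'I_d, pos f a < m -> zn s zINV a = pos f a));
  rewrite /= ?hd ?muln1 //; first by lia.
  move=> m s hm fr hx hI; pose p := Ordinal hm.
  have cur : zn s zCUR m = f p by rewrite fr.2 // (hf p).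
  have f_lt := ltn_ord (f p).
  apply: (wp_put wb_large) => //=; rewrite hx ?cur; try lia.
  move=> a; case: eqP => [e|ne] ha.
    have -> : a = f p by apply: val_inj.
    by rewrite pos_perm.
  apply: hI; move: ha; rewrite ltnS leq_eqVlt => /orP[/eqP e|//].
  by case: ne; have -> // : a = f p; apply: (@pos_inj _ f); rewrite pos_perm.
by move=> s fr hI a; rewrite hI // /pos ltn_ord.
Qed.

Lemma p_search_ok st len x : env st -> rg st 34 = len -> rg st 29 = x ->
  len <= d -> (forall l l', l < l' -> l' < len -> zn st zT l < zn st zT l') ->
  wp tl.+2 p_search (fun s => [/\ rg s 35 <= len,
    forall l, l < rg s 35 -> zn st zT l < x &
    forall l, rg s 35 <= l < len -> x <= zn st zT l]) st.
Proof.
move=> he h34 h29 hlen mono; rewrite /p_search.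
have d_lt : d + d + 3 < ab by nia.
have S_le : rg st rS <= d.
  rewrite (env_S he); have hL := env_L he; have hL0 := env_L0 he.
  apply: leq_trans (trunc_logP (isT : 1 < 2) d_gt0); rewrite leq_exp2l //; lia.
apply: wp_seq; apply: (wp_set wb_large) => //=; first by lia.
apply: wp_seq; apply: (wp_set wb_large) => //=; first by lia.
set s0 := setr _ 36 _.
have es0 : env s0 by do 2!apply: env_setr => //.
have hL : rg st rL < ab.
  have := env_L he; have := trunc_logP (isT : 1 < 2) d_gt0.
  by have := ltn_expl tl (isT : 1 < 2); lia.
(* The insertion point lies among the 2 ^ (rL - m) positions that start at register 35: no
   constraint at first, as 2 ^ rL > d, and a single position at the end. *)
apply: (wp_for wb_large (W := 1) (I := fun m s =>
  [/\ rg s 36 = 2 ^ (rg st rL - m) %/ 2, rg s 35 <= len,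
      forall l, l < rg s 35 -> zn st zT l < x &
      forall l, l < len -> rg s 35 + 2 ^ (rg st rL - m) <= l.+1 -> x <= zn st zT l]));
  rewrite /= ?muln1 //.
- by rewrite ltnS (env_L he).
- split=> // [|l hl].
    by rewrite subn0 -(prednK (env_L0 he)) expnS mulKn //= (env_S he).
  rewrite subn0 add0n -(prednK (env_L0 he)) expnS -(env_S he).
  have := env_S2 he; lia.
- move=> m s hm fr hx [h36 h35 hlo hhi].
  have es : env s by exact: env_frame fr _ _ es0.
  have t34 : rg s 34 = len by rewrite fr.1.
  have t29 : rg s 29 = x by rewrite fr.1.
  have eT l : zn s zT l = zn st zT l by rewrite fr.2.
  have eL : rg st rL - m = (rg st rL - m.+1).+1 by lia.
  move: h36 hhi; rewrite eL expnS mulKn // => h36 hhi.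
  set h := 2 ^ (rg st rL - m.+1) in h36 hhi *.
  have h0 : 0 < h by rewrite expn_gt0.
  apply: (@wp_cut _ _ _ _ _ 1 _ _ (fun s' => [/\ rg s' 36 = h, rg s' 35 <= len,
      forall l, l < rg s' 35 -> zn st zT l < x &
      forall l, l < len -> rg s' 35 + h <= l.+1 -> x <= zn st zT l])) => //.
    apply: wp_if => //=; rewrite t34 h36; last first.
      move=> /eqP; rewrite eqb0 -ltnNge => hp; apply: wp_skip => //.
      by split=> // l hl; lia.
    rewrite eqb0 negbK => hp.
    apply: wp_if => //=; rewrite t29 h36 eT addn1.
      rewrite eqb0 negbK => lt; apply: (wp_set wb_large) => //=; rewrite h36; first by lia.
      split=> // [l hl|l hl hle]; last by apply: hhi => //; lia.
      have [->|ne] := eqVneq l (rg s 35 + h - 1); first exact: lt.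
      apply: ltn_trans lt; apply: mono; lia.
    move=> /eqP; rewrite eqb0 -leqNgt => ge; apply: wp_skip => //.
    split=> // l hl hle; apply: leq_trans ge _.
    have [->//|ne] := eqVneq l (rg s 35 + h - 1).
    apply/ltnW/mono => //; lia.
  move=> s1 f1 [i36 i35 ilo ihi].
  apply: (wp_set wb_large) => //=; rewrite i36 //.
  apply: leq_ltn_trans (leq_div _ _) _; apply: leq_ltn_trans (_ : rg st rS < _); last by lia.
  rewrite (env_S he) /h leq_exp2l //; lia.
move=> s fr [h36 h35 hlo hhi]; rewrite subnn in hhi; split=> // l /andP[hl1 hl2].
by apply: hhi => //; rewrite addn1.
Qed.

Lemma p_lcs_ok st m : env st -> inverted st -> m < n -> rg st 15 = m ->
  wp (d.+1 * tl.+2) p_lcs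
    (fun s => rg s 34 = lcs_length (ranking_seq (rk m)) (ranking_seq f)) st.
Proof.
move=> he hi hm h15; rewrite /p_lcs.
have d_lt : d + d + 3 < ab by nia.
apply: wp_seq; apply: (wp_set wb_large) => //=; first by lia.
have es0 : env (setr st 34 0) by apply: env_setr.
have hd := par_d (env_par he).
apply: (wp_for wb_large (W := tl.+2) (I := fun q s => rg s 34 <= q /\
  tails [seq pos f a | a <- take q (ranking_seq (rk m))] (zn s zT) (rg s 34)));
  rewrite /= ?hd //; first by lia.
- by rewrite take0; split=> //; exact: tails_nil.
- move=> q s hq fr hx [hlen ht]; pose p := Ordinal hq.
  have es : env s by exact: env_frame fr _ _ es0.
  have s15 : rg s 15 = m by rewrite fr.1.
  have [_ /(_ m p hm) low] := par_low (env_par es).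
  have a_lt := ltn_ord (rk m p).
  have inv_a : zn s zINV (rk m p) = pos f (rk m p) by rewrite fr.2 // hi.
  have pos_lt : pos f (rk m p) < d by rewrite /pos ltn_ord.
  have cell : m * d + d <= n * d by rewrite -mulSnr leq_mul2r hm orbT.
  apply: wp_seq; apply: (wp_in wb_large) => //=; rewrite ?(par_d (env_par es)) ?s15 ?hx ?low //.
  - by rewrite limE; lia.
  - by apply: leq_trans a_lt _; lia.
  apply: wp_seq; apply: (wp_set wb_large) => //=; rewrite inv_a; first by lia.
  set x := pos f _ in pos_lt *; set s1 := setr _ 29 x.
  have es1 : env s1 by do 2!apply: env_setr => //.
  have mono l l' : l < l' -> l' < rg s 34 -> zn s zT l < zn s zT l' := tails_mono ht.
  apply: (wp_cut _ (p_search_ok (len := rg s 34) (x := x) es1 _ _ _ mono)) => //.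
    by lia.
  move=> s2 f2 [h35 hlo hhi].
  have t29 : rg s2 29 = x by rewrite f2.1.
  have t34 : rg s2 34 = rg s 34 by rewrite f2.1.
  apply: wp_seq; apply: (wp_put wb_large) => //=; rewrite ?t29; try lia.
  apply: (wp_set wb_large) => //=; rewrite t34.
    by case: (_ == _); lia.
  have -> : rg s 34 + (rg s2 35 == rg s 34) =
      if rg s2 35 == rg s 34 then (rg s 34).+1 else rg s 34.
    by case: (_ == _); rewrite ?addn1 ?addn0.
  split; first by case: (_ == _); lia.
  rewrite (take_rankingS _ hq) map_rcons f2.2 //.
  exact: tails_rcons.
move=> s fr [_ ht]; apply/esym; apply: tails_lcs (zn s zT) _ _.
by rewrite take_oversize ?size_ranking in ht.
Qed.

Local Notation S := [set s in rankings].

Lemma median_costE : median_cost S f = \sum_(s <- rankings) ulam s f.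
Proof. by rewrite /median_cost big_uniq //; apply: eq_bigl => s; rewrite inE. Qed.

Lemma median_cost_le : median_cost S f <= n * d.
Proof.
rewrite median_costE; elim: (rankings) => [|s l IH]; first by rewrite big_nil.
by rewrite big_cons /= mulSn leq_add // ulam_le.
Qed.

Lemma p_cost_ok st : env st -> loaded f zCUR st ->
  wp (n.+1 * (d.+1 * tl.+2)) p_cost (fun s => rg s 37 = median_cost S f) st.
Proof.
move=> he hf; rewrite /p_cost.
have d_lt : n * d + d + d + n + 3 < ab by nia.
apply: (wp_cut _ (p_inverse_ok he hf)); first by nia.
move=> s1 f1 hi.
have es1 : env s1 by exact: env_frame f1 _ _ he.
apply: wp_seq; apply: (wp_set wb_large) => //=; first by lia.
have es2 : env (setr s1 37 0) by apply: env_setr.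
have hn := par_n (env_par es1).
apply: (wp_for wb_large (W := d.+1 * tl.+2)
  (I := fun m s => rg s 37 = \sum_(s <- take m rankings) ulam s f));
  rewrite /= ?hn //; first by lia.
- by rewrite take0 big_nil.
- move=> m s hm fr hx h37.
  have es : env s by exact: env_frame fr _ _ es2.
  have hi' : inverted s by move=> a; rewrite fr.2 //; exact: hi.
  apply: (wp_cut _ (p_lcs_ok es hi' hm hx)) => // s3 f3 h34.
  have es3 : env s3 by exact: env_frame f3 _ _ es.
  have t37 : rg s3 37 = rg s 37 by rewrite f3.1.
  have e : rg s3 37 + (d - rg s3 34) = \sum_(s <- take m.+1 rankings) ulam s f.
    by rewrite t37 h37 h34 (take_nth 1%g) // -cats1 big_cat big_seq1.
  apply: (wp_set wb_large) => //=; rewrite (par_d (env_par es3)) e //.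
  apply: (@leq_ltn_trans (n * d)); last by lia.
  apply: leq_trans median_cost_le; rewrite median_costE.
  by rewrite -[X in _ <= \sum_(s <- X) _](cat_take_drop m.+1 rankings) big_cat leq_addr.
by move=> s fr ->; rewrite take_size median_costE.
Qed.

End Evaluation.

(** * The loop over the given rankings and the majority ranking *)

Definition p_copy : acmd := (
  AFor 15 rD
    (AIf ($12 + 1 <= $rN) (AIn 14 (4 + $rD + $12 * $rD + $15)) (14 ::= zTAU @[ $15 ]) ;;
     APut zPI $15 $14))%A.

Definition p_select : acmd := (
  AIf ($37 + 1 <= $13)
    (13 ::= $37 ;; AFor 15 rD (APut zBEST $15 (zCUR @[ $15 ]))) ASkip)%A.

(** [n * d + 1] exceeds every cost, so the first round always selects its ranking; the round of
    index n, one past the given rankings, treats [tau]. *)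
Definition p_loop : acmd := (
  13 ::= $rN * $rD + 1 ;;
  AFor 12 rN1 (p_copy ;; p_closest ;; p_cost ;; p_select))%A.

Definition p_output : acmd := (
  AFor 15 rD (14 ::= zBEST @[ $15 ] ;; AOut $15 $14))%A.

Definition p_median : acmd := (p_init ;; p_relative ;; p_loop ;; p_output)%A.

Section Main.

Variables (fl ce : nat -> nat -> nat) (lim ab wb : nat).
Hypothesis wb_large : lim + nzones * ab.+1 <= wb.

Local Notation wp := (wp fl ce lim wb).

Variables (d g k : nat) (grp : 'I_d -> 'I_g) (rankings : seq 'S_d).
Local Notation n := (size rankings).
Local Notation env := (env k grp rankings).
Local Notation b := (base d g).
Local Notation NN := (b ^ g).
Local Notation tl := (trunc_log 2 d).
Local Notation S := [set s in rankings].
Local Notation fair_perm := (fair_perm fl ce k grp).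

Hypotheses (g_gt0 : 0 < g) (g_le : g <= d) (k_gt0 : 0 < k) (k_le : k <= d).
Hypothesis limE : lim = 4 + d + n * d.
Hypothesis ab_n : (n + 2) * (d + 2) + 10 <= ab.
Hypothesis ab_NN : (NN + 2) * (d + 2) + 10 <= ab.
Hypothesis gsize_lt : forall i, gsize grp i < b.
Hypothesis uniq_rk : uniq rankings.
Hypothesis n_gt0 : 0 < n.
Hypothesis fair_ex : exists s, fair_perm s.

Section Loop.

Variable tau : 'S_d.

Local Notation rk m := (if m < n then nth 1%g rankings m else tau).

Lemma p_copy_ok st m : env st -> loaded tau zTAU st -> m <= n -> rg st 12 = m ->
  wp d.+1 p_copy (loaded (rk m) zPI) st.
Proof.
move=> he ht hm h12; rewrite /p_copy; have hd := par_d (env_par he).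
have d_lt : n + d + d + 3 < ab by nia.
apply: (wp_for wb_large (W := 1) (I := fun q s =>
  forall p : 'I_d, p < q -> zn s zPI p = rk m p)); rewrite /= ?hd ?muln1 //; first by lia.
  move=> q s hq fr hx hI; pose p := Ordinal hq.
  have es : env s by exact: env_frame fr _ _ he.
  have s12 : rg s 12 = m by rewrite fr.1.
  have r_lt := ltn_ord (rk m p).
  apply: (@wp_cut _ _ _ _ _ 1 _ _ (fun s' => rg s' 14 = rk m p)) => //.
    apply: wp_if => //=; rewrite s12 (par_n (env_par es)) addn1.
      rewrite eqb0 negbK => hmn; rewrite hmn in r_lt *.
      have [_ /(_ m p hmn) low] := par_low (env_par es).
      have cell : m * d + d <= n * d by rewrite -mulSnr leq_mul2r hmn orbT.
      apply: (wp_in wb_large) => //=; rewrite ?(par_d (env_par es)) ?s12 ?hx ?low //.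
        by rewrite limE; lia.
      by apply: leq_trans r_lt _; lia.
    move=> /eqP; rewrite eqb0 => /negbTE nmn; rewrite nmn in r_lt *.
    have te : zn s zTAU q = tau p by rewrite fr.2 // (ht p).
    by apply: (wp_set wb_large) => //=; rewrite hx te //; apply: leq_trans r_lt _; lia.
  move=> s1 f1 h14.
  have hx1 : rg s1 15 = q by rewrite f1.1.
  apply: (wp_put wb_large) => //=; rewrite ?hx1 ?h14; [by lia | by apply: leq_trans r_lt _; lia |].
  move=> p'; rewrite ltnS leq_eqVlt; case: eqP => [e _|_ /= hp'].
    by congr (nat_of_ord (fun_of_perm _ _)); apply: val_inj.
  by rewrite f1.2 // hI.
by move=> s fr hI p; rewrite hI ?ltn_ord.
Qed.

Definition best_inv m st : Prop :=
  [/\ forall i, i < m -> exists f, [/\ fair_perm f,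
        forall f', fair_perm f' -> ulam (rk i) f <= ulam (rk i) f' &
        rg st 13 <= median_cost S f],
      m = 0 -> rg st 13 = n * d + 1 &
      0 < m -> exists f, [/\ loaded f zBEST st, fair_perm f & median_cost S f = rg st 13]].

Definition loop_work : nat :=
  NN.+1 * (d.+2 * g.+1) + d.+1 * d.+2 + n.+1 * (d.+1 * tl.+2) + d.+1.

Lemma p_loop_ok st : env st -> loaded tau zTAU st -> value_bound d st ->
  wp (n.+2 * loop_work) p_loop (best_inv n.+1) st.
Proof.
move=> he ht hv; rewrite /p_loop.
have d_lt : n * d + n + d + d + 3 < ab by nia.
have d_gt0 : 0 < d by exact: leq_trans g_gt0 g_le.
apply: wp_seq; apply: (wp_set wb_large) => //=; rewrite ?(par_n (env_par he)) ?(par_d (env_par he)).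
  by lia.
set s0 := setr _ _ _.
have es0 : env s0 by apply: env_setr.
apply: (wp_for wb_large (W := loop_work) (I := fun m s => value_bound d s /\ best_inv m s));
  rewrite /= ?(par_n1 (env_par he)) ?addn1 //; first by lia.
- move=> m s hm fr hx [hvb [b1 b2 b3]].
  have es : env s by exact: env_frame fr _ _ es0.
  have ts : loaded tau zTAU s by move=> p; rewrite fr.2 //= ht.
  apply: (wp_cut _ (p_copy_ok es ts hm hx)); first by rewrite /loop_work; lia.
  move=> s1 f1 hpi.
  have es1 : env s1 by exact: env_frame f1 _ _ es.
  have hv1 : value_bound d s1 by move=> c j hj; rewrite /value f1.2 //; exact: hvb.
  apply: (wp_cut _ (p_closest_ok wb_large g_gt0 g_le k_le ab_n ab_NN gsize_lt es1 hpi hv1 fair_ex)).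
    by rewrite /loop_work; lia.
  move=> s2 f2 [hv2 [f [hf ff fclosest]]].
  have es2 : env s2 by exact: env_frame f2 _ _ es1.
  apply: (wp_cut _ (p_cost_ok fl ce wb_large d_gt0 limE ab_n uniq_rk es2 hf)).
    by rewrite /loop_work; lia.
  move=> s3 f3 h37; rewrite /p_select.
  have es3 : env s3 by exact: env_frame f3 _ _ es2.
  have t13 : rg s3 13 = rg s 13 by rewrite f3.1 // f2.1 // f1.1.
  have hf3 : loaded f zCUR s3 by move=> p; rewrite f3.2.
  have hv3 : value_bound d s3 by move=> c j hj; rewrite /value f3.2 //; exact: hv2.
  have cost_le := median_cost_le uniq_rk f.
  have fm : exists f, [/\ fair_perm f,
      forall f', fair_perm f' -> ulam (rk m) f <= ulam (rk m) f' &
      median_cost S f = rg s3 37] by exists f.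
  apply: wp_if => //=.
    rewrite eqb0 negbK addn1 t13 h37 => lt.
    apply: wp_seq; apply: (wp_set wb_large) => //=; first by lia.
    set s4 := setr _ _ _.
    have es4 : env s4 by apply: env_setr.
    apply: (wp_for wb_large (W := 1) (I := fun q s' =>
      forall p : 'I_d, p < q -> zn s' zBEST p = f p)); rewrite /= ?(par_d (env_par es3)) ?muln1 //.
    - by lia.
    - by rewrite /loop_work; lia.
    - move=> q s5 hq f5 hx5 hI; pose p := Ordinal hq.
      have cur : zn s5 zCUR q = f p by rewrite f5.2 //= (hf3 p).
      have f_lt := ltn_ord (f p).
      apply: (wp_put wb_large) => //=; rewrite hx5 ?cur; try lia.
      move=> p'; rewrite ltnS leq_eqVlt; case: eqP => [e _|_ /= hp']; last exact: hI.
      by congr (nat_of_ord (f _)); apply: val_inj.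
    move=> s5 f5 hI; split.
      by move=> c j hj; rewrite /value /= f5.2 //; exact: hv3.
    have e13 : rg s5 13 = median_cost S f by rewrite f5.1 //= h37.
    split=> //= [i|_]; rewrite e13; last first.
      by exists f; split=> // p; rewrite hI ?ltn_ord.
    rewrite ltnS leq_eqVlt => /orP[/eqP ->|/b1[fi [x1 x2 x3]]]; first by exists f.
    by exists fi; split=> //; apply: leq_trans x3; apply: ltnW.
  rewrite addn1 t13 h37 => /eqP; rewrite eqb0 -leqNgt => ge.
  apply: wp_skip => //=.
  split; first by move=> c j hj; exact: hv3.
  have m_gt0 : 0 < m.
    by case: (m) b2 => // /(_ erefl) e; move: ge; rewrite e; lia.
  split=> //= [i|_]; rewrite t13; last first.
    have [fb [y1 y2 y3]] := b3 m_gt0; exists fb; split=> // p.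
    by rewrite /= f3.2 // f2.2 // f1.2.
  rewrite ltnS leq_eqVlt => /orP[/eqP ->|/b1 //].
  by exists f.
by move=> s fr [].
Qed.

End Loop.

Lemma p_output_ok st (f : 'S_d) : rg st rD = d -> loaded f zBEST st ->
  wp d.+1 p_output (fun s => forall p : 'I_d, zn s 0 p = f p) st.
Proof.
move=> hd hf; rewrite /p_output.
have d_lt : n * d + n + d + d + 3 < ab by nia.
apply: (wp_for wb_large (W := 1) (I := fun q s' =>
  forall p : 'I_d, p < q -> zn s' 0 p = f p)); rewrite /= ?hd ?muln1 //; first by lia.
  move=> q s hq fr hx hI; pose p := Ordinal hq.
  have fe : zn s zBEST q = f p by rewrite fr.2 // (hf p).
  have f_lt := ltn_ord (f p).
  apply: wp_seq; apply: (wp_set wb_large) => //=; rewrite hx fe; first by lia.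
  apply: (wp_out wb_large) => //=; rewrite ?hx; [by rewrite limE; lia | by lia |].
  move=> p'; rewrite ltnS leq_eqVlt; case: eqP => [e _|_ /= hp']; last exact: hI.
  by congr (nat_of_ord (f _)); apply: val_inj.
by move=> s fr hI p; rewrite hI ?ltn_ord.
Qed.

Definition total_work : nat :=
  d.+1 * (d.+1 * n.+1) + n.+2 * loop_work.

Lemma p_median_ok st : initial k grp rankings st ->
  wp total_work p_median (fun s => exists (f tau : 'S_d) (del : {set 'I_d}),
    [/\ forall p : 'I_d, zn s 0 p = f p, fair_perm f,
        greedy rankings del /\
        {in ~: del &, forall a b, ~~ contested S a b},
        forall a, pos tau a = order_rank (before S del) a &
        (forall s, s \in rankings -> exists h, [/\ fair_perm h,
          forall h', fair_perm h' -> ulam s h <= ulam s h' &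
          median_cost S f <= median_cost S h]) /\
        exists h, [/\ fair_perm h,
          forall h', fair_perm h' -> ulam tau h <= ulam tau h' &
          median_cost S f <= median_cost S h]]) st.
Proof.
move=> hi; rewrite /p_median.
have zones0 z : 0 < z -> forall o, zn st z o = 0 by move=> hz o; exact: init_zones hi _ _ hz.
apply: (wp_cut _ (p_init_ok fl ce wb_large g_gt0 g_le k_gt0 k_le limE ab_n ab_NN hi)).
  by rewrite /total_work; nia.
move=> s1 f1 es1.
have z1 o : zn s1 zDEL o = 0 by rewrite f1.2 // zones0.
apply: (wp_cut _ (p_relative_ok fl ce wb_large limE ab_n uniq_rk n_gt0 es1 z1)).
  exact: leq_addr.
move=> s2 f2 [del [hgr hun [tau [htau ht]]]].
have es2 : env s2 by exact: env_frame f2 _ _ es1.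
have hv : value_bound d s2.
  by move=> c j hj; rewrite /value f2.2 // f1.2 // zones0 // leqW.
apply: (wp_cut _ (p_loop_ok es2 ht hv)); first exact: leq_addl.
move=> s3 f3 [b1 _ /(_ isT)[f [lf ff cf]]].
have es3 : env s3 by exact: env_frame f3 _ _ es2.
apply: (wp_cons _ (p_output_ok (par_d (env_par es3)) lf)).
  by rewrite /total_work; nia.
move=> s4 f4 ho; exists f, tau, del; split=> //; rewrite cf; split.
  move=> s sr; have := b1 (index s rankings).
  by rewrite index_mem sr nth_index // leqW ?index_mem //; exact.
by have := b1 n; rewrite ltnn; apply.
Qed.

End Main.

(** * Memory layout of the input *)

Section Encoding.

Variables (d g k : nat) (grp : 'I_d -> 'I_g) (rankings : seq 'S_d).
Local Notation n := (size rankings).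

Lemma size_flatten_const (T : Type) m (ss : seq (seq T)) :
  all (fun s => size s == m) ss -> size (flatten ss) = size ss * m.
Proof. by elim: ss => //= s ss IH /andP[/eqP sm /IH e]; rewrite size_cat sm e mulSn. Qed.

Lemma nth_flatten_const (T : Type) (x : T) m (ss : seq (seq T)) r p :
  all (fun s => size s == m) ss -> r < size ss -> p < m ->
  nth x (flatten ss) (r * m + p) = nth x (nth [::] ss r) p.
Proof.
elim: ss r => //= s ss IH [|r] /andP[/eqP sm al] hr hp; rewrite nth_cat sm.
  by rewrite mul0n add0n hp.
rewrite mulSn -addnA ltnNge leq_addr /= addKn; exact: IH.
Qed.

Local Notation input := (encode_input grp k rankings).
Local Notation rows := [seq [seq nat_of_ord c | c <- ranking_seq s] | s <- rankings].

Lemma rows_size : all (fun s => size s == d) rows.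
Proof. by apply/allP => u /mapP[s _ ->]; rewrite size_map size_ranking. Qed.

Lemma size_input : size input = 4 + d + n * d.
Proof.
rewrite /encode_input !size_cat size_map size_enum_ord.
by rewrite (size_flatten_const rows_size) size_map addnA.
Qed.

Definition start : astate :=
  AState (fun=> 0) (fun z o => if z == 0 then nth 0 input o else 0).

Lemma start_initial : initial k grp rankings start.
Proof.
split=> //=; last by move=> z o; rewrite lt0n => /negbTE ->.
split=> [a|r p hr]; rewrite /= add0n.
  rewrite nth_cat size_map size_enum_ord ltn_ord (nth_map a) ?size_enum_ord //.
  by rewrite nth_ord_enum.
rewrite nth_cat size_map size_enum_ord -addnA ltnNge leq_addr /= addKn.
rewrite (nth_flatten_const _ rows_size) ?size_map ?ltn_ord //.
by rewrite (nth_map 1%g) // (nth_map p) ?size_ranking // (nth_ranking _ _ (ltn_ord p));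
  congr (nat_of_ord (fun_of_perm _ _)); apply: val_inj.
Qed.

Lemma start_sim : sim (4 + d + n * d) start
  (State (update (fun=> 0) 0 (4 + d + n * d)) (nth 0 input)).
Proof.
split=> // z o /andP[z0 _].
have -> : zn start z o = 0 by rewrite /= (gtn_eqF z0).
by apply: nth_default; rewrite size_input leq_addr.
Qed.

End Encoding.

(* Register 0 is set to the size of the input, where the zones start. *)
Definition median_prog : cmd :=
  Seq (Assign 0 (Bin Add (Const 4) (Bin Add (Read (Const 1))
                   (Bin Mul (Read (Const 0)) (Read (Const 1))))))
      (comp p_median).

(** A choice of one member per group is injective. *)
Lemma groups_le d g (grp : 'I_d -> 'I_g) :
  (forall i, candidates_of grp i != set0) -> g <= d.
Proof.
move=> ne; have /fin_all_exists[f hf] : forall i, exists a, grp a = i.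
  by move=> i; have /set0Pn[a] := ne i; rewrite inE => /eqP; exists a.
have inj : injective f by move=> i j e; rewrite -(hf i) e hf.
by have := leq_card f inj; rewrite !card_ord.
Qed.

(** For g >= 2 a member of another group is missing from group i, so its size is below d. *)
Lemma gsize_base d g (grp : 'I_d -> 'I_g) i : 0 < g ->
  (forall i, candidates_of grp i != set0) -> gsize grp i < base d g.
Proof.
move=> g0 ne; have sz : size [seq nat_of_ord (grp a) | a <- enum 'I_d] = d.
  by rewrite size_map size_enum_ord.
have le : gsize grp i <= d by rewrite -[X in _ <= X]sz count_size.
rewrite /base; have [_|ng] := eqVneq g 1; first by rewrite addn1 ltnS.
rewrite addn0 ltn_neqAle le andbT -[X in _ != X]sz -all_count.
have [j nj] : exists j : 'I_g, nat_of_ord j != i.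
  have g1 : 1 < g by case: (g) g0 ng => [|[|]].
  have [->|ni] := eqVneq i 0; first by exists (Ordinal g1).
  by exists (Ordinal g0); rewrite eq_sym.
have /set0Pn[a] := ne j; rewrite inE => /eqP ga.
apply/allPn; exists (nat_of_ord (grp a)); last by rewrite /= ga.
by apply/mapP; exists a; rewrite ?mem_enum.
Qed.

Lemma pow_base d g : 0 < g -> g <= d -> base d g ^ g <= 2 * d ^ g.
Proof.
move=> g0 gd; rewrite /base; have [->|_] := eqVneq g 1; first by rewrite !expn1; lia.
by rewrite addn0 leq_pmull.
Qed.

(** Serves the case d = 1, where [trunc_log 2 d] vanishes and cannot absorb a constant: n = 1 then
    makes the work constant. *)
Lemma card_rankings_1 (rankings : seq 'S_1) : uniq rankings -> size rankings <= 1.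
Proof.
move=> un; rewrite -(card_uniqP un); apply: leq_trans (max_card _) _.
by rewrite card_Sn.
Qed.

(** N stands for [base d g ^ g], D for [d ^ g] and t for the logarithm. The terms without t are
    bounded by multiples of [n * (D * d ^ 2)], with 86 = 8 + 54 + 18 + 6. *)
Lemma loop_work_le d g N D n t : 0 < g -> g <= d -> 0 < n -> N <= 2 * D ->
  d <= D ->
  d.+1 * (d.+1 * n.+1) + n.+2 * (N.+1 * (d.+2 * g.+1) + d.+1 * d.+2
    + n.+1 * (d.+1 * t.+2) + d.+1) <=
  86 * (n * (D * d ^ 2)) + 12 * (n ^ 2 * d * t.+2).
Proof.
move=> g0 gd n0 hN dD; have d0 : 0 < d by exact: leq_trans gd.
have D0 : 0 < D by exact: leq_trans dD.
have h1 : d.+1 <= 2 * d by lia.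
have h2 : d.+2 <= 3 * d by lia.
have h3 : g.+1 <= 2 * d by lia.
have h4 : n.+2 <= 3 * n by lia.
have h5 : n.+1 <= 2 * n by lia.
have h6 : N.+1 <= 3 * D by lia.
have X1 : n * d ^ 2 <= n * (D * d ^ 2) by rewrite leq_mul2l leq_pmull ?orbT.
have X2 : n * d <= n * d ^ 2 by rewrite leq_mul2l -mulnn leq_pmulr ?orbT.
have a1 : d.+1 * (d.+1 * n.+1) <= 8 * (n * d ^ 2).
  by apply: leq_trans (leq_mul h1 (leq_mul h1 h5)) _; rewrite -mulnn; lia.
have a2 : n.+2 * (N.+1 * (d.+2 * g.+1)) <= 54 * (n * (D * d ^ 2)).
  by apply: leq_trans (leq_mul h4 (leq_mul h6 (leq_mul h2 h3))) _; rewrite -mulnn; lia.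
have a3 : n.+2 * (d.+1 * d.+2) <= 18 * (n * d ^ 2).
  by apply: leq_trans (leq_mul h4 (leq_mul h1 h2)) _; rewrite -mulnn; lia.
have a4 : n.+2 * (n.+1 * (d.+1 * t.+2)) <= 12 * (n ^ 2 * d * t.+2).
  apply: leq_trans (leq_mul h4 (leq_mul h5 (leq_mul h1 (leqnn _)))) _.
  by rewrite -[n ^ 2]mulnn; lia.
have a5 : n.+2 * d.+1 <= 6 * (n * d).
  by apply: leq_trans (leq_mul h4 h1) _; lia.
rewrite !mulnDr.
move: a1 a2 a3 a4 a5 X1 X2.
move: (n * (D * d ^ 2)) (n * d ^ 2) (n * d) (n ^ 2 * d * t.+2) => x1 x2 x3 x4.
by lia.
Qed.

Lemma total_work_le d g (rankings : seq 'S_d) : 0 < g -> g <= d ->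
  0 < size rankings -> uniq rankings ->
  total_work g rankings <= 110 * time_bound (size rankings) d g.
Proof.
move=> g0 gd n0 un; rewrite /total_work /loop_work /time_bound.
have d0 : 0 < d by exact: leq_trans gd.
have dD : d <= d ^ g by rewrite -{1}[d]expn1 leq_pexp2l.
apply: leq_trans (loop_work_le _ g0 gd n0 (pow_base g0 gd) dD) _.
rewrite expnD mulnDr.
have [d1|d1] := leqP d 1.
  have {}d1 : d = 1 by apply/eqP; rewrite eqn_leq d1.
  have n1 : size rankings = 1.
    apply/eqP; rewrite eqn_leq n0 andbT; move: rankings un {n0}; rewrite d1.
    exact: card_rankings_1.
  (* This case fixes the constant: 86 + 12 * 2 = 110. For d >= 2 the bound t + 2 <= 3 * t leaves
     room. *)
  by rewrite n1 d1 !exp1n.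
have t1 : 0 < trunc_log 2 d by rewrite trunc_log_gt0.
apply: leq_add; first by rewrite leq_mul2r orbT.
move: (_ ^ 2 * d) (trunc_log 2 d) t1 => y t t1.
apply: leq_trans (_ : 12 * (y * (3 * t)) <= _); last by lia.
by rewrite !leq_mul2l /=; apply/orP; right; lia.
Qed.

Theorem theorem6 (R : realType) :
  exists (eps : R) (prog : cmd) (C : nat),
    (0 < eps)%R /\
    forall (d g k : nat) (grp : 'I_d -> 'I_g) (lambda mu : 'I_g -> R)
           (S : {set 'S_d}) (rankings : seq 'S_d),
      (0 < g)%N ->
      (forall i : 'I_g, candidates_of grp i != set0) ->
      (forall i : 'I_g, (0 <= lambda i <= 1)%R /\ (0 <= mu i <= 1)%R) ->
      (1 <= k <= d)%N ->
      S != set0 ->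
      uniq rankings -> rankings =i S ->
      (exists s : 'S_d, fair grp lambda mu k s) ->
      exists (t : nat) (st : state) (s : 'S_d),
        exec (floor_op lambda) (ceil_op mu) (word_bound C #|S| d g)
             prog (init_state (encode_input grp k rankings)) t st /\
        (t <= C * time_bound #|S| d g)%N /\
        outputs st s /\
        approx_fair_median (3%:R - eps)%R grp lambda mu k S s.
Proof.
set sz := size_cmd p_median.
(* An opaque name for the size of the program keeps tactics from evaluating it. *)
have [sz' esz] : exists m, m = sz by exists sz.
(* 2 / 145 is 3 - 433 / 145. In C, the multiple of [sz'] pays for the compiled program; 400 pays for
   the 11 steps that set register 0 and makes the words large enough. *)
exists (2 / 145)%R, median_prog, (400 + 110 * sz'); split.
  by apply: Num.Theory.divr_gt0; rewrite Num.Theory.ltr0n.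
move=> d g k grp lambda mu S rankings g0 ne hb /andP[k0 kd] S0 un mS [s0 fs0].
have -> : S = [set s in rankings] by apply/setP => s; rewrite inE mS.
have {mS} n0 : 0 < size rankings.
  by have /set0Pn[s] := S0; rewrite -mS; case: (rankings).
rewrite (card_S un); set n := size rankings.
have gd : g <= d := groups_le ne.
have d0 : 0 < d by exact: leq_trans gd.
(* 8 * X + 14 dominates (2 * d ^ g + 2) * (d + 2) + 10, since d ^ g * d, d ^ g and d are each at
   most X. *)
pose X := n * d ^ (g + 2); pose ab := 8 * X + 14.
have NE := pow_base g0 gd.
have dD : d <= d ^ g by rewrite -{1}[d]expn1 leq_pexp2l.
have DX : d ^ g * d * n <= X.
  by rewrite /X expnD mulnC leq_mul2l leq_mul2l -mulnn leq_pmulr ?orbT.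
have D0 : 0 < d ^ g by rewrite expn_gt0 d0.
have x1 : n * d <= X by apply: leq_trans DX; rewrite mulnC leq_mul2r leq_pmull ?orbT.
have x2 : d ^ g * d <= X by apply: leq_trans DX; rewrite leq_pmulr.
have x3 : n <= X by apply: leq_trans x1; rewrite leq_pmulr.
have x4 : d <= X by apply: leq_trans x1; rewrite leq_pmull.
have x5 : d ^ g <= X by apply: leq_trans x2; rewrite leq_pmulr.
have ab_n : (n + 2) * (d + 2) + 10 <= ab by rewrite /ab; lia.
have ab_NN : (base d g ^ g + 2) * (d + 2) + 10 <= ab.
  apply: leq_trans (_ : (2 * d ^ g + 2) * (d + 2) + 10 <= _).
    by rewrite leq_add2r leq_mul2r leq_add2r NE orbT.
  by rewrite /ab; lia.
pose lim := 4 + d + n * d.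
set C := 400 + _.
have C2 : 400 <= C by exact: leq_addr.
have wb_large : lim + nzones * ab.+1 <= word_bound C n d g.
  rewrite /word_bound -/X; apply: leq_trans (_ : (C + X) ^ 2 <= _); last first.
    by rewrite leq_pexp2l //; lia.
  rewrite /lim /ab /nzones -mulnn; move: x1 x4 C2; clear; nia.
have fair_ex : exists s, fair_perm (floor_op lambda) (ceil_op mu) k grp s.
  by exists s0; exact: (fair_wordP grp k s0 hb).1 fs0.
have gsz i : gsize grp i < base d g by exact: gsize_base.
have [t [st' [ast [ex tle sm _]]]] := p_median_ok wb_large g0 gd k0 kd erefl ab_n ab_NN
  gsz un n0 fair_ex (start_initial k grp rankings) erefl (start_sim k grp rankings).
move=> [f [tau [del [hout ff [hgr hun] htau [hS [ft [fft ftc ftb]]]]]]].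
have hfair s : fair_perm (floor_op lambda) (ceil_op mu) k grp s <-> fair grp lambda mu k s.
  exact: iff_sym (fair_wordP grp k s hb).
exists (11 + t), st', f; split.
  apply: ExecSeq ex.
  have -> : 4 + d + size rankings * d = eval (floor_op lambda) (ceil_op mu)
      (init_state (encode_input grp k rankings))
      (Bin Add (Const 4) (Bin Add (Read (Const 1)) (Bin Mul (Read (Const 0)) (Read (Const 1))))).
    by rewrite /= addnA.
  apply: ExecAssign; rewrite /= addnA; apply: leq_trans wb_large; rewrite /lim /nzones -/n.
  lia.
split.
  have T1 : 0 < time_bound n d g.
    by rewrite /time_bound addn_gt0 muln_gt0 n0 expn_gt0 d0.
  rewrite /C mulnDl esz; apply: leq_add; first by apply: leq_trans (leq_pmulr _ T1).
  apply: leq_trans tle _; rewrite -/sz [110 * _]mulnC -mulnA leq_mul2l.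
  by rewrite total_work_le ?orbT.
split.
  move=> p; case: sm => _ _ low _; rewrite low ?hout //.
  by have := ltn_ord p; lia.
split; first exact/hfair.
move=> opt [fopt _].
(* [K] fixes for every ranking a largest set on which it agrees with [opt]. *)
have [K K_agree K_ulam] := fin_all_exists2 (fun s => ulam_agree_ex s opt).
have fo : fair_perm (floor_op lambda) (ceil_op mu) k grp opt by exact/hfair.
have S_gt0 : 0 < #|[set s in rankings]| by rewrite (card_S un).
suff : 145 * median_cost [set s in rankings] f <= 433 * median_cost [set s in rankings] opt.
  move: (median_cost _ _) (median_cost _ _) => y x xy.
  have : ((145 * x)%N%:R <= (433 * y)%N%:R :> R)%R by rewrite Num.Theory.ler_nat.
  by rewrite !GRing.natrM; lra.
apply: (best_approx S_gt0 K_agree K_ulam (tau := tau) (f := ft)) => //.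
- move=> s; rewrite inE => /hS[h [h1 h2 h3]]; exists h => //; exact: h2.
- exact: ftc.
exact: (relative_order_ulam S_gt0 K_agree hun hgr htau).
Qed.
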